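(* Suppose that $\kappa_2\equiv\kappa_1-1\pmod e$ and $n\equiv 0\pmod e$. Then 1. $\operatorname{im}(\phi_m)$ is an irreducible $\mathscr H_n^\Lambda$-module for all $m\in\{1,\dots,n-1\}$, and 2. $\ker(\gamma_m)/\operatorname{im}(\phi_m)$ is an irreducible $\mathscr H_n^\Lambda$-module for all $m\in\{2,\dots,n-1\}$.
   Context: Let $\mathbb F$ be a field, $e\geqslant 3$ an integer, $I=\mathbb Z/e\mathbb Z$, $n\geqslant 1$ an integer and $\kappa=(\kappa_1,\kappa_2)\in I^2$. For $i,j\in I$ write $i\to j$ if $j=i+1$ and $i\leftarrow j$ if $j=i-1$. The symmetric group $\mathfrak S_n$, with $s_r=(r,r+1)$, acts on $I^n$ by place permutations. Algebra. $\mathscr H_n$ is the unital associative $\mathbb F$-algebra with generators $e(\mathbf i)$ ($\mathbf i\in I^n$), $y_1,\dots,y_n$, $\psi_1,\dots,\psi_{n-1}$ and relations: $e(\mathbf i)e(\mathbf j)=\delta_{\mathbf i,\mathbf j}e(\mathbf i)$; $\sum_{\mathbf i}e(\mathbf i)=1$; $y_re(\mathbf i)=e(\mathbf i)y_r$; $\psi_re(\mathbf i)=e(s_r\mathbf i)\psi_r$; $y_ry_s=y_sy_r$; $\psi_ry_s=y_s\psi_r$ if $s\ne r,r+1$; $\psi_r\psi_s=\psi_s\psi_r$ if $|r-s|>1$; $\psi_ry_{r+1}e(\mathbf i)=(y_r\psi_r+\delta_{i_r,i_{r+1}})e(\mathbf i)$; $y_{r+1}\psi_re(\mathbf i)=(\psi_ry_r+\delta_{i_r,i_{r+1}})e(\mathbf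 i)$; $\psi_r^2e(\mathbf i)$ equals $0$ if $i_r=i_{r+1}$, $(y_{r+1}-y_r)e(\mathbf i)$ if $i_r\to i_{r+1}$, $(y_r-y_{r+1})e(\mathbf i)$ if $i_r\leftarrow i_{r+1}$, and $e(\mathbf i)$ otherwise; $\psi_r\psi_{r+1}\psi_re(\mathbf i)$ equals $(\psi_{r+1}\psi_r\psi_{r+1}+1)e(\mathbf i)$ if $i_{r+2}=i_r\to i_{r+1}$, $(\psi_{r+1}\psi_r\psi_{r+1}-1)e(\mathbf i)$ if $i_{r+2}=i_r\leftarrow i_{r+1}$, and $\psi_{r+1}\psi_r\psi_{r+1}e(\mathbf i)$ otherwise. The cyclotomic algebra $\mathscr H_n^\Lambda$ (level 2) is the quotient of $\mathscr H_n$ by the relations $y_1^{c(i_1)}e(\mathbf i)=0$ for all $\mathbf i\in I^n$, where $c(i)=\#\{j\in\{1,2\}:\kappa_j=i\}$. Specht modules labelled by hook bipartitions. For $0\leqslant m\leqslant n$ put $\mathbf i_{((n-m),(1^m))}=(\kappa_2,\kappa_2-1,\dots,\kappa_2-m+1,\kappa_1,\kappa_1+1,\dots,\kappa_1+n-m-1)\in I^n$. $S_{((n-m),(1^m))}$ is the module generated by $z=z_{((n-m),(1^m))}$ subject only to $e(\mathbf i_{((n-m),(1^m))})z=z$, $y_rz=0$ for $1\leqslant r\leqslant n$, and $\psi_rz=0$ for all $r\in\{1,\dots,n-1\}\setminus\{m\}$; it is an $\mathscr H_n^\Lambda$-module. For $1\leqslant a_1<\dots<a_m\leqslant n$ define $v(a_1,\dots,a_m)=(\psi_{a_1-1}\cdots\psi_1)(\psi_{a_2-1}\cdots\psi_2)\cdots(\psi_{a_m-1}\cdots\psi_m)z$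 (indices decreasing in each factor; the factor is $1$ if $a_j=j$). These form an $\mathbb F$-basis (standard basis) of $S_{((n-m),(1^m))}$. The Specht module $S_{((n-m,1^m),\varnothing)}$. For $0\leqslant m\leqslant n-1$ put $\mathbf j=(\kappa_1,\kappa_1-1,\dots,\kappa_1-m,\kappa_1+1,\kappa_1+2,\dots,\kappa_1+n-m-1)\in I^n$. $S_{((n-m,1^m),\varnothing)}$ is the module generated by $z=z_{((n-m,1^m),\varnothing)}$ subject only to $e(\mathbf j)z=z$, $y_rz=0$ for $1\leqslant r\leqslant n$, $\psi_rz=0$ for $r\in\{1,\dots,n-1\}\setminus\{m+1\}$, and, if $m\leqslant n-2$, $\psi_1\psi_2\cdots\psi_{m+1}z=0$; it is an $\mathscr H_n^\Lambda$-module. Homomorphisms. Assume $\kappa_2\equiv\kappa_1-1$ and $n\equiv 0\pmod e$ (so $n\equiv\kappa_2-\kappa_1+1$). The following are well-defined $\mathscr H_n^\Lambda$-homomorphisms. For $0\leqslant m\leqslant n-1$, $\gamma_m:S_{((n-m),(1^m))}\to S_{((n-m-1),(1^{m+1}))}$ with $\gamma_m(z_{((n-m),(1^m))})=v(1,\dots,m,n)$. For $1\leqslant m\leqslant n-1$, $\phi_m:S_{((n-m+1,1^{m-1}),\varnothing)}\to S_{((n-m),(1^m))}$ with $\phi_m(z_{((n-m+1,1^{m-1}),\varnothing)})=v(2,\dots,m,n)$. One has $\operatorname{im}(\phi_m)\subseteq\ker(\gamma_m)$. *)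

(* Defs.v *)
From HB Require Import structures.
From mathcomp Require Import all_boot all_order all_algebra.
From mathcomp Require Import boolp.
From mathcomp.multinomials Require Import monalg.

Set Implicit Arguments.
Unset Strict Implicit.
Unset Printing Implicit Defensive.

Import GRing.Theory.
Local Open Scope ring_scope.
Local Open Scope quotient_scope.

(* The library only has ring quotients by proper ideals of commutative rings.
   Here the ideal is the two-sided one generated by S, and the quotient may a
   priori be zero, whence [pzRingType] rather than [nzRingType] or [algType]. *)

Section RingQuotient.
Variables (R : pzRingType) (S : R -> Prop).

Inductive ideal_span : R -> Prop :=
| ideal_span0 : ideal_span 0
| ideal_spanD x a s b : ideal_span x -> S s -> ideal_span (x + a * s * b).

Definition ideal_gen : {pred R} := fun x => `[< ideal_span x >].

Lemma ideal_spanDD x y : ideal_span x -> ideal_span y -> ideal_span (x + y).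
Proof.
move=> Ix; elim=> [|y' a s b _ IH Ss]; first by rewrite addr0.
by rewrite addrA; apply: ideal_spanD.
Qed.

Lemma ideal_spanMl c x : ideal_span x -> ideal_span (c * x).
Proof.
elim=> [|y a s b _ IH Ss]; first by rewrite mulr0; constructor.
by rewrite mulrDr 2!mulrA; apply: ideal_spanD.
Qed.

Lemma ideal_spanMr c x : ideal_span x -> ideal_span (x * c).
Proof.
elim=> [|y a s b _ IH Ss]; first by rewrite mul0r; constructor.
by rewrite mulrDl -mulrA; apply: ideal_spanD.
Qed.

Lemma ideal_gen_zmod_closed : zmod_closed ideal_gen.
Proof.
split=> [|x y /asboolP Ix /asboolP Iy]; apply/asboolP; first by constructor.
by apply: ideal_spanDD => //; rewrite -mulN1r; apply: ideal_spanMl.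
Qed.

HB.instance Definition _ :=
  GRing.isZmodClosed.Build R ideal_gen ideal_gen_zmod_closed.

Definition ring_quot : Type := Quotient.quot ideal_gen.

HB.instance Definition _ := GRing.Zmodule.on ring_quot.

Definition rpi (x : R) : ring_quot := \pi_(Quotient.quot ideal_gen) x.

Lemma rpi_surj (u : ring_quot) : rpi (repr (u : Quotient.quot ideal_gen)) = u.
Proof. exact: reprK. Qed.

Lemma rpiP x y : rpi x = rpi y <-> ideal_span (x - y).
Proof.
split=> [/eqP|Ixy].
  by rewrite /rpi -[_ == _]Quotient.idealrBE => /asboolP.
by apply/eqP; rewrite /rpi -[_ == _]Quotient.idealrBE; apply/asboolP.
Qed.

Lemma rpiD : {morph rpi : x y / x + y}.
Proof. by move=> x y; rewrite /rpi !piE. Qed.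

Definition ring_quot_mul (u v : ring_quot) : ring_quot :=
  rpi (repr (u : Quotient.quot ideal_gen) * repr (v : Quotient.quot ideal_gen)).

Lemma rpiM x y : rpi (x * y) = ring_quot_mul (rpi x) (rpi y).
Proof.
apply/rpiP; set x' := repr _; set y' := repr _.
have /rpiP Hx : rpi x = rpi x' by rewrite rpi_surj.
have /rpiP Hy : rpi y = rpi y' by rewrite rpi_surj.
have -> : x * y - x' * y' = (x - x') * y + x' * (y - y').
  by rewrite mulrBl mulrBr addrA subrK.
by apply: ideal_spanDD; [apply: ideal_spanMr | apply: ideal_spanMl].
Qed.

Fact ring_quot_mulA : associative ring_quot_mul.
Proof.
move=> u v w; rewrite -[u]rpi_surj -[v]rpi_surj -[w]rpi_surj.
by rewrite -!rpiM mulrA.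
Qed.
Fact ring_quot_mul1 : left_id (rpi 1) ring_quot_mul.
Proof. by move=> u; rewrite -[u]rpi_surj -!rpiM mul1r. Qed.
Fact ring_quot_mulr1 : right_id (rpi 1) ring_quot_mul.
Proof. by move=> u; rewrite -[u]rpi_surj -!rpiM mulr1. Qed.
Fact ring_quot_mulDl : left_distributive ring_quot_mul +%R.
Proof.
move=> u v w; rewrite -[u]rpi_surj -[v]rpi_surj -[w]rpi_surj.
by rewrite -!(rpiM, rpiD) mulrDl.
Qed.
Fact ring_quot_mulDr : right_distributive ring_quot_mul +%R.
Proof.
move=> u v w; rewrite -[u]rpi_surj -[v]rpi_surj -[w]rpi_surj.
by rewrite -!(rpiM, rpiD) mulrDr.
Qed.

HB.instance Definition _ := GRing.Zmodule_isPzRing.Build ring_quot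
  ring_quot_mulA ring_quot_mul1 ring_quot_mulr1 ring_quot_mulDl ring_quot_mulDr.

Fact rpi_is_zmod_morphism : zmod_morphism rpi.
Proof. by move=> x y; rewrite /rpi !piE. Qed.
Fact rpi_is_monoid_morphism : monoid_morphism rpi.
Proof. by split=> // x y; rewrite rpiM. Qed.
HB.instance Definition _ := GRing.isZmodMorphism.Build R ring_quot rpi
  rpi_is_zmod_morphism.
HB.instance Definition _ := GRing.isMonoidMorphism.Build R ring_quot rpi
  rpi_is_monoid_morphism.

End RingQuotient.

Section SubModule.
Variables (R : pzRingType) (M : lmodType R).

Inductive submod_span (S : M -> Prop) : M -> Prop :=
| submod_span0 : submod_span S 0
| submod_spanD x a s : submod_span S x -> S s -> submod_span S (x + a *: s).

Definition submod_gen (S : M -> Prop) : {pred M} := fun x => `[< submod_span S x >].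

Fact submod_gen_closed S : submod_closed (submod_gen S).
Proof.
split=> [|c x y /asboolP Sx /asboolP Sy]; apply/asboolP; first by constructor.
elim: Sx => [|u a s _ IH Ss]; first by rewrite scaler0 add0r.
by rewrite scalerDr addrAC scalerA; apply: submod_spanD.
Qed.
HB.instance Definition _ S := GRing.isSubmodClosed.Build R M (submod_gen S)
  (submod_gen_closed S).

Definition submod (K : submodClosed M) : Type := {x : M | x \in K}.

Variable K : submodClosed M.
HB.instance Definition _ := SubChoice.on (submod K).
HB.instance Definition _ :=
  GRing.SubChoice_isSubLmodule.Build R M (fun x => x \in K) (submod K)
    (GRing.subsemimodClosedP K).

Definition submod_zmod : {pred M} := K.
HB.instance Definition _ := GRing.isZmodClosed.Build M submod_zmod
  (GRing.submod_closedB (GRing.submodClosedP K)).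

Definition mod_quot : Type := Quotient.quot submod_zmod.
HB.instance Definition _ := GRing.Zmodule.on mod_quot.

Definition mpi (x : M) : mod_quot := \pi_(Quotient.quot submod_zmod) x.

Lemma mpi_surj (u : mod_quot) : mpi (repr (u : Quotient.quot submod_zmod)) = u.
Proof. exact: reprK. Qed.

Lemma mpiP x y : mpi x = mpi y <-> x - y \in K.
Proof.
split=> [/eqP|Kxy]; first by rewrite /mpi -[_ == _]Quotient.idealrBE.
by apply/eqP; rewrite /mpi -[_ == _]Quotient.idealrBE.
Qed.

Lemma mpiD : {morph mpi : x y / x + y}.
Proof. by move=> x y; rewrite /mpi !piE. Qed.

Definition mod_quot_scale (a : R) (u : mod_quot) : mod_quot :=
  mpi (a *: repr (u : Quotient.quot submod_zmod)).

Lemma mpiZ a x : mpi (a *: x) = mod_quot_scale a (mpi x).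
Proof.
apply/mpiP; rewrite -scalerBr rpredZ //; apply/mpiP.
by rewrite mpi_surj.
Qed.

Fact mod_quot_scaleA a b u :
  mod_quot_scale a (mod_quot_scale b u) = mod_quot_scale (a * b) u.
Proof. by rewrite -[u]mpi_surj -!mpiZ scalerA. Qed.
Fact mod_quot_scale1 : left_id 1 mod_quot_scale.
Proof. by move=> u; rewrite -[u]mpi_surj -mpiZ scale1r. Qed.
Fact mod_quot_scaleDr : right_distributive mod_quot_scale +%R.
Proof.
by move=> a u v; rewrite -[u]mpi_surj -[v]mpi_surj -!(mpiZ, mpiD) scalerDr.
Qed.
Fact mod_quot_scaleDl u : {morph mod_quot_scale^~ u : a b / a + b}.
Proof. by move=> a b; rewrite -[u]mpi_surj -!(mpiZ, mpiD) scalerDl. Qed.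

HB.instance Definition _ := GRing.Zmodule_isLmodule.Build R mod_quot
  mod_quot_scaleA mod_quot_scale1 mod_quot_scaleDr mod_quot_scaleDl.

Fact mpi_is_zmod_morphism : zmod_morphism mpi.
Proof. by move=> x y; rewrite /mpi !piE. Qed.
Fact mpi_is_scalable : scalable mpi.
Proof. by move=> a x; rewrite mpiZ. Qed.
HB.instance Definition _ := GRing.isZmodMorphism.Build M mod_quot mpi
  mpi_is_zmod_morphism.
HB.instance Definition _ := GRing.isScalable.Build R M mod_quot *:%R mpi
  mpi_is_scalable.

End SubModule.

(* A [submodClosed] is a boolean predicate, but classically every submodule is
   of this form. *)
Definition irreducible_module (R : pzRingType) (M : lmodType R) : Prop :=
  (exists x : M, x != 0) /\
  forall U : submodClosed M,
    (forall x, x \in U -> x = 0) \/ (forall x, x \in U).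

Section KerIm.
Variables (R : pzRingType) (M N : lmodType R) (f : {linear M -> N}).

Definition lin_ker : {pred M} := fun x => f x == 0.
Definition lin_im : {pred N} := fun y => `[< exists x, f x = y >].

Fact lin_ker_closed : submod_closed lin_ker.
Proof.
split=> [|a x y]; rewrite !unfold_in; first by rewrite linear0.
by move=> /eqP fx /eqP fy; rewrite linearP fx fy scaler0 addr0.
Qed.
HB.instance Definition _ := GRing.isSubmodClosed.Build R M lin_ker
  lin_ker_closed.

Fact lin_im_closed : submod_closed lin_im.
Proof.
split=> [|a x y]; first by apply/asboolP; exists 0; rewrite linear0.
move=> /asboolP[u <-] /asboolP[v <-].
by apply/asboolP; exists (a *: u + v); rewrite linearP.
Qed.
HB.instance Definition _ := GRing.isSubmodClosed.Build R N lin_im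
  lin_im_closed.

End KerIm.

Section SubQuotient.
Variables (R : pzRingType) (M : lmodType R) (K L : submodClosed M).

Definition restr_submod : {pred submod K} := fun x => val x \in L.

Fact restr_submod_closed : submod_closed restr_submod.
Proof.
have memE x : (x \in restr_submod) = (val x \in L) by [].
split=> [|a x y]; rewrite !memE ?linear0 ?rpred0 // => Lx Ly.
by rewrite linearP rpredD ?rpredZ.
Qed.
HB.instance Definition _ := GRing.isSubmodClosed.Build R (submod K) restr_submod
  restr_submod_closed.

(* The quotient K / L, for submodules L <= K of M. *)
Definition subquot : Type := mod_quot restr_submod.
HB.instance Definition _ := GRing.Lmodule.on subquot.

End SubQuotient.

Section KLR.
Variables (F : fieldType) (e n : nat).

(* Indices of y and psi, and positions in a residue sequence, are 1-based. *)
Definition klr_gen : choiceType :=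
  (n.-tuple 'Z_e + {r : nat | (1 <= r <= n)%N} + {r : nat | (1 <= r < n)%N})%type.

(* The free F-algebra on the generators; the scalars F are central in it, so
   modules over its quotients are F-vector spaces and submodules are subspaces. *)
Definition klr_free := {malg F[{fmonom klr_gen}]}.

Definition free_gen (g : klr_gen) : klr_free := << fmu g >>.
Definition free_e (i : n.-tuple 'Z_e) : klr_free := free_gen (inl (inl i)).
(* The value 0 is junk, for indices out of range. *)
Definition free_y (r : nat) : klr_free :=
  if insub r is Some r' then free_gen (inl (inr r')) else 0.
Definition free_psi (r : nat) : klr_free :=
  if insub r is Some r' then free_gen (inr r') else 0.

Definition residue (i : n.-tuple 'Z_e) (r : nat) : 'Z_e := nth 0 i r.-1.

Definition seq_of_residues (f : nat -> 'Z_e) : n.-tuple 'Z_e :=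
  [tuple f k.+1 | k < n].

Definition swap_residues (r : nat) (i : n.-tuple 'Z_e) : n.-tuple 'Z_e :=
  seq_of_residues (fun k => residue i
    (if k == r then r.+1 else if k == r.+1 then r else k)).

Local Notation "''e' ( i )" := (free_e i) (format "''e' ( i )").
Local Notation "''y_' r" := (free_y r) (at level 8, r at level 2).
Local Notation "''psi_' r" := (free_psi r) (at level 8, r at level 2).
Local Notation "''delta' ( a , b )" := ((a == b)%:R : klr_free).

Inductive klr_rel : klr_free -> klr_free -> Prop :=
| klr_e_e i j : klr_rel ('e(i) * 'e(j)) ('delta(i, j) * 'e(i))
| klr_e_sum : klr_rel (\sum_i 'e(i)) 1
| klr_y_e r i : (1 <= r <= n)%N -> klr_rel ('y_r * 'e(i)) ('e(i) * 'y_r)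
| klr_psi_e r i : (1 <= r < n)%N ->
    klr_rel ('psi_r * 'e(i)) ('e(swap_residues r i) * 'psi_r)
| klr_y_y r s : (1 <= r <= n)%N -> (1 <= s <= n)%N ->
    klr_rel ('y_r * 'y_s) ('y_s * 'y_r)
| klr_psi_y_far r s : (1 <= r < n)%N -> (1 <= s <= n)%N ->
    s != r -> s != r.+1 -> klr_rel ('psi_r * 'y_s) ('y_s * 'psi_r)
| klr_psi_psi_far r s : (1 <= r < n)%N -> (1 <= s < n)%N ->
    (r.+1 < s)%N || (s.+1 < r)%N -> klr_rel ('psi_r * 'psi_s) ('psi_s * 'psi_r)
| klr_psi_y r i : (1 <= r < n)%N ->
    klr_rel ('psi_r * 'y_r.+1 * 'e(i))
      (('y_r * 'psi_r + 'delta(residue i r, residue i r.+1)) * 'e(i))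
| klr_y_psi r i : (1 <= r < n)%N ->
    klr_rel ('y_r.+1 * 'psi_r * 'e(i))
      (('psi_r * 'y_r + 'delta(residue i r, residue i r.+1)) * 'e(i))
| klr_psi2 r i : (1 <= r < n)%N ->
    klr_rel ('psi_r ^+ 2 * 'e(i))
      (let a := residue i r in let b := residue i r.+1 in
       if a == b then 0
       else if b == a + 1 then ('y_r.+1 - 'y_r) * 'e(i)
       else if b == a - 1 then ('y_r - 'y_r.+1) * 'e(i)
       else 'e(i))
| klr_braid r i : (1 <= r)%N -> (r.+1 < n)%N ->
    klr_rel ('psi_r * 'psi_r.+1 * 'psi_r * 'e(i))
      (let a := residue i r in let b := residue i r.+1 in
       let t := 'psi_r.+1 * 'psi_r * 'psi_r.+1 in
       if (residue i r.+2 == a) && (b == a + 1) then (t + 1) * 'e(i)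
       else if (residue i r.+2 == a) && (b == a - 1) then (t - 1) * 'e(i)
       else t * 'e(i)).

(* The affine algebra H_n. *)
Definition klr_alg : pzRingType :=
  ring_quot (fun x : klr_free => exists u v, klr_rel u v /\ x = u - v).

Definition klr_pi (x : klr_free) : klr_alg := rpi _ x.

Variables k1 k2 : 'Z_e.

Definition charge_mult (a : 'Z_e) : nat := ((k1 == a) + (k2 == a))%N.

(* The cyclotomic quotient H_n^Lambda. *)
Definition cyc_alg : pzRingType :=
  ring_quot (fun x : klr_alg => exists i : n.-tuple 'Z_e,
    x = klr_pi ('y_1 ^+ charge_mult (residue i 1) * 'e(i))).

Definition cyc_pi (x : klr_free) : cyc_alg := rpi _ (klr_pi x).
Definition cyc_e i := cyc_pi (free_e i).
Definition cyc_y r := cyc_pi (free_y r).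
Definition cyc_psi r := cyc_pi (free_psi r).

(* The left module generated by one generator z subject only to the relations
   a *: z = 0 for a in S, realised as the quotient of the left regular module. *)
Section Cyclic.
Variable S : cyc_alg -> Prop.

Definition cyclic_module : lmodType cyc_alg :=
  mod_quot (submod_gen (S : cyc_alg^o -> Prop)).

Definition cyclic_gen : cyclic_module := mpi _ (1 : cyc_alg^o).
End Cyclic.

(* S_((n-m),(1^m)), for 0 <= m <= n. *)

Definition hook2_residues (m : nat) : n.-tuple 'Z_e :=
  seq_of_residues (fun r =>
    if (r <= m)%N then k2 - (r - 1)%:R else k1 + (r - m - 1)%:R).

Inductive hook2_rel (m : nat) : cyc_alg -> Prop :=
| hook2_e : hook2_rel m (cyc_e (hook2_residues m) - 1)
| hook2_y r : (1 <= r <= n)%N -> hook2_rel m (cyc_y r)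
| hook2_psi r : (1 <= r < n)%N -> r != m -> hook2_rel m (cyc_psi r).

Definition hook2_specht (m : nat) : lmodType cyc_alg :=
  cyclic_module (hook2_rel m).
Definition hook2_gen (m : nat) : hook2_specht m := cyclic_gen (hook2_rel m).

(* psi_(a-1) ... psi_(j+1) psi_j *)
Definition psi_down (a j : nat) : cyc_alg :=
  \prod_(r <- rev (index_iota j a)) cyc_psi r.

(* v(a_1, ..., a_m), for s = [:: a_1; ...; a_m] *)
Definition hook2_v (m : nat) (s : seq nat) : hook2_specht m :=
  (\prod_(1 <= j < m.+1) psi_down (nth 0%N s j.-1) j) *: hook2_gen m.

(* S_((n-m,1^m),0), for 0 <= m <= n-1. *)

Definition hook1_residues (m : nat) : n.-tuple 'Z_e :=
  seq_of_residues (fun r =>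
    if (r <= m.+1)%N then k1 - (r - 1)%:R else k1 + (r - m - 1)%:R).

Inductive hook1_rel (m : nat) : cyc_alg -> Prop :=
| hook1_e : hook1_rel m (cyc_e (hook1_residues m) - 1)
| hook1_y r : (1 <= r <= n)%N -> hook1_rel m (cyc_y r)
| hook1_psi r : (1 <= r < n)%N -> r != m.+1 -> hook1_rel m (cyc_psi r)
| hook1_garnir : (m.+2 <= n)%N ->
    hook1_rel m (\prod_(1 <= r < m.+2) cyc_psi r).

Definition hook1_specht (m : nat) : lmodType cyc_alg :=
  cyclic_module (hook1_rel m).
Definition hook1_gen (m : nat) : hook1_specht m := cyclic_gen (hook1_rel m).

(* z generates its module, so there is at most one such homomorphism. *)
Definition is_gamma (m : nat)
    (g : {linear hook2_specht m -> hook2_specht m.+1}) : Prop :=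
  g (hook2_gen m) = hook2_v m.+1 (rcons (index_iota 1 m.+1) n).

Definition is_phi (m : nat)
    (f : {linear hook1_specht m.-1 -> hook2_specht m}) : Prop :=
  f (hook1_gen m.-1) = hook2_v m (rcons (index_iota 2 m.+1) n).

End KLR.

(* Main.v *)
(* The standard basis of S_((n-m),(1^m)) is indexed by paths with n steps, m of
   which are legs (the positions a_1 < ... < a_m, encoded as true) and n - m of
   which are arms (false). When kappa2 = kappa1 - 1 the generators act on this
   basis by local moves depending only on residues mod e of the position:
   psi_r replaces leg-arm by arm-leg at (r, r+1); it also replaces arm-leg by
   leg-arm when r is not 0, 1, -1 mod e, and for r = 1 (resp. -1) it replaces
   A x L by L x A, up to sign, at r-1, r, r+1 (resp. r, r+1, r+2); y_r and
   y_(r+1) replace arm-leg by -+ leg-arm at (r, r+1) when e divides r. That these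
   rules satisfy the defining relations is a finite check, so they give a module
   on which one sees that the vectors v(a_1,...,a_m) are independent; that they
   span is an induction on length.
   Since e divides n, the last step has the same residue whether it is an arm or
   a leg. So gamma_m turns a final arm into a leg, its kernel has as basis the
   paths ending with a leg, and the image of phi_m the paths that moreover start
   with an arm. Each of the two subquotients is thus spanned by the paths with
   prescribed first and last step. It is irreducible: the y_r with e | r and the
   e(i) bring any nonzero vector to a multiple of a single path, and the psi_r
   connect any two such paths. *)

Require Import Defs.
From HB Require Import structures.
From mathcomp Require Import all_boot all_order all_algebra.
From mathcomp Require Import zify ring boolp.
From mathcomp.multinomials Require Import monalg.

Set Implicit Arguments.
Unset Strict Implicit.
Unset Printing Implicit Defensive.

Import GRing.Theory.

(** * Local rules on words of steps *)

(** One representation, on the span of all words of [n] steps, serves every m: the rules preserve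
    the number of legs, so each Specht module is modelled by a block of it and gamma_m becomes a map
    between two blocks. Since the rules see only which positions [e] divides, each relation concerns
    a few consecutive steps and reduces to booleans, uniformly in [e] and [n]. The three-step rules
    are forced. If [e] divides r-1, then psi_r on A A L is psi_r^2 on A L A, which is y_(r+1) - y_r,
    and y_r acts there through the multiple r-1 of [e]; on A L L the value comes from the braid
    relation. The case of r+1 is symmetric. Residues alone do not separate paths: exchanging arm and
    leg at (r, r+1) with [e] dividing r leaves them unchanged. These are exactly the swaps made by
    y_r, so the y_r must act before an idempotent can isolate a path. Independence needs no
    computation inside the Specht module: a map to the model sends its standard vectors to distinct
    basis vectors. *)

Local Notation signed_word := (option (bool * seq bool)).

(* A rule sends the steps at r-1, r, r+1, r+2 to a signed word or to zero (None);
   the sign true is -1. The booleans z1, z0, zm say whether e divides r-1, r, r+1. *)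
Definition psi_rule (z1 z0 zm : bool) (w : seq bool) : signed_word :=
  if w is [:: a; b; c; d] then
    if b && ~~ c then Some (false, [:: a; c; b; d])
    else if z1 then
      if ~~ a && c then Some (~~ b, [:: true; b; false; d]) else None
    else if zm then
      if ~~ b && d then Some (~~ c, [:: a; true; c; false]) else None
    else if z0 then None
    else if ~~ b && c then Some (false, [:: a; c; b; d]) else None
  else None.

Definition y_rule (z1 z0 zm : bool) (w : seq bool) : signed_word :=
  if w is [:: a; b; c; d] then
    if [&& z0, ~~ b & c] then Some (true, [:: a; true; false; d])
    else if [&& z1, ~~ a & b] then Some (false, [:: true; false; c; d])
    else None
  else None.

Local Notation rule := (bool -> bool -> bool -> seq bool -> signed_word).

(* The rule at offset j of a longer word w; zs lists which positions are divisible
   by e, with the same origin as w. *)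
Definition local_rule (R : rule) (zs : seq bool) (j : nat) (w : seq bool)
    : signed_word :=
  omap (fun p => (p.1, take j w ++ p.2 ++ drop (j + 4) w))
    (R (nth false zs j) (nth false zs j.+1) (nth false zs j.+2)
      (take 4 (drop j w))).

Definition then_rule (R : rule) zs j (o : signed_word) : signed_word :=
  if o is Some p then omap (fun q => (p.1 (+) q.1, q.2)) (local_rule R zs j p.2)
  else None.

(* Two multiples of e >= 3 are never at distance 1 or 2. *)
Fixpoint spaced (zs : seq bool) :=
  if zs is z :: zs' then
    (z ==> ~~ nth false zs' 0 && ~~ nth false zs' 1) && spaced zs'
  else true.

Fixpoint all_words (n : nat) (P : seq bool -> bool) : bool :=
  if n is n'.+1 then
    all_words n' (fun w => P (true :: w)) && all_words n' (fun w => P (false :: w))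
  else P [::].

Lemma all_wordsP n P w : all_words n P -> size w = n -> P w.
Proof.
elim: n P w => [|n IH] P [|b w] //= /andP[Pt Pf] [sz_w].
by case: b; [apply: IH Pt _|apply: IH Pf _].
Qed.

Lemma all_words2P m n (P : seq bool -> seq bool -> bool) zs w :
  all_words m (fun zs => spaced zs ==> all_words n (P zs)) ->
  spaced zs -> size zs = m -> size w = n -> P zs w.
Proof.
by move=> H sp szz szw; move: (all_wordsP H szz); rewrite sp => /all_wordsP; apply.
Qed.

Definition commute_at (R R' : rule) j zs w :=
  then_rule R' zs j (local_rule R zs 0 w)
  == then_rule R zs 0 (local_rule R' zs j w).

Definition preserves_size (R : rule) := forall z1 z0 zm w p,
  R z1 z0 zm w = Some p -> size p.2 = 4.

Lemma psi_rule_size : preserves_size psi_rule.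
Proof.
move=> z1 z0 zm [|a [|b [|c [|d [|? ?]]]]] // [s w'].
by case: z1; case: z0; case: zm; case: a; case: b; case: c; case: d => //= -[_ <-].
Qed.

Lemma y_rule_size : preserves_size y_rule.
Proof.
move=> z1 z0 zm [|a [|b [|c [|d [|? ?]]]]] // [s w'].
by case: z1; case: z0; case: zm; case: a; case: b; case: c; case: d => //= -[_ <-].
Qed.

(** From offset 4 on the two windows are disjoint, so neither rule changes a letter read by the
    other. *)
Lemma commute_far (R R' : rule) j zs w : preserves_size R -> preserves_size R' ->
  (4 <= j)%N -> (j + 4 <= size w)%N -> commute_at R R' j zs w.
Proof.
move=> szR szR' le4j lejw.
have [w0 [w1 [w2 [-> sz0 sz1]]]] : exists w0 w1 w2 : seq bool,
    [/\ w = w0 ++ w1 ++ w2, size w0 = 4 & size w1 = j - 4].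
  exists (take 4 w), (take (j - 4) (drop 4 w)), (drop (j - 4) (drop 4 w)).
  by split; rewrite ?cat_take_drop // size_takel ?size_drop; lia.
have Ej : j = size (w0 ++ w1) by rewrite size_cat; lia.
have D j' (u v x : seq bool) : size u = j' -> drop j' (u ++ v) = v.
  by move=> <-; rewrite drop_size_cat.
have E0 u v : size u = 4 -> local_rule R zs 0 (u ++ v) =
    omap (fun p => (p.1, p.2 ++ v)) (R (nth false zs 0) (nth false zs 1) (nth false zs 2) u).
  by move=> szu; rewrite /local_rule take0 drop0 add0n take_size_cat // drop_size_cat.
have E1 u v x : size u = 4 -> size v = j - 4 -> local_rule R' zs j (u ++ v ++ x) =
    omap (fun p => (p.1, u ++ v ++ p.2 ++ drop 4 x))
     (R' (nth false zs j) (nth false zs j.+1) (nth false zs j.+2) (take 4 x)).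
  move=> szu szv; rewrite /local_rule catA take_size_cat ?size_cat; last by lia.
  rewrite ![drop j _]drop_size_cat ?size_cat; [|lia..].
  rewrite [(j + 4)%N]addnC -drop_drop drop_size_cat ?size_cat; last by lia.
  by case: (R' _ _ _ _) => //= p; rewrite !catA.
rewrite /commute_at E0 // E1 //.
case EA: (R _ _ _ _) => [[s u]|]; case EB: (R' _ _ _ _) => [[s' u']|] //=.
- by rewrite E1 ?E0 ?(szR _ _ _ _ _ EA) // EA EB /= addbC.
- by rewrite E1 ?(szR _ _ _ _ _ EA) // EB.
- by rewrite E0 // EA.
Qed.

(** Reduces a goal about words of known sizes to a finite conjunction over the spaced [zs] and all
    [w], decided by evaluation. *)
Ltac brute_force zs w :=
  let sp := fresh in let szz := fresh in let szw := fresh in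
  move=> sp szz szw;
  lazymatch goal with |- is_true ?G =>
    lazymatch (eval pattern zs, w in G) with ?P _ _ =>
      apply: (all_words2P (P := P) _ sp szz szw); vm_compute; reflexivity
    end
  end.

(** At offsets 2 and 3 the windows overlap, so these cases are checked exhaustively; offset 1
    belongs to the braid relation. *)
Lemma commute_psi_psi j zs w : (2 <= j)%N -> spaced zs -> size zs = j + 3 ->
  size w = j + 4 -> commute_at psi_rule psi_rule j zs w.
Proof.
case: j => [|[|[|[|j]]]] // _ sp szz szw; last first.
  by apply: commute_far; rewrite ?szw //; [exact: psi_rule_size|exact: psi_rule_size].
all: by move: sp szz szw; brute_force zs w.
Qed.

Lemma commute_psi_y j zs w : (2 <= j)%N -> spaced zs -> size zs = j + 3 ->
  size w = j + 4 -> commute_at psi_rule y_rule j zs w.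
Proof.
case: j => [|[|[|[|j]]]] // _ sp szz szw; last first.
  by apply: commute_far; rewrite ?szw //; [exact: psi_rule_size|exact: y_rule_size].
all: by move: sp szz szw; brute_force zs w.
Qed.

Lemma commute_y_psi j zs w : (1 <= j)%N -> spaced zs -> size zs = j + 3 ->
  size w = j + 4 -> commute_at y_rule psi_rule j zs w.
Proof.
case: j => [|[|[|[|j]]]] // _ sp szz szw; last first.
  by apply: commute_far; rewrite ?szw //; [exact: y_rule_size|exact: psi_rule_size].
all: by move: sp szz szw; brute_force zs w.
Qed.

Lemma commute_y_y j zs w : spaced zs -> size zs = j + 3 ->
  size w = j + 4 -> commute_at y_rule y_rule j zs w.
Proof.
case: j => [|[|[|[|j]]]] // sp szz szw; last first.
  by apply: commute_far; rewrite ?szw //; exact: y_rule_size.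
all: by move: sp szz szw; brute_force zs w.
Qed.

Definition opp_word (o : signed_word) := omap (fun p => (~~ p.1, p.2)) o.

(* A sufficient condition for o1 = o2 + o3 when at most two of them are nonzero. *)
Definition signed_sum_eq (o1 o2 o3 : signed_word) :=
  [|| (o2 == None) && (o1 == o3), (o3 == None) && (o1 == o2)
    | (o1 == None) && (o2 == opp_word o3)].

(* The residue conditions of the relations, read off the steps of the path at r,
   r+1, r+2, which are the letters of w at 1, 2, 3; see res_eqE. *)
Definition same_res (zs w : seq bool) :=
  (nth false w 1 (+) nth false w 2) && nth false zs 1.
Definition next_res (zs w : seq bool) :=
  if nth false w 1 then ~~ nth false w 2 && nth false zs 0
  else ~~ nth false w 2 || nth false zs 2.
Definition prev_res (zs w : seq bool) :=
  if nth false w 1 then nth false w 2 || nth false zs 2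
  else nth false w 2 && nth false zs 0.
Definition same_res2 (zs w : seq bool) :=
  (nth false w 1 (+) nth false w 3) &&
  (if nth false w 1 (+) nth false w 2 then nth false zs 2 else nth false zs 1).

(** * Relations on words of five letters *)

Lemma psi_y_word zs w : spaced zs -> size zs = 4 -> size w = 5 ->
  signed_sum_eq (then_rule psi_rule zs 0 (local_rule y_rule zs 1 w))
    (then_rule y_rule zs 0 (local_rule psi_rule zs 0 w))
    (if same_res zs w then Some (false, w) else None).
Proof. brute_force zs w. Qed.

Lemma y_psi_word zs w : spaced zs -> size zs = 4 -> size w = 5 ->
  signed_sum_eq (then_rule y_rule zs 1 (local_rule psi_rule zs 0 w))
    (then_rule psi_rule zs 0 (local_rule y_rule zs 0 w))
    (if same_res zs w then Some (false, w) else None).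
Proof. brute_force zs w. Qed.

Lemma psi2_word zs w : spaced zs -> size zs = 4 -> size w = 5 ->
  if same_res zs w then
    then_rule psi_rule zs 0 (local_rule psi_rule zs 0 w) == None
  else if next_res zs w then
    signed_sum_eq (then_rule psi_rule zs 0 (local_rule psi_rule zs 0 w))
      (local_rule y_rule zs 1 w) (opp_word (local_rule y_rule zs 0 w))
  else if prev_res zs w then
    signed_sum_eq (then_rule psi_rule zs 0 (local_rule psi_rule zs 0 w))
      (local_rule y_rule zs 0 w) (opp_word (local_rule y_rule zs 1 w))
  else then_rule psi_rule zs 0 (local_rule psi_rule zs 0 w) == Some (false, w).
Proof. brute_force zs w. Qed.

Definition braid_left zs w := then_rule psi_rule zs 0
  (then_rule psi_rule zs 1 (local_rule psi_rule zs 0 w)).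

Definition braid_right zs w := then_rule psi_rule zs 1
  (then_rule psi_rule zs 0 (local_rule psi_rule zs 1 w)).

Lemma braid_word zs w : spaced zs -> size zs = 4 -> size w = 5 ->
  if same_res2 zs w && next_res zs w then
    signed_sum_eq (braid_left zs w) (braid_right zs w) (Some (false, w))
  else if same_res2 zs w && prev_res zs w then
    signed_sum_eq (braid_left zs w) (braid_right zs w) (opp_word (Some (false, w)))
  else braid_left zs w == braid_right zs w.
Proof. brute_force zs w. Qed.

(* Undoing leg-arm -> arm-leg next to a multiple of e takes two steps. *)
Lemma reverse_right zs w : spaced zs -> size zs = 4 -> size w = 5 ->
  [&& nth false zs 1, ~~ nth false w 2 & nth false w 3] ==>
  ((if nth false w 1 then then_rule psi_rule zs 1 (local_rule psi_rule zs 0 w)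
    else then_rule psi_rule zs 0 (local_rule psi_rule zs 1 w))
   == Some (~~ nth false w 1, [:: nth false w 0; nth false w 1; true; false; nth false w 4])).
Proof. brute_force zs w. Qed.

Lemma reverse_left zs w : spaced zs -> size zs = 4 -> size w = 5 ->
  [&& nth false zs 2, ~~ nth false w 1 & nth false w 2] ==>
  ((if nth false w 3 then then_rule psi_rule zs 1 (local_rule psi_rule zs 0 w)
    else then_rule psi_rule zs 0 (local_rule psi_rule zs 1 w))
   == Some (~~ nth false w 3, [:: nth false w 0; true; false; nth false w 3; nth false w 4])).
Proof. brute_force zs w. Qed.

Local Open Scope ring_scope.

Section Words.

(** The default [f k] of [nth] leaves [f] unchanged past the end of [w], so exactly the window of
    [w] is overwritten. *)
Definition put (b : nat) (w : seq bool) (f : nat -> bool) : nat -> bool :=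
  fun k => if (k < b)%N then f k else nth (f k) w (k - b).

Definition word (b N : nat) (f : nat -> bool) : seq bool :=
  mkseq (fun i => f (b + i)%N) N.

Lemma size_word b N f : size (word b N f) = N.
Proof. exact: size_mkseq. Qed.

Lemma nth_word b N f i : (i < N)%N -> nth false (word b N f) i = f (b + i)%N.
Proof. exact: nth_mkseq. Qed.

Lemma put_word b N f : put b (word b N f) f = f.
Proof.
apply/funext => k; rewrite /put; case: ltnP => // lebk.
case: (ltnP (k - b) N) => [lt|ge]; last by rewrite nth_default // size_word.
by rewrite nth_mkseq // subnKC.
Qed.

Lemma put_word_eq b N f g :
  (forall k, (k < b)%N || (b + N <= k)%N -> f k = g k) -> put b (word b N g) f = g.
Proof.
move=> eqfg; apply/funext => k; rewrite /put; case: ltnP => [lt|le].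
  by rewrite eqfg ?lt.
case: (ltnP (k - b) N) => [ltN|leN]; first by rewrite nth_mkseq // subnKC.
by rewrite nth_default ?size_word // eqfg //; lia.
Qed.

Lemma put_put b j u w f : size u = 4%N -> (j + 4 <= size w)%N ->
  put (b + j) u (put b w f) = put b (take j w ++ u ++ drop (j + 4) w) f.
Proof.
move=> szu lejw; apply/funext => k; rewrite /put.
case: (ltnP k b) => [ltkb|lebk]; first by rewrite ltn_addr.
rewrite nth_cat size_takel; last by lia.
have -> : (k < b + j)%N = (k - b < j)%N by lia.
case: ltnP => [ltj|lej]; first by rewrite nth_take // (set_nth_default false) //; lia.
rewrite nth_cat szu subnDA; case: ltnP => [lt4|le4].
  by rewrite (set_nth_default (f k)) // szu.
rewrite nth_default ?szu // nth_drop; congr nth; lia.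
Qed.

Lemma word_put b j N w f : (j + N <= size w)%N ->
  word (b + j) N (put b w f) = take N (drop j w).
Proof.
move=> lejw; apply: (@eq_from_nth _ false).
  by rewrite size_word size_takel // size_drop; lia.
move=> i; rewrite size_word => ltiN.
rewrite nth_mkseq // nth_take // nth_drop /put ifN; last by lia.
rewrite (_ : (b + j + i - b)%N = (j + i)%N); last by lia.
by rewrite (set_nth_default false) //; lia.
Qed.

Lemma nth_put b w f j : (j < size w)%N -> put b w f (b + j)%N = nth false w j.
Proof.
by move=> lt; rewrite /put ltnNge leq_addr /= addKn; exact: set_nth_default.
Qed.

Lemma put_outside b w f k : (k < b)%N || (b + size w <= k)%N -> put b w f k = f k.
Proof.
by rewrite /put; case: ltnP => //= lebk le; rewrite nth_default //; lia.
Qed.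

End Words.

(** * Paths and the vector space they span *)

Section Paths.
Variable n : nat.
Local Notation T := (n.-tuple bool).

(* Steps are numbered from 1; by convention step 0 is a leg and the steps after n
   are arms, so that the rules need no special case at the ends of the path. *)
Definition step (t : T) (k : nat) : bool := nth false (true :: t) k.
Definition path_of (f : nat -> bool) : T := [tuple f (val i).+1 | i < n].
Definition admissible (f : nat -> bool) :=
  f 0%N /\ forall k, (n < k)%N -> f k = false.

Lemma step_admissible t : admissible (step t).
Proof.
split=> // k ltnk; rewrite /step nth_default //= size_tuple; lia.
Qed.

Lemma path_ofE f k : (1 <= k <= n)%N -> step (path_of f) k = f k.
Proof.
case: k => // k /= ltkn.
by rewrite /step /= -(tnth_nth false (path_of f) (Ordinal ltkn)) tnth_mktuple.
Qed.

Lemma path_ofK f : admissible f -> step (path_of f) = f.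
Proof.
move=> [f0 fn]; apply/funext => -[|k]; first by rewrite f0.
case: (ltnP k n) => [lt|le]; first exact: path_ofE.
by rewrite fn // (step_admissible _).2.
Qed.

Lemma stepK t : path_of (step t) = t.
Proof.
by apply: eq_from_tnth => i; rewrite tnth_mktuple /step /= -tnth_nth.
Qed.

Lemma step_inj t t' : (forall k, (1 <= k <= n)%N -> step t k = step t' k) -> t = t'.
Proof.
move=> eqt; rewrite -[t]stepK -[t']stepK; apply: eq_from_tnth => i.
by rewrite !tnth_mktuple eqt /=.
Qed.

Lemma admissible_put b w f : admissible f -> (0 < size w)%N ->
  (b = 0%N -> nth false w 0) ->
  (forall i, (i < size w)%N -> (n < b + i)%N -> nth false w i = false) ->
  admissible (put b w f).
Proof.
move=> [f0 fn] w0 wb wn; split.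
  rewrite /put; case: ltnP => // /[!leqn0]/eqP b0.
  by rewrite sub0n (set_nth_default false) ?wb.
move=> k ltnk; rewrite /put; case: ltnP => [_|lebk]; first exact: fn.
case: (ltnP (k - b) (size w)) => [lt|le]; last by rewrite nth_default ?fn.
by rewrite (set_nth_default false) // wn // subnKC.
Qed.

Variable F : fieldType.

(** With the predecessor, matrix sizes are visible successors and the endomorphisms form a nonzero
    ring; [dimVE] restores the number of paths. *)
Definition dimV := #|{: T}|.-1.
Definition path_index (t : T) : 'I_dimV.+1 := inord (enum_rank t).

Lemma dimVE : dimV.+1 = #|{: T}|.
Proof. by rewrite prednK //; apply/card_gt0P; exists [tuple of nseq n true]. Qed.

Lemma path_index_inj : injective path_index.
Proof.
have ltr (s : T) : (enum_rank s < dimV.+1)%N by rewrite dimVE.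
by move=> t t' /(congr1 (@nat_of_ord _)); rewrite /path_index !inordK // => /val_inj/enum_rank_inj.
Qed.

Lemma path_index_surj i : exists t, i = path_index t.
Proof.
have lti : (i < #|{: T}|)%N by rewrite -dimVE.
exists (enum_val (Ordinal lti)); apply: ord_inj.
by rewrite /path_index enum_valK inordK //= ltn_ord.
Qed.

Local Notation V := 'cV[F]_dimV.+1.
Local Notation E := 'M[F]_dimV.+1.

Definition basis (t : T) : V := delta_mx (path_index t) 0.
Definition coord (u : V) (t : T) : F := u (path_index t) 0.

Lemma coord_basis t t' : coord (basis t) t' = (t == t')%:R.
Proof.
by rewrite /coord mxE eqxx andbT (inj_eq path_index_inj) eq_sym.
Qed.

Lemma coord_inj u u' : (forall t, coord u t = coord u' t) -> u = u'.
Proof.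
move=> eqc; apply/matrixP => i j; rewrite (ord1 j).
by have [t ->] := path_index_surj i; apply: eqc.
Qed.

Lemma coord_sum (f : T -> F) t : coord (\sum_t f t *: basis t) t = f t.
Proof.
rewrite /coord summxE (bigD1 t) //= big1 ?addr0 => [|t' ne].
  by rewrite mxE -/(coord (basis t) t) coord_basis eqxx mulr1.
by rewrite mxE -/(coord (basis t') t) coord_basis (negPf ne) mulr0.
Qed.

Lemma sum_coord u : \sum_t coord u t *: basis t = u.
Proof. by apply: coord_inj => t; rewrite coord_sum. Qed.

Lemma mx_basis_ext (A B : E) : (forall t, A *m basis t = B *m basis t) -> A = B.
Proof.
move=> eqAB; apply/matrixP => i j; have [t ->] := path_index_surj j.
move/colP/(_ i): (eqAB t); rewrite !mxE.
do 2![rewrite (bigD1 (path_index t)) //= mxE !eqxx mulr1 big1 ?addr0;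
  last by move=> k ne; rewrite mxE (negPf ne) mulr0].
by [].
Qed.

Definition mx_of (g : T -> V) : E := \sum_t g t *m (basis t)^T.

Lemma mx_ofE g t : mx_of g *m basis t = g t.
Proof.
rewrite /mx_of mulmx_suml (bigD1 t) //= big1 ?addr0 => [|t' ne].
  by rewrite -mulmxA trmx_delta mul_delta_mx -[RHS]mulmx1; congr (_ *m _);
     apply/matrixP => i j; rewrite !ord1 !mxE.
rewrite -mulmxA trmx_delta mul_delta_mx_cond (inj_eq path_index_inj) (negPf ne).
by rewrite mulmx0.
Qed.

Definition vect b f (o : signed_word) : V :=
  if o is Some p then (-1) ^+ p.1 *: basis (path_of (put b p.2 f)) else 0.

Lemma basis_vect b N t : basis t = vect b (step t) (Some (false, word b N (step t))).
Proof. by rewrite /vect /= expr0 scale1r put_word stepK. Qed.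

Lemma vect_opp b f o : vect b f (opp_word o) = - vect b f o.
Proof.
by case: o => [[[] w]|] /=; rewrite ?oppr0 // ?expr1 ?expr0 ?scale1r ?scaleN1r ?opprK.
Qed.

Lemma vect_sum b f o1 o2 o3 : signed_sum_eq o1 o2 o3 ->
  vect b f o1 = vect b f o2 + vect b f o3.
Proof.
case/or3P => /andP[/eqP-> /eqP->] /=; rewrite ?add0r ?addr0 //.
by rewrite vect_opp addNr.
Qed.

Variable e : nat.

Definition zlist b N := mkseq (fun i => (e %| b + i)%N) N.

Lemma nth_zlist b N i : (i < N)%N -> nth false (zlist b N) i = (e %| b + i)%N.
Proof. exact: nth_mkseq. Qed.

Lemma zlist_spaced b N : (3 <= e)%N -> spaced (zlist b N).
Proof.
move=> e3; have key m d : (0 < d < 3)%N -> (e %| m)%N -> (e %| m + d)%N = false.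
  by move=> dd dv; rewrite dvdn_addr //; apply/negP => /dvdn_leq; lia.
elim: N b => [|N IH] b //.
have -> : zlist b N.+1 = (e %| b)%N :: zlist b.+1 N.
  rewrite /zlist /mkseq /= addn0; congr cons.
  by rewrite (iotaDl 1 0) -map_comp; apply: eq_map => i /=; rewrite addnA addn1.
rewrite /= IH andbT; apply/implyP => dv.
have D i : (0 < i.+1 < 3)%N -> nth false (zlist b.+1 N) i = false.
  move=> ii; case: (ltnP i N) => [lt|le]; last by rewrite nth_default // size_mkseq.
  by rewrite nth_zlist // addSnnS key.
by rewrite !D.
Qed.

(* The window of R at position r starts at r - 1. *)
Definition rule_mx (R : rule) (r : nat) : E :=
  mx_of (fun t => vect r.-1 (step t)
    (local_rule R (zlist r.-1 3) 0 (word r.-1 4 (step t)))).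

(** [path_of] forgets the steps outside 1..[n]. Only if the result is admissible is nothing lost
    there, and then products of matrices correspond to composed rules. *)
Definition keeps_admissible (R : rule) r := forall f p, admissible f ->
  R (e %| r.-1)%N (e %| r)%N (e %| r.+1)%N (word r.-1 4 f) = Some p ->
  admissible (put r.-1 p.2 f).

Definition wf_word b f N (o : signed_word) :=
  if o is Some p then size p.2 = N /\ admissible (put b p.2 f) else True.

(** Several generators can thus act inside one larger window: multiplying matrices becomes composing
    rules on a word, with admissibility carried along. *)
Lemma rule_mx_vect (R : rule) r b f N M j o :
  preserves_size R -> keeps_admissible R r -> (j + 4 <= N)%N -> (j + 3 <= M)%N ->
  r = (b + j).+1 -> wf_word b f N o ->
  rule_mx R r *m vect b f o = vect b f (then_rule R (zlist b M) j o) /\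
  wf_word b f N (then_rule R (zlist b M) j o).
Proof.
move=> szR okR leN leM rE; case: o => [[s w]|] /=; last by rewrite mulmx0.
move=> [szw okw]; rewrite -scalemxAr mx_ofE path_ofK // rE /=.
rewrite word_put ?szw // /local_rule take0 drop0 !nth_zlist ?addn0; [|lia..].
rewrite (@take_oversize _ 4 (take 4 _)); last first.
  by rewrite size_takel // size_drop; lia.
rewrite ?addn1 ?addn2 !(addnS b); move: (fun p => okR _ p okw).
rewrite rE /= word_put ?szw // => {}okR.
have := szR (e %| b + j)%N (e %| (b + j).+1)%N (e %| (b + j).+2)%N (take 4 (drop j w)).
case E1: (R _ _ _ _) => [[s' u]|] szu /=; last by rewrite scaler0.
have {}szu := szu _ erefl; rewrite /= in szu.
have -> : drop 4 (take 4 (drop j w)) = [::].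
  by rewrite drop_oversize // size_takel // size_drop; lia.
rewrite cats0 put_put // ?szw //; split; first by rewrite scalerA signr_addb.
split; first by rewrite !size_cat szu size_takel ?size_drop; lia.
by rewrite -put_put // ?szw //; apply: (okR (s', u)).
Qed.

End Paths.

(** * Residues of paths *)

Definition transpose r k : nat := if k == r then r.+1 else if k == r.+1 then r else k.

Lemma transpose_window b : [/\ transpose b.+1 b = b, transpose b.+1 b.+1 = b.+2,
  transpose b.+1 b.+2 = b.+1 & transpose b.+1 b.+3 = b.+3].
Proof. by rewrite /transpose; split; do !case: eqP => //; lia. Qed.

Lemma word4 b f : word b 4 f = [:: f b; f b.+1; f b.+2; f b.+3].
Proof. by rewrite /word /mkseq /= addn0 addn1 addn2 addn3. Qed.

Lemma word5 b f : word b 5 f = [:: f b; f b.+1; f b.+2; f b.+3; f b.+4].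
Proof. by rewrite /word /mkseq /= addn0 addn1 addn2 addn3 addn4. Qed.

Lemma put4 b a0 a1 a2 a3 f : let g := put b [:: a0; a1; a2; a3] f in
  [/\ g b = a0, g b.+1 = a1, g b.+2 = a2 & g b.+3 = a3].
Proof.
have P i := nth_put b (w := [:: a0; a1; a2; a3]) f (j := i).
split; by [move: (P 0%N isT); rewrite addn0 | move: (P 1%N isT); rewrite addn1
  | move: (P 2%N isT); rewrite addn2 | move: (P 3%N isT); rewrite addn3].
Qed.

Lemma interval4 b (P : nat -> Prop) : P b -> P b.+1 -> P b.+2 -> P b.+3 ->
  forall k, (b <= k < b.+4)%N -> P k.
Proof.
move=> P0 P1 P2 P3 k Hk.
have : [|| k == b, k == b.+1, k == b.+2 | k == b.+3] by lia.
by case/or4P => /eqP->.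
Qed.

Section Residues.
Variables (e : nat) (k1 : 'Z_e).
(** Step 0 is a leg and contributes nothing. One counter serves both kinds of steps: with p arms
    before r, a leg at r has residue kappa2 - (r - 1 - p), which is kappa1 + p - r because kappa2 =
    kappa1 - 1. *)
Fixpoint arm_res (f : nat -> bool) (r : nat) : 'Z_e :=
  if r is r'.+1 then arm_res f r' + (~~ f r')%:R else k1.

(* With h = kappa1 + #(arms before r), an arm at r has residue h and a leg h - r. *)
Definition path_res (f : nat -> bool) (r : nat) : 'Z_e :=
  arm_res f r - (if f r then r%:R else 0).

Lemma arm_res_put_before b w f k : (k <= b)%N -> arm_res (put b w f) k = arm_res f k.
Proof.
elim: k => //= k IH ltkb; rewrite IH; last by lia.
by rewrite /put ltkb.
Qed.

Lemma arm_res_put_after b w f k :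
  arm_res (put b w f) (b + size w) = arm_res f (b + size w) ->
  (b + size w <= k)%N -> arm_res (put b w f) k = arm_res f k.
Proof.
move=> eqa; elim: k => [|k IH] le.
  by move: eqa; have /eqP-> : (b + size w)%N == 0%N by rewrite -leqn0.
case: (ltnP k (b + size w)) => [lt|le'].
  by have <- : (b + size w)%N = k.+1 by lia.
by rewrite /= IH // put_outside // le' orbT.
Qed.

(** Beyond the window, residues depend on it only through the counter [arm_res] at its end. *)
Lemma path_res_put b w f g : size w = 4%N ->
  (forall k, (b <= k < b + 4)%N -> path_res (put b w f) k = path_res f (g k)) ->
  (forall k, (k < b)%N || (b + 4 <= k)%N -> g k = k) ->
  arm_res (put b w f) (b + 4) = arm_res f (b + 4) ->
  forall k, path_res (put b w f) k = path_res f (g k).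
Proof.
move=> szw Hin Hout Heq k.
case: (boolP (b <= k < b + 4)%N) => [/Hin //|Hk].
rewrite Hout; last by lia.
rewrite /path_res put_outside; last by rewrite szw; lia.
case: (ltnP k b) => [lt|le]; first by rewrite arm_res_put_before ?(ltnW lt).
by rewrite arm_res_put_after ?szw //; lia.
Qed.

Hypothesis e3 : (3 <= e)%N.

Lemma natr_Ze_eq0 m : (m%:R == 0 :> 'Z_e) = (e %| m)%N.
Proof.
by rewrite -val_eqE /= val_Zp_nat; [|lia].
Qed.

Lemma dvdn_succF b : ~~ ((e %| b) && (e %| b.+1))%N.
Proof.
have /= := zlist_spaced b 2 e3; rewrite /zlist /mkseq /= addn0 addn1.
by case: (_ %| _)%N; case: (_ %| _)%N.
Qed.

(** This is psi_r e(i) = e(s_r i) psi_r before passing to matrices. Where a rule depends on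
    divisibility, [b] becomes 0, -1 or -2 in ['Z_e], and each equality of residues is a ring
    identity. *)
Lemma psi_path_res b f p :
  psi_rule (e %| b)%N (e %| b.+1)%N (e %| b.+2)%N (word b 4 f) = Some p ->
  forall k, path_res (put b p.2 f) k = path_res f (transpose b.+1 k).
Proof.
move=> Rp; have szp : size p.2 = 4%N := psi_rule_size Rp.
have A0 := arm_res_put_before p.2 f (leqnn b).
have E0 : (e %| b)%N -> b%:R = 0 :> 'Z_e by move=> H; apply/eqP; rewrite natr_Ze_eq0.
have E1 : (e %| b.+1)%N -> b%:R = - 1 :> 'Z_e.
  by rewrite -natr_Ze_eq0 -natr1 addr_eq0 => /eqP.
have E2 : (e %| b.+2)%N -> b%:R = - 2%:R :> 'Z_e.
  by rewrite -natr_Ze_eq0 -natr1 -[b.+1%:R]natr1 -addrA addr_eq0 => /eqP.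
have C12 := dvdn_succF b.+1.
have [T0 T1 T2 T3] := transpose_window b.
have H : [/\ forall k, (b <= k < b + 4)%N ->
     path_res (put b p.2 f) k = path_res f (transpose b.+1 k) &
   arm_res (put b p.2 f) (b + 4) = arm_res f (b + 4)].
  { move: C12 Rp A0 T0 T1 T2 T3; rewrite word4 addn4.
  case Da : (f b); case Db : (f b.+1); case Dc : (f b.+2); case Dd : (f b.+3);
  case: (e %| b)%N E0 => [/(_ isT) E0|_]; case: (e %| b.+1)%N E1 => [/(_ isT) E1|_];
  case: (e %| b.+2)%N E2 => [/(_ isT) E2|_] //= _ [<-] /=.
  all: set g := put _ _ _; have [G0 G1 G2 G3] :
     [/\ g b = _, g b.+1 = _, g b.+2 = _ & g b.+3 = _] := put4 b _ _ _ _ f.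
  all: move=> A0 T0 T1 T2 T3; split;
    [apply: (interval4 (P := fun k => path_res g k = path_res f (transpose b.+1 k)))|].
  all: rewrite ?T0 ?T1 ?T2 ?T3 /path_res /= ?A0 ?G0 ?G1 ?G2 ?G3 ?Da ?Db ?Dc ?Dd /=.
  all: rewrite -?natr1 ?E0 ?E1 ?E2; ring. }
apply: path_res_put H.1 _ H.2 => // k Hk; rewrite /transpose.
by do !case: eqP => //; lia.
Qed.

Lemma y_path_res b f p :
  y_rule (e %| b)%N (e %| b.+1)%N (e %| b.+2)%N (word b 4 f) = Some p ->
  forall k, path_res (put b p.2 f) k = path_res f k.
Proof.
move=> Rp; have szp : size p.2 = 4%N := y_rule_size Rp.
have A0 := arm_res_put_before p.2 f (leqnn b).
have E0 : (e %| b)%N -> b%:R = 0 :> 'Z_e by move=> H; apply/eqP; rewrite natr_Ze_eq0.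
have E1 : (e %| b.+1)%N -> b%:R = - 1 :> 'Z_e.
  by rewrite -natr_Ze_eq0 -natr1 addr_eq0 => /eqP.
have H : [/\ forall k, (b <= k < b + 4)%N ->
     path_res (put b p.2 f) k = path_res f k &
   arm_res (put b p.2 f) (b + 4) = arm_res f (b + 4)].
  { move: (dvdn_succF b) Rp A0; rewrite word4 addn4.
  case Da : (f b); case Db : (f b.+1); case Dc : (f b.+2); case Dd : (f b.+3);
  case: (e %| b)%N E0 => [/(_ isT) E0|_]; case: (e %| b.+1)%N E1 => [/(_ isT) E1|_] //= _ [<-] /=.
  all: set g := put _ _ _; have [G0 G1 G2 G3] :
     [/\ g b = _, g b.+1 = _, g b.+2 = _ & g b.+3 = _] := put4 b _ _ _ _ f.
  all: move=> A0; split; [apply: (interval4 (P := fun k => path_res g k = path_res f k))|].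
  all: rewrite /path_res /= ?A0 ?G0 ?G1 ?G2 ?G3 ?Da ?Db ?Dc ?Dd /=.
  all: rewrite -?natr1 ?E0 ?E1; ring. }
exact: path_res_put H.1 _ H.2.
Qed.
End Residues.

Section ResidueTests.
Variables (e : nat) (k1 : 'Z_e).
Hypothesis e3 : (3 <= e)%N.
Local Notation path_res := (path_res k1).

Lemma zlist4 b : zlist e b 4 = [:: e %| b; e %| b.+1; e %| b.+2; e %| b.+3]%N.
Proof. by rewrite /zlist /mkseq /= addn0 addn1 addn2 addn3. Qed.

(** Once the three steps are fixed, each difference of the two sides is, up to sign, 0, 1, 2, [b],
    [b + 1] or [b + 2]. The constants are decided by [e >= 3], the others by the divisibility tests
    of the window. *)
Lemma res_eqE b f :
  [/\ (path_res f b.+1 == path_res f b.+2) = same_res (zlist e b 4) (word b 5 f),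
      (path_res f b.+2 == path_res f b.+1 + 1) = next_res (zlist e b 4) (word b 5 f),
      (path_res f b.+2 == path_res f b.+1 - 1) = prev_res (zlist e b 4) (word b 5 f)
    & (path_res f b.+3 == path_res f b.+1) = same_res2 (zlist e b 4) (word b 5 f)].
Proof.
rewrite zlist4 word5 /same_res /next_res /prev_res /same_res2 /=.
have N k : (0 < k < e)%N -> (k%:R == 0 :> 'Z_e) = false.
  by move=> ?; rewrite natr_Ze_eq0 //; apply/negP => /dvdn_leq; lia.
have N1 : (1 == 0 :> 'Z_e) = false by apply: (N 1%N); lia.
have N2 : (2 == 0 :> 'Z_e) = false by apply: N; lia.
have Z0 : (b%:R == 0 :> 'Z_e) = (e %| b)%N by rewrite natr_Ze_eq0.
have Z1 : (b%:R + 1 == 0 :> 'Z_e) = (e %| b.+1)%N by rewrite natr1 natr_Ze_eq0.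
have Z2 : (b%:R + 2 == 0 :> 'Z_e) = (e %| b.+2)%N.
  by rewrite -natrD natr_Ze_eq0 // addn2.
have O (x y : 'Z_e) : x = - y -> (x == 0) = (y == 0) by move=> ->; rewrite oppr_eq0.
rewrite /path_res /=; set h := arm_res k1 f b + _.
case: (f b.+1); case: (f b.+2); case: (f b.+3); split; rewrite /= -subr_eq0 -?natr1.
all: rewrite -?Z0 -?Z1 -?Z2.
all: first [by apply/eqP; ring | by congr (_ == 0); ring | by apply: O; ring
  | by rewrite -N1; congr (_ == 0); ring | by rewrite -N1; apply: O; ring
  | by rewrite -N2; congr (_ == 0); ring | by rewrite -N2; apply: O; ring].
Qed.
End ResidueTests.

(** * The relations of the algebra *)

Section Representation.
Variables (F : fieldType) (e n : nat) (k1 : 'Z_e).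
Local Notation T := (n.-tuple bool).
Local Notation E := 'M[F]_((dimV n).+1).
Local Notation basis := (@basis n F).
Local Notation path_res := (path_res k1).

Definition weight (t : T) : n.-tuple 'Z_e := seq_of_residues n (path_res (step t)).

Lemma residue_seq (f : nat -> 'Z_e) r : (1 <= r <= n)%N ->
  residue (seq_of_residues n f) r = f r.
Proof.
case: r => // r /= ltrn; rewrite /residue /=.
by rewrite -(tnth_nth 0 (seq_of_residues n f) (Ordinal ltrn)) tnth_mktuple.
Qed.

Lemma eq_seq_of_residues (f g : nat -> 'Z_e) :
  (forall r, (1 <= r <= n)%N -> f r = g r) ->
  seq_of_residues n f = seq_of_residues n g.
Proof. by move=> eqfg; apply: eq_from_tnth => i; rewrite !tnth_mktuple eqfg /= ?ltn_ord. Qed.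

Definition psi_mx r : E := if (1 <= r < n)%N then rule_mx n F e psi_rule r else 0.
Definition y_mx r : E := if (1 <= r <= n)%N then rule_mx n F e y_rule r else 0.
Definition e_mx (i : n.-tuple 'Z_e) : E :=
  mx_of (fun t => (weight t == i)%:R *: basis t).

(** No rule turns the first letter of its window from leg to arm, nor the last from arm to leg. For
    [r = 1] the first letter is step 0, and only the last one can lie beyond [n]. *)
Lemma psi_keeps r : (1 <= r < n)%N -> keeps_admissible n e psi_rule r.
Proof.
case: r => // b /= ltbn f p okf; rewrite !succnK word4 => Rp.
apply: (admissible_put okf); rewrite ?(psi_rule_size Rp) //.
  move=> b0; move: Rp; rewrite b0 okf.1.
  by case: (f 1%N); case: (f 2%N); case: (f 3%N); case: (e %| 0)%N;
     case: (e %| 1)%N; case: (e %| 2)%N => //= -[<-].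
move=> i lti4 ltni; have i3 : i = 3%N by lia.
move: Rp; rewrite (okf.2 b.+3) ?i3; last by lia.
by case: (f b); case: (f b.+1); case: (f b.+2); case: (e %| b)%N;
     case: (e %| b.+1)%N; case: (e %| b.+2)%N => //= -[<-].
Qed.

Lemma y_keeps r : (1 <= r <= n)%N -> keeps_admissible n e y_rule r.
Proof.
case: r => // b /= ltbn f p okf; rewrite !succnK word4 => Rp.
apply: (admissible_put okf); rewrite ?(y_rule_size Rp) //.
  move=> b0; move: Rp; rewrite b0 okf.1.
  by case: (f 1%N); case: (f 2%N); case: (f 3%N); case: (e %| 0)%N;
     case: (e %| 1)%N; case: (e %| 2)%N => //= -[<-].
move=> i lti4 ltni; have : (i == 2)%N && (n < b.+2)%N || (i == 3)%N by lia.
case/orP => [/andP[/eqP-> ltn]|/eqP->]; move: Rp.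
  rewrite (okf.2 b.+2) // (okf.2 b.+3); last by lia.
  by case: (f b); case: (f b.+1); case: (e %| b)%N;
     case: (e %| b.+1)%N; case: (e %| b.+2)%N => //= -[<-].
rewrite (okf.2 b.+3); last by lia.
by case: (f b); case: (f b.+1); case: (f b.+2); case: (e %| b)%N;
     case: (e %| b.+1)%N; case: (e %| b.+2)%N => //= -[<-].
Qed.

Lemma e_mxE i t : e_mx i *m basis t = (weight t == i)%:R *: basis t.
Proof. exact: mx_ofE. Qed.

(** A relation with the factor e(i) needs checking only on paths of weight [i], where its case
    distinction is settled. *)
Lemma mul_e_mx_ext (A B : E) i :
  (forall t, weight t = i -> A *m basis t = B *m basis t) -> A * e_mx i = B * e_mx i.
Proof.
move=> eqAB; apply: mx_basis_ext => t; rewrite -!mulmxE -!mulmxA !e_mxE -!scalemxAr.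
by case: eqP => [/eqAB->//|_]; rewrite !scale0r.
Qed.

Lemma then_rule1 (R : rule) zs j w :
  then_rule R zs j (Some (false, w)) = local_rule R zs j w.
Proof. by rewrite /then_rule /=; case: (local_rule _ _ _ _) => [[]|]. Qed.

Lemma wf_word_path b N (t : T) : wf_word n b (step t) N (Some (false, word b N (step t))).
Proof.
by split; rewrite /= ?size_word // put_word; apply: step_admissible.
Qed.

Lemma rule_mx_vect1 (R : rule) r b N M j (t : T) :
  preserves_size R -> keeps_admissible n e R r -> (j + 4 <= N)%N -> (j + 3 <= M)%N ->
  r = (b + j).+1 ->
  rule_mx n F e R r *m basis t =
    vect n F b (step t) (local_rule R (zlist e b M) j (word b N (step t))) /\
  wf_word n b (step t) N (local_rule R (zlist e b M) j (word b N (step t))).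
Proof.
move=> szR okR leN leM rE; rewrite (basis_vect F b N) -then_rule1.
exact: rule_mx_vect (wf_word_path b N t).
Qed.

Hypothesis e3 : (3 <= e)%N.

Lemma rule_mx_commute (R R' : rule) r j : (1 <= r)%N ->
  preserves_size R -> preserves_size R' ->
  keeps_admissible n e R r -> keeps_admissible n e R' (r + j) ->
  (forall zs w, spaced zs -> size zs = (j + 3)%N -> size w = (j + 4)%N ->
    commute_at R R' j zs w) ->
  rule_mx n F e R r * rule_mx n F e R' (r + j) =
  rule_mx n F e R' (r + j) * rule_mx n F e R r.
Proof.
case: r => // b _ szR szR' okR okR' comm; apply: mx_basis_ext => t.
rewrite -!mulmxE -!mulmxA.
have [-> wf1] := @rule_mx_vect1 R b.+1 b (j + 4) (j + 3) 0 t szR okR ltac:(lia)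
  ltac:(lia) ltac:(lia).
have [-> wf2] := @rule_mx_vect1 R' (b.+1 + j) b (j + 4) (j + 3) j t szR' okR'
  ltac:(lia) ltac:(lia) ltac:(lia).
have [-> _] := rule_mx_vect F (N := (j + 4)%N) (M := (j + 3)%N) (b := b)
  (j := 0) (r := b.+1) szR okR ltac:(lia) ltac:(lia) ltac:(lia) wf2.
have [-> _] := rule_mx_vect F (N := (j + 4)%N) (M := (j + 3)%N) (b := b)
  (j := j) (r := (b.+1 + j)%N) szR' okR' ltac:(lia) ltac:(lia) ltac:(lia) wf1.
by rewrite -(eqP (comm _ _ (zlist_spaced _ _ e3) (size_mkseq _ _) (size_word _ _ _))).
Qed.

Lemma y_mxC r s : y_mx r * y_mx s = y_mx s * y_mx r.
Proof.
wlog lers : r s / (r <= s)%N => [W|].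
  by case: (leqP r s) => [/W //|/ltnW/W->].
rewrite /y_mx; case: ifP => [r1n|_]; last by rewrite mul0r mulr0.
case: ifP => [s1n|_]; last by rewrite mul0r mulr0.
have <- : (r + (s - r))%N = s by lia.
apply: rule_mx_commute; rewrite ?subnKC //; [lia|exact: y_rule_size..| | |].
- exact: y_keeps.
- exact: y_keeps.
by move=> zs w; apply: commute_y_y.
Qed.

Lemma psi_mx_far r s : (r.+1 < s)%N -> psi_mx r * psi_mx s = psi_mx s * psi_mx r.
Proof.
move=> ltrs; rewrite /psi_mx; case: ifP => [r1n|_]; last by rewrite mul0r mulr0.
case: ifP => [s1n|_]; last by rewrite mul0r mulr0.
have <- : (r + (s - r))%N = s by lia.
apply: rule_mx_commute; rewrite ?subnKC; try lia; do ?exact: psi_rule_size.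
- exact: psi_keeps.
- exact: psi_keeps.
by move=> zs w; apply: commute_psi_psi; lia.
Qed.

Lemma psi_y_mx_far r s : s != r -> s != r.+1 -> psi_mx r * y_mx s = y_mx s * psi_mx r.
Proof.
move=> nsr nsr1; rewrite /psi_mx /y_mx; case: ifP => [r1n|_]; last by rewrite mul0r mulr0.
case: ifP => [s1n|_]; last by rewrite mul0r mulr0.
case: (ltnP r s) => [ltrs|lesr].
  have <- : (r + (s - r))%N = s by lia.
  apply: rule_mx_commute; rewrite ?subnKC; try lia.
  - exact: psi_rule_size.
  - exact: y_rule_size.
  - exact: psi_keeps.
  - exact: y_keeps.
  by move=> zs w; apply: commute_psi_y; lia.
have <- : (s + (r - s))%N = r by lia.
symmetry; apply: rule_mx_commute; rewrite ?subnKC; try lia.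
- exact: y_rule_size.
- exact: psi_rule_size.
- exact: y_keeps.
- exact: psi_keeps.
by move=> zs w; apply: commute_y_psi; lia.
Qed.

End Representation.

Section Relations.
Variables (F : fieldType) (e n : nat) (k1 : 'Z_e).
Local Notation T := (n.-tuple bool).
Local Notation basis := (@basis n F).
Local Notation path_res := (path_res k1).
Local Notation weight := (weight k1).
Local Notation psi_mx := (psi_mx F e n).
Local Notation y_mx := (y_mx F e n).
Local Notation e_mx := (@e_mx F e n k1).

Lemma weight_path f : admissible n f -> weight (path_of n f) = seq_of_residues n (path_res f).
Proof. by move=> okf; rewrite /weight path_ofK. Qed.

Lemma residue_weight (t : T) r : (1 <= r <= n)%N -> residue (weight t) r = path_res (step t) r.
Proof. exact: residue_seq. Qed.

Lemma swap_residuesK r (i : n.-tuple 'Z_e) : (1 <= r < n)%N ->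
  swap_residues r (swap_residues r i) = i.
Proof.
move=> r1n; rewrite -[RHS](_ : seq_of_residues n (residue i) = i); last first.
  by apply: eq_from_tnth => j; rewrite tnth_mktuple /residue /= -tnth_nth.
apply: eq_seq_of_residues => k k1n; rewrite residue_seq.
  congr residue; do !case: eqP => //; lia.
by do !case: eqP => //; lia.
Qed.

Lemma local_word4 R zs w : preserves_size R -> size w = 4%N ->
  local_rule R zs 0 w = R (nth false zs 0) (nth false zs 1) (nth false zs 2) w.
Proof.
move=> szR szw; rewrite /local_rule take0 drop0 take_oversize ?szw //.
by case E1: (R _ _ _ _) => [[s u]|] //=; rewrite drop_oversize ?szw // cats0.
Qed.

Lemma rule_mx_weight (R : rule) r (t : T) i' : (1 <= r)%N ->
  preserves_size R -> keeps_admissible n e R r ->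
  (forall p, R (e %| r.-1)%N (e %| r)%N (e %| r.+1)%N (word r.-1 4 (step t)) = Some p ->
    seq_of_residues n (path_res (put r.-1 p.2 (step t))) = i') ->
  forall i, e_mx i *m (rule_mx n F e R r *m basis t) =
            (i' == i)%:R *: (rule_mx n F e R r *m basis t).
Proof.
case: r => // b _ szR okR wtR i.
have [-> ] := @rule_mx_vect1 F e n R b.+1 b 4 3 0 t szR okR isT isT ltac:(lia).
rewrite local_word4 ?size_word // !nth_zlist // addn0 addn1 addn2.
case E1: (R _ _ _ _) => [[s w]|] /=; last by rewrite mulmx0 scaler0.
move=> [_ okw]; rewrite -scalemxAr e_mxE weight_path // (wtR _ E1).
by rewrite scalerA [_ * (_ == _)%:R]mulrC -scalerA.
Qed.

Lemma e_mx_mul i j : e_mx i * e_mx j = (i == j)%:R * e_mx i.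
Proof.
have [<-|ne] := eqVneq i j; last rewrite mul0r -[RHS](mul0r (e_mx j)).
  rewrite mul1r -[RHS]mul1r; apply: mul_e_mx_ext => t wt.
  by rewrite e_mxE wt eqxx scale1r mul1mx.
apply: mul_e_mx_ext => t wt.
by rewrite e_mxE wt eq_sym (negPf ne) scale0r mul0mx.
Qed.

Lemma e_mx_sum : \sum_i e_mx i = 1.
Proof.
apply: mx_basis_ext => t; rewrite mulmx_suml mul1mx (bigD1 (weight t)) //=.
rewrite e_mxE eqxx scale1r big1 ?addr0 // => i ne.
by rewrite e_mxE eq_sym (negPf ne) scale0r.
Qed.

Hypothesis e3 : (3 <= e)%N.

Lemma y_e_mx r i : y_mx r * e_mx i = e_mx i * y_mx r.
Proof.
rewrite /y_mx; case: ifP => r1n; last by rewrite mul0r mulr0.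
apply: mx_basis_ext => t; rewrite -!mulmxE -!mulmxA e_mxE -scalemxAr.
rewrite (@rule_mx_weight y_rule r t (weight t)) //.
- by case/andP: r1n.
- exact: y_rule_size.
- exact: y_keeps.
case: r r1n => // b r1n p Rp; apply: eq_seq_of_residues => k _.
exact: y_path_res.
Qed.

Lemma psi_e_mx r i : (1 <= r < n)%N ->
  psi_mx r * e_mx i = e_mx (swap_residues r i) * psi_mx r.
Proof.
move=> r1n; rewrite /psi_mx r1n.
apply: mx_basis_ext => t; rewrite -!mulmxE -!mulmxA e_mxE -scalemxAr.
rewrite (@rule_mx_weight psi_rule r t (swap_residues r (weight t))) //.
- by rewrite (inj_eq (can_inj (fun i => swap_residuesK i r1n))).
- by case/andP: r1n.
- exact: psi_rule_size.
- exact: psi_keeps.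
case: r r1n => // b r1n p Rp; apply: eq_seq_of_residues => k k1n.
rewrite (psi_path_res k1 e3 Rp) residue_weight //.
by do !case: eqP => //; lia.
Qed.

Lemma path_res_tests b (t : T) : (b.+2 <= n)%N ->
  let a := residue (weight t) b.+1 in let c := residue (weight t) b.+2 in
  let zs := zlist e b 4 in let w := word b 5 (step t) in
  [/\ (a == c) = same_res zs w, (c == a + 1) = next_res zs w
    & (c == a - 1) = prev_res zs w].
Proof.
by move=> ltb; rewrite /= !residue_weight; [|lia..]; case: (res_eqE k1 e3 b (step t)).
Qed.

Section NearRelations.
Variables (b : nat) (t : T).
Hypothesis ltb : (b.+2 <= n)%N.
Let zs := zlist e b 4.
Let f := step t.
Let w := word b 5 f.
Local Notation vec o := (vect n F b f o).
Local Notation wf o := (wf_word n b f 5 o).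

Let sp : spaced zs := zlist_spaced b 4 e3.
Let szz : size zs = 4%N := size_mkseq _ _.
Let szw : size w = 5%N := size_word _ _ _.

Lemma act_psi0 o : wf o -> psi_mx b.+1 *m vec o = vec (then_rule psi_rule zs 0 o) /\
  wf (then_rule psi_rule zs 0 o).
Proof.
have r1n : (1 <= b.+1 < n)%N by lia.
move=> wfo; rewrite /psi_mx r1n.
apply: rule_mx_vect wfo; rewrite ?addn0 //; [exact: psi_rule_size|exact: psi_keeps].
Qed.

Lemma act_psi1 o : (b.+3 <= n)%N -> wf o ->
  psi_mx b.+2 *m vec o = vec (then_rule psi_rule zs 1 o) /\
  wf (then_rule psi_rule zs 1 o).
Proof.
move=> ltb3; have r1n : (1 <= b.+2 < n)%N by lia.
move=> wfo; rewrite /psi_mx r1n.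
apply: rule_mx_vect wfo; rewrite ?addn1 //; [exact: psi_rule_size|exact: psi_keeps].
Qed.

Lemma act_y0 o : wf o -> y_mx b.+1 *m vec o = vec (then_rule y_rule zs 0 o) /\
  wf (then_rule y_rule zs 0 o).
Proof.
have r1n : (1 <= b.+1 <= n)%N by lia.
move=> wfo; rewrite /y_mx r1n.
apply: rule_mx_vect wfo; rewrite ?addn0 //; [exact: y_rule_size|exact: y_keeps].
Qed.

Lemma act_y1 o : wf o -> y_mx b.+2 *m vec o = vec (then_rule y_rule zs 1 o) /\
  wf (then_rule y_rule zs 1 o).
Proof.
have r1n : (1 <= b.+2 <= n)%N by lia.
move=> wfo; rewrite /y_mx r1n.
apply: rule_mx_vect wfo; rewrite ?addn1 //; [exact: y_rule_size|exact: y_keeps].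
Qed.

Let wf0 : wf (Some (false, w)) := wf_word_path b 5 t.
Let basisE : basis t = vec (Some (false, w)) := basis_vect F b 5 t.

Lemma psi_y_basis : psi_mx b.+1 *m (y_mx b.+2 *m basis t) =
  y_mx b.+1 *m (psi_mx b.+1 *m basis t) + (same_res zs w)%:R *: basis t.
Proof.
rewrite basisE; have [-> wf1] := act_y1 wf0; have [-> wf2] := act_psi0 wf0.
rewrite (act_psi0 wf1).1 (act_y0 wf2).1 !then_rule1.
rewrite (vect_sum n F b f (psi_y_word sp szz szw)); congr (_ + _).
by case: same_res; rewrite ?scale1r ?scale0r.
Qed.

Lemma y_psi_basis : y_mx b.+2 *m (psi_mx b.+1 *m basis t) =
  psi_mx b.+1 *m (y_mx b.+1 *m basis t) + (same_res zs w)%:R *: basis t.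
Proof.
rewrite basisE; have [-> wf1] := act_y0 wf0; have [-> wf2] := act_psi0 wf0.
rewrite (act_psi0 wf1).1 (act_y1 wf2).1 !then_rule1.
rewrite (vect_sum n F b f (y_psi_word sp szz szw)); congr (_ + _).
by case: same_res; rewrite ?scale1r ?scale0r.
Qed.

Lemma psi2_basis : psi_mx b.+1 *m (psi_mx b.+1 *m basis t) =
  if same_res zs w then 0
  else if next_res zs w then y_mx b.+2 *m basis t - y_mx b.+1 *m basis t
  else if prev_res zs w then y_mx b.+1 *m basis t - y_mx b.+2 *m basis t
  else basis t.
Proof.
rewrite basisE; have [-> wf1] := act_psi0 wf0; rewrite (act_psi0 wf1).1.
rewrite (act_y0 wf0).1 (act_y1 wf0).1 !then_rule1.
have := psi2_word sp szz szw.
case: same_res => [/eqP->//|]; case: next_res => [/vect_sum->|].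
  by rewrite vect_opp.
by case: prev_res => [/vect_sum->|/eqP->//]; rewrite vect_opp.
Qed.

Lemma braid_basis : (b.+3 <= n)%N ->
  psi_mx b.+1 *m (psi_mx b.+2 *m (psi_mx b.+1 *m basis t)) =
  psi_mx b.+2 *m (psi_mx b.+1 *m (psi_mx b.+2 *m basis t)) +
  (if same_res2 zs w && next_res zs w then basis t
   else if same_res2 zs w && prev_res zs w then - basis t else 0).
Proof.
move=> ltb3; rewrite basisE.
have [-> wf1] := act_psi0 wf0; have [-> wf2] := act_psi1 ltb3 wf1.
have [-> wf3] := act_psi1 ltb3 wf0; have [-> wf4] := act_psi0 wf3.
rewrite (act_psi0 wf2).1 (act_psi1 ltb3 wf4).1 !then_rule1.
rewrite -/(braid_left zs w) -/(braid_right zs w).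
have := braid_word sp szz szw.
case: ifP => [_ /vect_sum->|_]; first by [].
case: ifP => [_ /vect_sum->|_ /eqP->]; last by rewrite addr0.
by rewrite vect_opp.
Qed.
End NearRelations.

Lemma psi_y_mx r i : (1 <= r < n)%N -> psi_mx r * y_mx r.+1 * e_mx i =
  (y_mx r * psi_mx r + (residue i r == residue i r.+1)%:R) * e_mx i.
Proof.
case: r => // b r1n; apply: mul_e_mx_ext => t <-; have ltb : (b.+2 <= n)%N by lia.
have [-> _ _] := path_res_tests t ltb.
by rewrite -mulmxE mulmxDl -!mulmxA psi_y_basis //; congr (_ + _);
  case: same_res; rewrite ?mul1mx ?mul0mx ?scale1r ?scale0r.
Qed.

Lemma y_psi_mx r i : (1 <= r < n)%N -> y_mx r.+1 * psi_mx r * e_mx i =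
  (psi_mx r * y_mx r + (residue i r == residue i r.+1)%:R) * e_mx i.
Proof.
case: r => // b r1n; apply: mul_e_mx_ext => t <-; have ltb : (b.+2 <= n)%N by lia.
have [-> _ _] := path_res_tests t ltb.
by rewrite -mulmxE mulmxDl -!mulmxA y_psi_basis //; congr (_ + _);
  case: same_res; rewrite ?mul1mx ?mul0mx ?scale1r ?scale0r.
Qed.

Lemma psi2_mx r i : (1 <= r < n)%N -> psi_mx r ^+ 2 * e_mx i =
  (let a := residue i r in let b := residue i r.+1 in
   if a == b then 0
   else if b == a + 1 then (y_mx r.+1 - y_mx r) * e_mx i
   else if b == a - 1 then (y_mx r - y_mx r.+1) * e_mx i
   else e_mx i).
Proof.
case: r => // b r1n; have ltb : (b.+2 <= n)%N by lia.
(* Taking e(i) out of every branch gives the right side the form required by [mul_e_mx_ext]. *)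
rewrite /= (_ : (if _ then _ else _) =
  (if residue i b.+1 == residue i b.+2 then 0
   else if residue i b.+2 == residue i b.+1 + 1 then y_mx b.+2 - y_mx b.+1
   else if residue i b.+2 == residue i b.+1 - 1 then y_mx b.+1 - y_mx b.+2
   else 1) * e_mx i); last by do !case: ifP => _; rewrite ?mul0r ?mul1r.
apply: mul_e_mx_ext => t <-; have [-> -> ->] := path_res_tests t ltb.
rewrite expr2 -mulmxE -mulmxA psi2_basis //.
by do !case: ifP => _; rewrite ?mul0mx ?mul1mx ?mulmxBl.
Qed.

Lemma braid_mx r i : (1 <= r)%N -> (r.+1 < n)%N ->
  psi_mx r * psi_mx r.+1 * psi_mx r * e_mx i =
  (let a := residue i r in let b := residue i r.+1 in
   let t := psi_mx r.+1 * psi_mx r * psi_mx r.+1 in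
   if (residue i r.+2 == a) && (b == a + 1) then (t + 1) * e_mx i
   else if (residue i r.+2 == a) && (b == a - 1) then (t - 1) * e_mx i
   else t * e_mx i).
Proof.
case: r => // b _ ltb3; have ltb : (b.+2 <= n)%N by lia.
set s := psi_mx b.+2 * _ * _.
rewrite /= (_ : (if _ then _ else _) =
  (s + if (residue i b.+3 == residue i b.+1) && (residue i b.+2 == residue i b.+1 + 1)
       then 1
       else if (residue i b.+3 == residue i b.+1) && (residue i b.+2 == residue i b.+1 - 1)
       then - 1 else 0) * e_mx i); last by do !case: ifP => _; rewrite ?addr0.
apply: mul_e_mx_ext => t <-; have [_ -> ->] := path_res_tests t ltb.
have [_ _ _ S2] := res_eqE k1 e3 b (step t).
rewrite !residue_weight ?S2; [|lia..].
rewrite /s -!mulmxE mulmxDl -!mulmxA braid_basis //; congr (_ + _).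
by do !case: ifP => _; rewrite ?mul1mx ?mul0mx ?mulNmx ?mul1mx.
Qed.

End Relations.

(** * Combinatorics of paths *)

Section PathCombinatorics.
Variable n : nat.
Local Notation T := (n.-tuple bool).
Implicit Types t s : T.

Definition swap r t : T := path_of n (fun k => step t (transpose r k)).
Definition legs t : seq nat := filter (step t) (iota 1 n).
(** Arm-leg counts as a descent because exchanging the two steps lowers the sum of the legs by 1,
    hence also the length of the standard vector. *)
Definition descent t r := ~~ step t r && step t r.+1.
Definition ascent t r := step t r && ~~ step t r.+1.

Lemma step_swap r t k : (1 <= r < n)%N -> step (swap r t) k = step t (transpose r k).
Proof.
move=> r1n; rewrite /swap path_ofK //; have [t0 tn] := step_admissible t; split.
  by rewrite (_ : transpose r 0 = 0%N) //; rewrite /transpose; do !case: eqP; lia.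
move=> l ltl; rewrite (_ : transpose r l = l) ?tn //.
by rewrite /transpose; do !case: eqP; lia.
Qed.

Lemma transposeK r k : transpose r (transpose r k) = k.
Proof. by rewrite /transpose; do !case: eqP; lia. Qed.

Lemma swapK r t : (1 <= r < n)%N -> swap r (swap r t) = t.
Proof. by move=> r1n; apply: step_inj => k _; rewrite !step_swap // transposeK. Qed.

Lemma transpose_l r : transpose r r = r.+1.
Proof. by rewrite /transpose eqxx. Qed.

Lemma transpose_r r : transpose r r.+1 = r.
Proof. by rewrite /transpose eqxx; case: eqP; lia. Qed.

Lemma transpose_out r k : k != r -> k != r.+1 -> transpose r k = k.
Proof. by move=> /negPf nr /negPf nr1; rewrite /transpose nr nr1. Qed.

Lemma swap_descent r t : (1 <= r < n)%N -> descent t r -> ascent (swap r t) r.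
Proof.
by move=> r1n; rewrite /descent /ascent !step_swap // transpose_l transpose_r andbC.
Qed.

Lemma mem_legs t k : (k \in legs t) = (1 <= k <= n)%N && step t k.
Proof. by rewrite mem_filter mem_iota add1n ltnS andbC. Qed.

(** At an ascent exactly one entry of the list of legs changes; the last two conclusions are the
    side conditions of [psi_word_succ]. *)
Lemma legs_split r t : (1 <= r < n)%N -> ascent t r ->
  exists p q, [/\ legs t = p ++ r :: q, legs (swap r t) = p ++ r.+1 :: q,
                  (forall a, a \in p -> (a < r)%N) & (size p < r)%N].
Proof.
move=> r1n asc; have /andP[tr /negPf tr1] := asc.
have Di : iota 1 n = iota 1 r.-1 ++ [:: r; r.+1] ++ iota r.+2 (n - r.+1).
  have -> : n = (r.-1 + (n - r.+1).+2)%N by lia.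
  rewrite iotaD; congr (_ ++ _); rewrite (_ : (1 + r.-1)%N = r); last by lia.
  by congr [:: _, _ & iota _ _]; lia.
have D s : legs s = filter (step s) (iota 1 r.-1) ++
    filter (step s) [:: r; r.+1] ++ filter (step s) (iota r.+2 (n - r.+1)).
  by rewrite /legs Di !filter_cat.
exists (filter (step t) (iota 1 r.-1)), (filter (step t) (iota r.+2 (n - r.+1))).
split.
- by rewrite D /= tr tr1.
- rewrite D /= !step_swap // transpose_l transpose_r tr tr1 /=.
  congr (_ ++ _ :: _); apply: eq_in_filter => k; rewrite mem_iota => Hk;
  by rewrite step_swap // transpose_out //; apply/eqP; lia.
- by move=> a; rewrite mem_filter mem_iota; lia.
- by have := size_filter (step t) (iota 1 r.-1); have := count_size (step t) (iota 1 r.-1);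
    rewrite size_iota; lia.
Qed.

Lemma size_legs_swap r t : (1 <= r < n)%N -> ascent t r ->
  size (legs (swap r t)) = size (legs t).
Proof. by move=> r1n /(legs_split r1n)[p [q [-> -> _ _]]]; rewrite !size_cat. Qed.

Lemma size_legs_swap_descent r t : (1 <= r < n)%N -> descent t r ->
  size (legs (swap r t)) = size (legs t).
Proof.
move=> r1n /(swap_descent r1n)/(size_legs_swap r1n).
by rewrite swapK.
Qed.

Lemma sumn_legs_swap r t : (1 <= r < n)%N -> ascent t r ->
  sumn (legs (swap r t)) = (sumn (legs t)).+1.
Proof.
by move=> r1n /(legs_split r1n)[p [q [-> -> _ _]]]; rewrite !sumn_cat /= addSn addnS.
Qed.

Lemma sumn_legs_descent r t : (1 <= r < n)%N -> descent t r ->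
  sumn (legs t) = (sumn (legs (swap r t))).+1.
Proof.
by move=> r1n /(swap_descent r1n)/(sumn_legs_swap r1n); rewrite swapK.
Qed.

Lemma legs_sub t s : (forall k, (1 <= k <= n)%N -> step t k -> step s k) ->
  size (legs t) = size (legs s) -> t = s.
Proof.
move=> sub szts; have sts : subseq (legs t) (legs s).
  have -> : legs t = filter (step t) (legs s).
    rewrite -filter_predI; apply: eq_in_filter => k; rewrite mem_iota => Hk /=.
    by case tk : (step t k) => //=; rewrite sub //; lia.
  exact: filter_subseq.
have /eqP eqts : legs t == legs s by rewrite -(size_subseq_leqif sts) szts.
apply: step_inj => k k1n; have := mem_legs t k.
by rewrite eqts mem_legs k1n.
Qed.

(** Without descents the legs of the interval precede its arms. Two such paths that agree elsewhere
    are nested, and equal numbers of legs make them equal. *)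
Lemma no_descent_unique a b t s : (1 <= a)%N -> (b <= n)%N ->
  (forall r, (a <= r < b)%N -> ~~ descent t r) ->
  (forall r, (a <= r < b)%N -> ~~ descent s r) ->
  (forall k, (1 <= k <= n)%N -> ~~ (a <= k <= b)%N -> step t k = step s k) ->
  size (legs t) = size (legs s) -> t = s.
Proof.
move=> a1 bn; have mono t' : (forall r, (a <= r < b)%N -> ~~ descent t' r) ->
    forall k l, (a <= k)%N -> (k <= l)%N -> (l <= b)%N -> step t' l -> step t' k.
  move=> nd k l ak; elim: l => [|l IH]; first by rewrite leqn0 => /eqP->.
  rewrite leq_eqVlt => /orP[/eqP->//|kl] lb tl1; apply: IH => //; first by lia.
  by have := nd l; rewrite /descent tl1 andbT negbK; apply; lia.
(* If no position of the interval is a leg of one path and an arm of the other, they agree. The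
   choice of [k] orients the inclusion: the legs of [t] in the interval lie before [k], where [s]
   has only legs. *)
wlog [k [ak [tk sk]]] : t s / exists k, (a <= k <= b)%N /\ step s k /\ step t k = false.
  move=> W ndt nds out szts.
  case: (EM (exists k, (a <= k <= b)%N /\ step s k /\ step t k = false)) => [H|H1].
    exact: W.
  case: (EM (exists k, (a <= k <= b)%N /\ step t k /\ step s k = false)) => [H|H2].
    by symmetry; apply: W => // k k1 k2; rewrite out.
  apply: step_inj => k k1n; case: (boolP (a <= k <= b)%N) => [akb|]; last exact: out.
  case tk : (step t k); case sk : (step s k) => //.
    by case: H2; exists k.
  by case: H1; exists k.
move=> /mono mt /mono ms out; apply: legs_sub => l l1n tl.
case: (boolP (a <= l <= b)%N) => [alb|nalb]; last by rewrite -out.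
case: (leqP l k) => [lk|/ltnW kl]; first by apply: (ms l k) => //; lia.
suff: step t k by rewrite sk.
by apply: (mt k l) => //; lia.
Qed.

Definition low_path m : T := path_of n (fun k => k <= m)%N.

Section LowPath.
Variable m : nat.
Hypothesis lemn : (m <= n)%N.

Lemma step_low k : step (low_path m) k = (k <= m)%N.
Proof. by rewrite path_ofK //; split=> // l; lia. Qed.

Lemma legs_low : legs (low_path m) = iota 1 m.
Proof.
rewrite /legs (eq_filter step_low) -[in LHS](subnKC lemn) iotaD filter_cat.
have /all_filterP-> : all (fun k => k <= m)%N (iota 1 m).
  by apply/allP => k; rewrite mem_iota; lia.
rewrite (@eq_in_filter _ _ pred0) ?filter_pred0 ?cats0 // => k.
by rewrite mem_iota /=; lia.
Qed.

Lemma low_path_no_descent r : ~~ descent (low_path m) r.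
Proof. by rewrite /descent !step_low; lia. Qed.

Lemma low_or_descent t : size (legs t) = m ->
  t = low_path m \/ exists2 r, (1 <= r < n)%N & descent t r.
Proof.
move=> szt; case: (EM (exists2 r, (1 <= r < n)%N & descent t r)) => [|nd]; [by right|left].
apply: (@no_descent_unique 1 n) => //.
- by move=> r r1n; apply/negP => d; case: nd; exists r.
- by move=> r _; exact: low_path_no_descent.
- by move=> k ->.
by rewrite szt legs_low size_iota.
Qed.

(** Raising swaps correspond to the factors psi in v(a_1, ..., a_m), and [low_path] to the
    generator, so this is induction on the length of a standard vector. *)
Lemma path_ind (P : T -> Prop) : P (low_path m) ->
  (forall r t, (1 <= r < n)%N -> ascent t r -> size (legs t) = m -> P t -> P (swap r t)) ->
  forall t, size (legs t) = m -> P t.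
Proof.
move=> P0 PS t; have [l] := ubnP (sumn (legs t)); elim: l t => // l IH t ltl szt.
have [->//|[r r1n d]] := low_or_descent szt.
have a := swap_descent r1n d; rewrite -[t](swapK t r1n).
have := sumn_legs_descent r1n d => Hs.
apply: PS => //; rewrite ?size_legs_swap_descent //.
by apply: IH; rewrite ?size_legs_swap_descent //; lia.
Qed.

End LowPath.
End PathCombinatorics.

(** * Action of the generators on paths *)

Section Action.
Variables (F : fieldType) (e n : nat) (k1 : 'Z_e).
Local Notation T := (n.-tuple bool).
Local Notation basis := (@basis n F).
Local Notation psi_mx := (psi_mx F e n).
Local Notation y_mx := (y_mx F e n).
Implicit Types t s : T.

Lemma rule_mx_word4 (R : rule) b t : preserves_size R ->
  rule_mx n F e R b.+1 *m basis t = vect n F b (step t)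
    (R (e %| b)%N (e %| b.+1)%N (e %| b.+2)%N
      [:: step t b; step t b.+1; step t b.+2; step t b.+3]).
Proof.
move=> szR; rewrite mx_ofE local_word4 ?size_word // !nth_zlist //.
by rewrite succnK word4 addn0 addn1 addn2.
Qed.

Lemma psi_mx_word4 b t : (b.+2 <= n)%N -> psi_mx b.+1 *m basis t =
  vect n F b (step t) (psi_rule (e %| b)%N (e %| b.+1)%N (e %| b.+2)%N
      [:: step t b; step t b.+1; step t b.+2; step t b.+3]).
Proof.
by move=> ltb; rewrite /psi_mx ifT // rule_mx_word4 //; exact: psi_rule_size.
Qed.

Lemma y_mx_word4 b t : (b.+1 <= n)%N -> y_mx b.+1 *m basis t =
  vect n F b (step t) (y_rule (e %| b)%N (e %| b.+1)%N (e %| b.+2)%N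
      [:: step t b; step t b.+1; step t b.+2; step t b.+3]).
Proof.
by move=> ltb; rewrite /y_mx ifT // rule_mx_word4 //; exact: y_rule_size.
Qed.

Lemma path_of_put_swap b N r t w : (1 <= r < n)%N -> (b <= r)%N -> (r.+1 < b + N)%N ->
  w = word b N (fun k => step t (transpose r k)) ->
  path_of n (put b w (step t)) = swap r t.
Proof.
move=> r1n br rN ->; rewrite put_word_eq // => k Hk.
by rewrite transpose_out //; apply/eqP; lia.
Qed.

Lemma put_swap4 b t : (b.+2 <= n)%N ->
  path_of n (put b [:: step t b; step t b.+2; step t b.+1; step t b.+3] (step t)) =
  swap b.+1 t.
Proof.
move=> ltb; apply: (@path_of_put_swap b 4); [lia..|].
by have [H0 H1 H2 H3] := transpose_window b; rewrite word4 H0 H1 H2 H3.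
Qed.

Lemma psi_mx_ascent r t : (1 <= r < n)%N -> ascent t r ->
  psi_mx r *m basis t = basis (swap r t).
Proof.
case: r => // b r1n /andP[tr /negPf tr1]; rewrite psi_mx_word4 //.
by rewrite -put_swap4 // tr tr1 /= expr0 scale1r.
Qed.

Lemma psi_mx_descent r t : (1 <= r < n)%N -> descent t r ->
  ~~ (e %| r.-1)%N -> ~~ (e %| r)%N -> ~~ (e %| r.+1)%N ->
  psi_mx r *m basis t = basis (swap r t).
Proof.
case: r => // b r1n /andP[/negPf tr tr1] /= /negPf z1 /negPf z0 /negPf zm.
rewrite psi_mx_word4 // -put_swap4 // tr tr1 z1 z0 zm /=.
by rewrite expr0 scale1r.
Qed.

Hypothesis e3 : (3 <= e)%N.

(** As [e] divides [r] it does not divide [r - 1], so only one clause of [y_rule] can apply; the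
    swap stays in range because step [n + 1] is an arm. *)
Lemma y_mx_block r t : (1 <= r <= n)%N -> (e %| r)%N ->
  y_mx r *m basis t = if descent t r then - basis (swap r t) else 0.
Proof.
case: r => // b r1n z0; rewrite y_mx_word4 // z0 /descent.
have /negPf -> : ~~ (e %| b)%N by have := dvdn_succF e3 b; rewrite z0 andbT.
case: (boolP (_ && _)) => [/andP[/negPf tr tr1]|nd] /=; last by rewrite (negPf nd).
rewrite tr tr1 /= expr1 scaleN1r; congr (- basis _).
have ltb : (b.+2 <= n)%N.
  by rewrite ltnNge; apply/negP => le; move: tr1; rewrite (step_admissible t).2 //; lia.
by rewrite -put_swap4 // tr tr1.
Qed.

Lemma weight_swap r t : (1 <= r < n)%N -> ascent t r ->
  weight k1 (swap r t) = swap_residues r (weight k1 t).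
Proof.
case: r => // b r1n asc; apply: eq_seq_of_residues => k k1n.
have r1n' : (1 <= b.+1 <= n)%N by lia.
rewrite residue_weight; last by do !case: eqP => //; lia.
have E : step (swap b.+1 t) = put b (word b 4 (step (swap b.+1 t))) (step t).
  rewrite put_word_eq // => l Hl; rewrite step_swap // transpose_out //;
  by apply/eqP; lia.
have := @psi_path_res e k1 e3 b (step t) (false, word b 4 (step (swap b.+1 t))).
rewrite -E => -> //; rewrite !word4 !step_swap //.
have [-> -> -> ->] := transpose_window b.
by case/andP: asc => -> /negPf->.
Qed.

(** Next to a multiple of [e], psi_r alone does not undo the swap. A product of psi_r with its
    neighbour on the side of that multiple does, up to a sign, in an order depending on the step
    beyond. *)
Lemma reverse_swap r t : (2 <= r)%N -> (r.+1 < n)%N -> descent t r ->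
  (e %| r.-1)%N || (e %| r.+1)%N ->
  exists c p q, [/\ (1 <= p < n)%N, (1 <= q < n)%N, c * c = 1 &
    psi_mx p *m (psi_mx q *m basis t) = c *: basis (swap r t)].
Proof.
move=> r2 ltr1n /andP[/negPf tr tr1] /orP[z|z].
- case: r r2 ltr1n tr tr1 z => // -[|b] // _ ltb tr tr1 /= z.
  have := reverse_right (zlist_spaced b 4 e3) (size_mkseq _ _) (size_word b 5 (step t)).
  rewrite nth_zlist // !nth_word // addn0 addn1 addn2 addn3 addn4 z tr tr1 implyTb.
  have r1n : (1 <= b.+2 < n)%N by lia.
  have S : path_of n (put b [:: step t b; step t b.+1; true; false; step t b.+4] (step t))
      = swap b.+2 t.
    apply: (@path_of_put_swap b 5); [lia..|].
    rewrite word5 transpose_l transpose_r tr tr1 !transpose_out //; try by apply/eqP; lia.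
  have L2 : (b.+2 <= n)%N by lia.
have L3 : (b.+3 <= n)%N by lia.
have wf0 := wf_word_path b 5 t.
  case t1 : (step t b.+1) => /eqP H; rewrite t1 in S.
    exists ((-1) ^+ false), b.+2, b.+1; split; [lia|lia|by rewrite mulr1|].
    rewrite (basis_vect F b 5 t).
    have [-> wf1] := act_psi0 F e3 (t := t) L2 wf0.
    by rewrite (act_psi1 F e3 (t := t) L2 L3 wf1).1 then_rule1 H /= S.
  exists ((-1) ^+ true), b.+1, b.+2; split; [lia|lia|by rewrite mulrNN mulr1|].
  rewrite (basis_vect F b 5 t).
  have [-> wf1] := act_psi1 F e3 (t := t) L2 L3 wf0.
  by rewrite (act_psi0 F e3 (t := t) L2 wf1).1 then_rule1 H /= S.
case: r r2 ltr1n tr tr1 z => // b _ ltb tr tr1 z.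
have := reverse_left (zlist_spaced b 4 e3) (size_mkseq _ _) (size_word b 5 (step t)).
rewrite nth_zlist // !nth_word // addn0 addn1 addn2 addn3 addn4 z tr tr1 implyTb.
have r1n : (1 <= b.+1 < n)%N by lia.
have S : path_of n (put b [:: step t b; true; false; step t b.+3; step t b.+4] (step t))
    = swap b.+1 t.
  apply: (@path_of_put_swap b 5); [lia..|].
  by rewrite word5 transpose_l transpose_r tr tr1 !transpose_out //; apply/eqP; lia.
have L2 : (b.+2 <= n)%N by lia.
have L3 : (b.+3 <= n)%N by lia.
have wf0 := wf_word_path b 5 t.
case t1 : (step t b.+3) => /eqP H; rewrite t1 in S.
  exists ((-1) ^+ false), b.+2, b.+1; split; [lia|lia|by rewrite mulr1|].
  rewrite (basis_vect F b 5 t).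
  have [-> wf1] := act_psi0 F e3 (t := t) L2 wf0.
  by rewrite (act_psi1 F e3 (t := t) L2 L3 wf1).1 then_rule1 H /= S.
exists ((-1) ^+ true), b.+1, b.+2; split; [lia|lia|by rewrite mulrNN mulr1|].
rewrite (basis_vect F b 5 t).
have [-> wf1] := act_psi1 F e3 (t := t) L2 L3 wf0.
by rewrite (act_psi0 F e3 (t := t) L2 wf1).1 then_rule1 H /= S.
Qed.

End Action.

(* The part of the structure of the cyclotomic algebra needed below. Keeping the
   algebra abstract stops unification from unfolding the iterated quotients. *)
Record klr_rep (F : fieldType) (e n : nat) (k1 : 'Z_e) (A : pzRingType) := KlrRep {
  gen_psi : nat -> A;
  gen_y : nat -> A;
  gen_e : n.-tuple 'Z_e -> A;
  gen_sc : F -> A;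
  rep : A -> 'M[F]_((dimV n).+1);
  gen_e_idem : forall i j, gen_e i * gen_e j = (i == j)%:R * gen_e i;
  gen_psi_e : forall r i, (1 <= r < n)%N ->
    gen_psi r * gen_e i = gen_e (swap_residues r i) * gen_psi r;
  gen_psi_y_far : forall r s, (1 <= r < n)%N -> (1 <= s <= n)%N -> s != r -> s != r.+1 ->
    gen_psi r * gen_y s = gen_y s * gen_psi r;
  gen_psi_far : forall r s, (r.+1 < s)%N || (s.+1 < r)%N ->
    gen_psi r * gen_psi s = gen_psi s * gen_psi r;
  gen_psi_y : forall r i, (1 <= r < n)%N -> gen_psi r * gen_y r.+1 * gen_e i =
    (gen_y r * gen_psi r + (residue i r == residue i r.+1)%:R) * gen_e i;
  gen_y_psi : forall r i, (1 <= r < n)%N -> gen_y r.+1 * gen_psi r * gen_e i =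
    (gen_psi r * gen_y r + (residue i r == residue i r.+1)%:R) * gen_e i;
  gen_psi2 : forall r i, (1 <= r < n)%N -> exists c d : int,
    gen_psi r ^+ 2 * gen_e i = (c%:~R * (gen_y r - gen_y r.+1) + d%:~R) * gen_e i;
  gen_braid : forall r i, (1 <= r)%N -> (r.+1 < n)%N -> exists c : int,
    gen_psi r * gen_psi r.+1 * gen_psi r * gen_e i =
    (gen_psi r.+1 * gen_psi r * gen_psi r.+1 + c%:~R) * gen_e i;
  gen_scD : {morph gen_sc : c d / c + d};
  gen_scM : {morph gen_sc : c d / c * d};
  gen_sc1 : gen_sc 1 = 1;
  gen_sc_central : forall c a, gen_sc c * a = a * gen_sc c;
  gen_ind : forall P : A -> Prop,
    (forall a b, P a -> P b -> P (a + b)) -> (forall a b, P a -> P b -> P (a * b)) ->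
    (forall c, P (gen_sc c)) -> (forall i, P (gen_e i)) ->
    (forall r, (1 <= r <= n)%N -> P (gen_y r)) ->
    (forall r, (1 <= r < n)%N -> P (gen_psi r)) -> forall a, P a;
  repD : {morph rep : a b / a + b};
  repM : {morph rep : a b / a * b};
  rep1 : rep 1 = 1;
  rep_psi : forall r, rep (gen_psi r) = psi_mx F e n r;
  rep_y : forall r, rep (gen_y r) = y_mx F e n r;
  rep_idem : forall i, rep (gen_e i) = e_mx F k1 i;
  rep_sc : forall c, rep (gen_sc c) = c%:M
}.

(** * Coordinates and supports of vectors *)

Section Coordinates.
Variables (F : fieldType) (n : nat).
Local Notation T := (n.-tuple bool).
Local Notation V := 'cV[F]_((dimV n).+1).
Local Notation E := 'M[F]_((dimV n).+1).
Local Notation basis := (@basis n F).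
Local Notation coord := (@coord n F).
Implicit Types (t s : T) (u : V).

Lemma coordD u v t : coord (u + v) t = coord u t + coord v t.
Proof. by rewrite /coord mxE. Qed.

Lemma coordZ c u t : coord (c *: u) t = c * coord u t.
Proof. by rewrite /coord mxE. Qed.

Lemma coordN u t : coord (- u) t = - coord u t.
Proof. by rewrite /coord mxE. Qed.

Lemma coord0 t : coord 0 t = 0.
Proof. by rewrite /coord mxE. Qed.

Lemma coord_big (I : Type) (r : seq I) (P : pred I) (f : I -> V) t :
  coord (\sum_(i <- r | P i) f i) t = \sum_(i <- r | P i) coord (f i) t.
Proof. by rewrite /coord summxE. Qed.

Lemma coord_mulmx (A : E) u t :
  coord (A *m u) t = \sum_s coord u s * coord (A *m basis s) t.
Proof.
rewrite -[in LHS](sum_coord u) mulmx_sumr coord_big; apply: eq_bigr => s _.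
by rewrite -scalemxAr coordZ.
Qed.

Lemma neq0_coord u : u != 0 -> exists t, coord u t != 0.
Proof.
move=> u0; case: (EM (exists t, coord u t != 0)) => // H; case/eqP: u0.
apply: coord_inj => t; rewrite coord0; apply/eqP/negPn/negP => Ht.
by case: H; exists t.
Qed.

Definition supported (P : pred T) u := forall t, coord u t != 0 -> P t.

Lemma supported0 P : supported P 0.
Proof. by move=> t; rewrite coord0 eqxx. Qed.

Lemma supportedD P u v : supported P u -> supported P v -> supported P (u + v).
Proof.
move=> Pu Pv t; rewrite coordD; have [->|/Pu//] := eqVneq (coord u t) 0.
by rewrite add0r => /Pv.
Qed.

Lemma supportedZ P c u : supported P u -> supported P (c *: u).
Proof. by move=> Pu t; rewrite coordZ mulf_eq0 negb_or => /andP[_ /Pu]. Qed.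

Lemma supportedN P u : supported P u -> supported P (- u).
Proof. by rewrite -scaleN1r; exact: supportedZ. Qed.

Lemma supported_basis (P : pred T) t : P t -> supported P (basis t).
Proof. by move=> Pt s; rewrite coord_basis; have [<-//|_] := eqVneq t s; rewrite eqxx. Qed.

Lemma supported_mulmx (P P' : pred T) (A : E) u :
  (forall s, P s -> supported P' (A *m basis s)) -> supported P u ->
  supported P' (A *m u).
Proof.
move=> PA Pu; rewrite -(sum_coord u) mulmx_sumr.
elim/big_ind: _ => [||s _]; [exact: supported0|by move=> x y; exact: supportedD|].
rewrite -scalemxAr; have [->|us] := eqVneq (coord u s) 0.
  by rewrite scale0r; exact: supported0.
by apply/supportedZ/PA/Pu.
Qed.

End Coordinates.

(** * Invariance of the paths from an arm to a leg *)

Section Irreducible.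
Variables (F : fieldType) (e n : nat) (k1 : 'Z_e).
Hypothesis (e3 : (3 <= e)%N) (n1 : (1 <= n)%N) (dv : (e %| n)%N).
Local Notation T := (n.-tuple bool).
Variables (A : pzRingType) (R : klr_rep F n k1 A).
Local Notation rep := (rep R).
Local Notation supported := (@supported F n).
Implicit Types (t s : T).

Definition first_arm_last_leg t := ~~ step t 1 && step t n.

Lemma le_en : (e <= n)%N.
Proof. exact: dvdn_leq. Qed.

Lemma step_last_succ t : step t n.+1 = false.
Proof. by apply: (step_admissible t).2. Qed.

(* Near position 1 we use that position 0 counts as a leg, near position n that
   position n + 1 counts as an arm and that e divides n. *)
Lemma rule_keeps_ends (Q : rule) b t p :
  (Q = psi_rule /\ (b.+2 <= n)%N) \/ (Q = y_rule /\ (b.+1 <= n)%N) ->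
  first_arm_last_leg t ->
  Q (e %| b)%N (e %| b.+1)%N (e %| b.+2)%N
    [:: step t b; step t b.+1; step t b.+2; step t b.+3] = Some p ->
  admissible n (put b p.2 (step t)) -> first_arm_last_leg (path_of n (put b p.2 (step t))).
Proof.
move=> QQ /andP[/negPf t1 tn] Qp okp; rewrite /first_arm_last_leg path_ofK //.
have en := le_en; have tn1 := step_last_succ t.
have szp : size p.2 = 4%N by case: QQ => -[E _]; rewrite E in Qp;
  [exact: psi_rule_size Qp|exact: y_rule_size Qp].
have N d : (0 < d < 3)%N -> (e %| d)%N = false.
  by move=> d12; apply/negP => /dvdn_leq; lia.
have Nn d : (0 < d < 3)%N -> (e %| n - d)%N = false.
  by move=> d12; rewrite dvdn_subr //; [exact: N|lia].
have H1 : put b p.2 (step t) 1 = false.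
  case: b => [|[|b]] in QQ Qp okp *; last by rewrite put_outside.
    move: Qp; rewrite t1 (_ : step t 0 = true) // dvdn0 !N //.
    by case: QQ => -[-> _]; case: (step t 2); case: (step t 3).
  have -> : put 1 p.2 (step t) 1 = nth false p.2 0.
    by rewrite -(@nth_put 1 p.2 (step t) 0) ?szp.
  move: Qp; rewrite t1 (N 1%N) // (N 2%N) //.
  by case: QQ => -[-> _]; case: (step t 2); case: (step t 3); case: (step t 4);
     case: (e %| 3)%N => //= -[<-].
rewrite H1 /=; move: Qp okp H1; case: p szp => s w /= szw Qp okp H1.
have [lt|ge] := leqP (b + 4) n; first by rewrite put_outside ?szw ?lt ?orbT.
have : [|| n == b.+1, n == b.+2 | n == b.+3] by lia.
have P f k v i : size v = 4%N -> k = (b + i)%N -> (i < 4)%N -> put b v f k = nth false v i.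
  by move=> szv -> lt; rewrite nth_put ?szv.
case/or3P => /eqP En.
- case: QQ => -[E]; first by lia.
  move=> _; move: Qp; rewrite E -En tn -[in (e %| b)%N](_ : n - 1 = b)%N ?Nn //; last by lia.
  by rewrite /= andbF.
- have Z1 : (e %| b)%N = false by rewrite (_ : b = n - 2)%N ?Nn //; lia.
  have Z0 : (e %| b.+1)%N = false by rewrite (_ : b.+1 = n - 1)%N ?Nn //; lia.
  move: Qp; rewrite Z1 Z0 -En dv tn tn1.
  by case: QQ => -[-> _]; case: (step t b); case: (step t b.+1) => //= -[_ <-];
     rewrite (P _ _ _ 2%N) //; lia.
have Z0 : (e %| b.+1)%N = false by rewrite (_ : b.+1 = n - 2)%N ?Nn //; lia.
have Zm : (e %| b.+2)%N = false by rewrite (_ : b.+2 = n - 1)%N ?Nn //; lia.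
move: Qp; rewrite Z0 Zm -En tn.
by case: QQ => -[-> _]; case: (step t b); case: (step t b.+1); case: (step t b.+2);
  case: (e %| b)%N => //= -[_ <-]; rewrite (P _ _ _ 3%N) //; lia.
Qed.

Lemma supported_vect b f (P : pred T) o :
  (forall p, o = Some p -> P (path_of n (put b p.2 f))) -> supported P (vect n F b f o).
Proof.
case: o => [p|] H; last exact: supported0.
by apply/supportedZ/supported_basis/H.
Qed.

(** Each generator respects both ends by [rule_keeps_ends], so these paths span a submodule; the
    image of phi_m lies in it because its generator does. *)
Lemma rep_keeps_ends (a : A) u : supported first_arm_last_leg u ->
  supported first_arm_last_leg (rep a *m u).
Proof.
elim/(@gen_ind _ _ _ _ _ R): a u => [a b Pa Pb|a b Pa Pb|c|i|r r1n|r r1n] u Qu.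
- by rewrite repD mulmxDl; apply: supportedD; [apply: Pa|apply: Pb].
- by rewrite repM -mulmxE -mulmxA; apply/Pa/Pb.
- by rewrite rep_sc mul_scalar_mx; exact: supportedZ.
- rewrite rep_idem; apply: supported_mulmx Qu => s Qs.
  by rewrite e_mxE; apply/supportedZ/supported_basis.
- rewrite rep_y; apply: supported_mulmx Qu => s Qs.
  case: r r1n => // b r1n; rewrite y_mx_word4 //; apply: supported_vect => p Rp.
  apply: (rule_keeps_ends _ Qs Rp) => //; first by right.
  by have := y_keeps (e := e) r1n (step_admissible s) (p := p); rewrite !succnK word4; apply.
rewrite rep_psi; apply: supported_mulmx Qu => s Qs.
case: r r1n => // b r1n; rewrite psi_mx_word4 //; apply: supported_vect => p Rp.
apply: (rule_keeps_ends _ Qs Rp) => //; first by left.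
by have := psi_keeps (e := e) r1n (step_admissible s) (p := p); rewrite !succnK word4; apply.
Qed.

End Irreducible.

(** * Connecting paths *)

Section Reach.
Variables (F : fieldType) (e n : nat) (k1 : 'Z_e).
Hypothesis (e3 : (3 <= e)%N) (n1 : (1 <= n)%N) (dv : (e %| n)%N).
Local Notation T := (n.-tuple bool).
Local Notation basis := (@basis n F).
Local Notation coord := (@coord n F).
Local Notation y_mx := (y_mx F e n).
Local Notation e_mx := (@e_mx F e n k1).
Variables (A : pzRingType) (R : klr_rep F n k1 A).
Local Notation rep := (rep R).
Local Notation supported := (@supported F n).
Implicit Types (t s : T).

Definition reach s t := exists a : A, rep a *m basis s = basis t.

Lemma reach_refl t : reach t t.
Proof. by exists 1; rewrite rep1 mul1mx. Qed.

Lemma reach_trans s t v : reach s t -> reach t v -> reach s v.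
Proof.
move=> [a Ha] [b Hb]; exists (b * a).
by rewrite repM -mulmxE -mulmxA Ha.
Qed.

Lemma reach_scaled s t (a : A) c : c != 0 ->
  rep a *m basis s = c *: basis t -> reach s t.
Proof.
move=> c0 Ha; exists (gen_sc R c^-1 * a).
rewrite repM rep_sc -mulmxE -mulmxA Ha mul_scalar_mx scalerA.
by rewrite mulVf // scale1r.
Qed.

Lemma reach_ascent r t : (1 <= r < n)%N -> ascent t r -> reach t (swap r t).
Proof.
by move=> r1n asc; exists (gen_psi R r); rewrite rep_psi psi_mx_ascent.
Qed.

(** The swap is undone by y_r if [e] divides [r], by two psi if [e] divides a neighbour of [r], and
    by psi_r otherwise. The bounds keep it away from the first and last steps. *)
Lemma reach_descent r t : (2 <= r)%N -> (r.+1 < n)%N -> descent t r -> reach t (swap r t).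
Proof.
move=> r2 rn d; have r1n : (1 <= r < n)%N by lia.
have [z0|nz0] := boolP (e %| r)%N.
  apply: (@reach_scaled _ _ (gen_y R r) (-1)); first by rewrite oppr_eq0 oner_eq0.
  by rewrite rep_y y_mx_block ?d ?scaleN1r //; lia.
have [z|] := boolP ((e %| r.-1) || (e %| r.+1))%N.
  have [c [p [q [p1n q1n cc H]]]] := reverse_swap F e3 r2 rn d z.
  apply: (@reach_scaled _ _ (gen_psi R p * gen_psi R q) c).
    by apply/eqP => c0; move/eqP: cc; rewrite c0 mul0r eq_sym oner_eq0.
  by rewrite repM !rep_psi -mulmxE -mulmxA.
rewrite negb_or => /andP[z1 zm]; exists (gen_psi R r).
by rewrite rep_psi psi_mx_descent.
Qed.

Definition ends_in (b : bool) m t := [&& step t 1 == b, step t n & size (legs t) == m].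

Lemma ends_in_swap b m r t : (2 <= r)%N -> (r.+1 < n)%N -> descent t r ->
  ends_in b m t -> ends_in b m (swap r t).
Proof.
move=> r2 rn d; have r1n : (1 <= r < n)%N by lia.
rewrite /ends_in !step_swap // size_legs_swap_descent //.
by rewrite !transpose_out //; apply/eqP; lia.
Qed.

(** Lowering swaps of interior steps lead from both paths to the one whose interior legs come first;
    [reach_ascent] then climbs back up to [t]. *)
Lemma reach_ends_in b m s t : ends_in b m s -> ends_in b m t -> reach s t.
Proof.
have [l] := ubnP (sumn (legs s) + sumn (legs t)); elim: l s t => // l IH s t lts es et.
have [[r [r2 rn d]]|nds] := EM (exists r, [/\ (2 <= r)%N, (r.+1 < n)%N & descent s r]).
  have r1n : (1 <= r < n)%N by lia.
  apply: reach_trans (reach_descent r2 rn d) _.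
  apply: IH et; last exact: ends_in_swap.
  by move: lts; rewrite (sumn_legs_descent r1n d) addSn ltnS.
have [[r [r2 rn d]]|ndt] := EM (exists r, [/\ (2 <= r)%N, (r.+1 < n)%N & descent t r]).
  have r1n : (1 <= r < n)%N by lia.
  apply: (@reach_trans _ (swap r t)).
    apply: IH es _; last exact: ends_in_swap.
    by move: lts; rewrite (sumn_legs_descent r1n d) addnS ltnS.
  by rewrite -[in X in reach _ X](swapK t r1n); apply/reach_ascent/swap_descent.
suff -> : s = t by exact: reach_refl.
move: es et => /and3P[/eqP s1 sn /eqP szs] /and3P[/eqP t1 tn /eqP szt].
apply: (@no_descent_unique n 2 n.-1); rewrite ?szs ?szt //; first by lia.
- by move=> r Hr; apply/negP => d; case: nds; exists r; split=> //; lia.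
- by move=> r Hr; apply/negP => d; case: ndt; exists r; split=> //; lia.
move=> k k1n Hk; have : (k == 1%N) || (k == n) by lia.
case/orP => /eqP Ek; first by rewrite Ek s1.
have K (g h : nat -> bool) : g n -> h n -> g k = h k by rewrite Ek => -> ->.
exact: K.
Qed.

Lemma block_descent r t : (1 <= r <= n)%N -> (e %| r)%N -> descent t r ->
  (2 <= r)%N /\ (r.+1 < n)%N.
Proof.
move=> r1n z /andP[_ tr1]; have := dvdn_leq _ z.
have : r.+1 != n by apply/eqP => En; have := dvdn_succF e3 r; rewrite z En dv.
have : r != n by apply/eqP => En; move: tr1; rewrite (step_admissible t).2 // En.
by lia.
Qed.

Lemma supported_y r b m u : (1 <= r <= n)%N -> (e %| r)%N ->
  supported (ends_in b m) u -> supported (ends_in b m) (y_mx r *m u).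
Proof.
move=> r1n z; apply: supported_mulmx => t et; rewrite y_mx_block //.
case: (boolP (descent t r)) => [d|_]; last exact: supported0.
have [r2 rn] := block_descent r1n z d.
exact/supportedN/supported_basis/ends_in_swap.
Qed.

Lemma y_mx_block_sq r : (1 <= r <= n)%N -> (e %| r)%N -> y_mx r * y_mx r = 0.
Proof.
move=> r1n z; apply: mx_basis_ext => t; rewrite -mulmxE -mulmxA mul0mx y_mx_block //.
case: (boolP (descent t r)) => [d|_]; last by rewrite mulmx0.
have [r2 rn] := block_descent r1n z d.
have /andP[asc _] : ascent (swap r t) r by apply: swap_descent => //; lia.
by rewrite mulmxN y_mx_block // /descent asc oppr0.
Qed.

(** Paths with a descent at [r] go to distinct paths up to sign, so their contributions to
    [y_mx r *m u] cannot cancel. *)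
Lemma y_mx_kernel r u t : (1 <= r <= n)%N -> (e %| r)%N -> y_mx r *m u = 0 ->
  coord u t != 0 -> ~~ descent t r.
Proof.
move=> r1n z yu0 ut; apply/negP => d; have [r2 rn] := block_descent r1n z d.
have r1n' : (1 <= r < n)%N by lia.
move/(congr1 (coord ^~ (swap r t))): yu0; rewrite coord0 coord_mulmx (bigD1 t) //= big1.
  rewrite addr0 y_mx_block // d coordN coord_basis eqxx mulrN1 => /eqP.
  by rewrite oppr_eq0 (negPf ut).
move=> s ne; rewrite y_mx_block //; case: ifP => _; last by rewrite coord0 mulr0.
by rewrite coordN coord_basis (can_eq (fun s => swapK s r1n')) (negPf ne) oppr0 mulr0.
Qed.

(** The y_r commute, and square to zero at multiples of [e]: it suffices to multiply by each y_r in
    turn exactly when the result is nonzero. *)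
Lemma kill_blocks b m u (rs : seq nat) : u != 0 -> supported (ends_in b m) u ->
  (forall r, r \in rs -> (1 <= r <= n)%N && (e %| r)%N) ->
  exists a : A, [/\ rep a *m u != 0, supported (ends_in b m) (rep a *m u) &
    forall r, r \in rs -> y_mx r *m (rep a *m u) = 0].
Proof.
move=> u0 su; elim: rs => [|r rs IH] Hrs.
  by exists 1; rewrite rep1 mul1mx; split.
have [|a [a0 sa ya]] := IH; first by move=> r' r'rs; apply: Hrs; rewrite inE r'rs orbT.
have /andP[r1n z] := Hrs r (mem_head _ _).
have [ya0|ya0] := eqVneq (y_mx r *m (rep a *m u)) 0.
  by exists a; split=> // r'; rewrite inE => /predU1P[->|/ya].
exists (gen_y R r * a).
rewrite repM rep_y -mulmxE -mulmxA; split=> //; first exact: supported_y.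
move=> r'; rewrite inE => /predU1P[->|/ya yr'].
  by rewrite mulmxA mulmxE y_mx_block_sq // mul0mx.
by rewrite mulmxA mulmxE y_mxC // -mulmxE -mulmxA yr' mulmx0.
Qed.

(* With no descent at the multiples of e, the residues determine the path: at
   k = 0 mod e both steps have residue h, but the next residue is h + 1 after an
   arm and h or h - 1 after a leg. *)
Lemma weight_inj s t : (forall r, (1 <= r <= n)%N -> (e %| r)%N -> ~~ descent s r) ->
  (forall r, (1 <= r <= n)%N -> (e %| r)%N -> ~~ descent t r) ->
  step s n = step t n -> weight k1 s = weight k1 t -> s = t.
Proof.
move=> nds ndt eqn eqw.
have res_eq r : (1 <= r <= n)%N -> path_res k1 (step s) r = path_res k1 (step t) r.
  by move=> r1n; rewrite -!residue_weight // eqw.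
have N d : (0 < d < 3)%N -> (d%:R == 0 :> 'Z_e) = false.
  by move=> d12; rewrite natr_Ze_eq0 //; apply/negP => /dvdn_leq; lia.
have key (x y : T) k : (1 <= k <= n)%N -> (e %| k)%N -> k != n ->
    (forall r, (1 <= r <= n)%N -> (e %| r)%N -> ~~ descent x r) ->
    path_res k1 (step x) k.+1 = path_res k1 (step y) k.+1 ->
    arm_res k1 (step x) k = arm_res k1 (step y) k ->
    step x k = false -> step y k = true -> False.
  move=> k1n z kn ndx Rk1 Ak xk yk.
  have xk1 : step x k.+1 = false.
    by have := ndx k k1n z; rewrite /descent xk /=; case: (step x k.+1).
  have kZ : k%:R = 0 :> 'Z_e by apply/eqP; rewrite natr_Ze_eq0.
  move: Rk1; rewrite /path_res /= xk xk1 yk Ak -natr1 kZ /= => /eqP.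
  rewrite -subr_eq0; case: (step y k.+1).
    by rewrite (_ : _ - _ = 2%:R) ?N //; ring.
  by rewrite (_ : _ - _ = 1%:R) ?N //; ring.
have H k : (k <= n)%N -> arm_res k1 (step s) k = arm_res k1 (step t) k /\ step s k = step t k.
  elim: k => [|k IH] le; first by [].
  have [Ak sk] := IH (ltnW le).
  have Ak1 : arm_res k1 (step s) k.+1 = arm_res k1 (step t) k.+1 by rewrite /= Ak sk.
  split=> //; have [z|nz] := boolP (e %| k.+1)%N.
    have [->//|kn] := eqVneq k.+1 n; have k2 : (1 <= k.+2 <= n)%N by lia.
    case s1 : (step s k.+1); case t1 : (step t k.+1) => //; exfalso.
      exact: (key t s k.+1 _ z kn ndt (esym (res_eq _ k2)) (esym Ak1)).
    exact: (key s t k.+1 _ z kn nds (res_eq _ k2) Ak1).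
  have := res_eq k.+1; rewrite /path_res Ak1 => /(_ ltac:(lia))/addrI/oppr_inj.
  have kZ : k.+1%:R != 0 :> 'Z_e by rewrite natr_Ze_eq0.
  by case: (step s k.+1); case: (step t k.+1) => // /eqP; rewrite ?(eq_sym 0) (negPf kZ).
by apply: step_inj => k /andP[_ le]; case: (H k le).
Qed.

(** After [kill_blocks] no path of the support has a descent at a multiple of [e]. By [weight_inj]
    an idempotent then cuts out one path, from which [reach_ends_in] leads to [t]. *)
Lemma reach_vector b m u t : u != 0 -> supported (ends_in b m) u -> ends_in b m t ->
  exists a : A, rep a *m u = basis t.
Proof.
move=> u0 su et.
have [|a [v0 sv yv]] := @kill_blocks b m u (filter (dvdn e) (iota 1 n)) u0 su.
  by move=> r; rewrite mem_filter mem_iota add1n ltnS => /andP[-> ->].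
set v := rep a *m u in v0 sv yv.
have nd s r : coord v s != 0 -> (1 <= r <= n)%N -> (e %| r)%N -> ~~ descent s r.
  move=> vs r1n z; apply: (y_mx_kernel r1n z _ vs); apply: yv.
  by rewrite mem_filter z mem_iota add1n ltnS.
have [s vs] := neq0_coord v0.
have Es : e_mx (weight k1 s) *m v = coord v s *: basis s.
  apply: coord_inj => s'; rewrite coordZ coord_basis coord_mulmx (bigD1 s') //= big1.
    rewrite addr0 e_mxE coordZ coord_basis eqxx mulr1.
    have [->|ne] := eqVneq s s'; first by rewrite eqxx.
    have [->|vs'] := eqVneq (coord v s') 0; first by rewrite mul0r mulr0.
    case: eqP => [ew|_]; last by rewrite !mulr0.
    case/eqP: ne; apply: weight_inj => [r|r||]; try exact: nd.
      by have /and3P[_ -> _] := sv _ vs; have /and3P[_ -> _] := sv _ vs'.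
    by rewrite ew.
  by move=> x ne; rewrite e_mxE coordZ coord_basis (negPf ne) !mulr0.
have [c Hc] := reach_ends_in (sv _ vs) et.
exists (gen_sc R (coord v s)^-1 * c * gen_e R (weight k1 s) * a).
rewrite !repM rep_sc rep_idem -!mulmxE -!mulmxA -/v Es.
by rewrite -scalemxAr Hc mul_scalar_mx scalerA mulVf // scale1r.
Qed.

End Reach.

(** * The Specht modules of hook bipartitions *)

Section CyclicModule.
Variables (A : pzRingType) (S : A -> Prop).
Local Notation K := (submod_gen (S : A^o -> Prop)).
Local Notation gen := (Defs.mpi K (1 : A^o)).

Lemma mpi_gen (a : A) : Defs.mpi K (a : A^o) = a *: gen.
Proof. by rewrite -[RHS]mpiZ -[a *: _]/(a * 1) mulr1. Qed.

Lemma cyclic_surj (x : mod_quot K) : exists a : A, x = a *: gen.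
Proof. by exists (repr (x : Quotient.quot _)); rewrite -mpi_gen mpi_surj. Qed.

Lemma cyclic_relation (a : A) : S a -> a *: gen = 0.
Proof.
move=> Sa; rewrite -mpi_gen -[RHS](raddf0 (Defs.mpi K)).
apply/mpiP; apply/asboolP; rewrite subr0 -[a]add0r -{1}[a]mul1r.
by apply: submod_spanD Sa; constructor.
Qed.

Variables (F : fieldType) (N : nat) (rep : A -> 'M[F]_N.+1) (v : 'cV[F]_N.+1).
Hypotheses (repD : {morph rep : a b / a + b}) (repM : {morph rep : a b / a * b}).
Hypothesis Sv : forall s, S s -> rep s *m v = 0.

(** Universal property of the cyclic module. The value at a vector uses a chosen coefficient of the
    generator; the choice does not matter because the relations kill [v]. *)
Lemma cyclic_map_ex : exists Phi : mod_quot K -> 'cV[F]_N.+1,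
  [/\ {morph Phi : x y / x + y}, forall a x, Phi (a *: x) = rep a *m Phi x
    & Phi gen = rep 1 *m v].
Proof.
have rep0 : rep 0 = 0 by apply: (addrI (rep 0)); rewrite -repD !addr0.
pose Phi x := rep (sval (cid (cyclic_surj x))) *m v.
have PhiE a : Phi (a *: gen) = rep a *m v.
  rewrite /Phi; case: cid => b /=; rewrite -!mpi_gen => /mpiP/asboolP ab.
  apply/esym/subr0_eq; have -> : rep a *m v - rep b *m v = rep (a - b) *m v.
    by rewrite -mulmxBl; congr (_ *m _); apply/eqP; rewrite subr_eq -repD subrK.
  elim: ab => [|x c s _ IH Ss]; first by rewrite rep0 mul0mx.
  by rewrite repD mulmxDl IH add0r repM -mulmxE -mulmxA Sv // mulmx0.
exists Phi; split.
- move=> x y; have [a ->] := cyclic_surj x; have [b ->] := cyclic_surj y.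
  by rewrite -scalerDl !PhiE repD mulmxDl.
- move=> a x; have [b ->] := cyclic_surj x.
  by rewrite scalerA !PhiE repM -mulmxE mulmxA.
by rewrite -[gen]scale1r PhiE.
Qed.

End CyclicModule.

Section Words.
Variables (F : fieldType) (e n : nat) (k1 : 'Z_e) (A : pzRingType).
Variable R : klr_rep F n k1 A.
Local Notation psi := (gen_psi R).
Local Notation basis := (@basis n F).

Definition psi_down a j : A := \prod_(r <- rev (index_iota j a)) psi r.

(** The product in v(a_1, ..., a_m), with factors numbered from [j], so that the tail of the list
    again gives such a product. *)
Fixpoint psi_word (j : nat) (s : seq nat) : A :=
  if s is a :: s' then psi_down a j * psi_word j.+1 s' else 1.

Lemma psi_down_commute r a j : (a < r)%N -> psi r * psi_down a j = psi_down a j * psi r.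
Proof.
move=> ltar; rewrite /psi_down big_seq_cond.
elim/big_ind: (\prod_(i <- _ | _) _) => [|u v Hu Hv|i].
- by rewrite mulr1 mul1r.
- by rewrite mulrA Hu -mulrA Hv mulrA.
rewrite andbT mem_rev mem_index_iota => /andP[_ ltia]; apply: gen_psi_far.
by rewrite (leq_ltn_trans ltia ltar) orbT.
Qed.

Lemma psi_downS a j : (j <= a)%N -> psi_down a.+1 j = psi a * psi_down a j.
Proof.
move=> le; rewrite /psi_down /index_iota subSn // -addn1 iotaD subnKC // rev_cat.
by rewrite /= big_cons.
Qed.

Lemma psi_down0 j : psi_down j j = 1.
Proof. by rewrite /psi_down /index_iota subnn big_nil. Qed.

(** The factors of [p] involve only psi_i with [i + 1 < r], so psi_r passes them and extends the
    next factor. *)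
Lemma psi_word_succ p q r j : (forall a, a \in p -> (a < r)%N) -> (j + size p <= r)%N ->
  psi r * psi_word j (p ++ r :: q) = psi_word j (p ++ r.+1 :: q).
Proof.
elim: p j => [|a p IH] j /= ltp lej; first by rewrite psi_downS ?mulrA //; lia.
rewrite mulrA psi_down_commute ?mem_head; last by apply: ltp; rewrite mem_head.
rewrite -mulrA IH // => [b bp|]; last by rewrite addSnnS.
by apply: ltp; rewrite inE bp orbT.
Qed.

Lemma psi_word_iota j k : psi_word j (iota j k) = 1.
Proof. by elim: k j => //= k IH j; rewrite psi_down0 mul1r IH. Qed.

Lemma psi_word_swap r (t : n.-tuple bool) : (1 <= r < n)%N -> ascent t r ->
  psi r * psi_word 1 (legs t) = psi_word 1 (legs (swap r t)).
Proof.
move=> r1n asc; have [p [q [-> -> ltp szp]]] := legs_split r1n asc.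
by apply: psi_word_succ => //; lia.
Qed.

Lemma psi_word_prod s j : \prod_(j <= i < j + size s) psi_down (nth 0%N s (i - j)) i =
  psi_word j s.
Proof.
elim: s j => [|a s IH] j; first by rewrite addn0 big_geq.
rewrite big_ltn /=; last by rewrite -[X in (X < _)%N]addn0 ltn_add2l.
rewrite subnn; congr (_ * _); rewrite -IH -addSnnS.
by apply: eq_big_nat => i /andP[lti _]; rewrite -(subnSK lti).
Qed.

Lemma rep_psi_word m t : (m <= n)%N -> size (legs t) = m ->
  rep R (psi_word 1 (legs t)) *m basis (low_path n m) = basis t.
Proof.
move=> lemn; move: t; apply: (path_ind lemn).
  by rewrite legs_low // psi_word_iota rep1 mul1mx.
move=> r t r1n asc szt IH; rewrite -psi_word_swap // repM -mulmxE -mulmxA IH rep_psi.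
exact: psi_mx_ascent.
Qed.

End Words.

Lemma far_apart r s : r != s -> r != s.+1 -> s != r.+1 -> (r.+1 < s)%N || (s.+1 < r)%N.
Proof. by lia. Qed.

(** * Straightening in the Specht module *)

Section HookModel.
Variables (F : fieldType) (e n : nat) (k1 : 'Z_e) (A : pzRingType).
Hypothesis e3 : (3 <= e)%N.
Variable R : klr_rep F n k1 A.
Local Notation psi := (gen_psi R).
Local Notation y := (gen_y R).
Local Notation idem := (gen_e R).
Local Notation sc := (gen_sc R).
Local Notation rep := (rep R).
Local Notation basis := (@basis n F).
Local Notation coord := (@coord n F).
Local Notation T := (n.-tuple bool).
Local Notation V := 'cV[F]_((dimV n).+1).
Implicit Types t s : T.

Lemma sc0 : sc 0 = 0.
Proof. by apply: (addrI (sc 0)); rewrite -gen_scD !addr0. Qed.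

Lemma scN c : sc (- c) = - sc c.
Proof. by apply/eqP; rewrite -addr_eq0 -gen_scD addNr sc0. Qed.

Lemma sc_int (c : int) : sc c%:~R = c%:~R.
Proof.
have H k : sc k%:R = k%:R by elim: k => [|k IH]; rewrite ?sc0 // -!natr1 gen_scD IH gen_sc1.
by case: c => k; rewrite ?NegzE ?mulrNz ?scN -!pmulrn H.
Qed.

Variables (M : lmodType A) (m : nat) (z : M).
Hypothesis lemn : (m <= n)%N.
Hypothesis z_gen : forall x, exists a, x = a *: z.
Hypothesis z_idem : idem (weight k1 (low_path n m)) *: z = z.
Hypothesis z_y : forall r, (1 <= r <= n)%N -> y r *: z = 0.
Hypothesis z_psi : forall r, (1 <= r < n)%N -> r != m -> psi r *: z = 0.

Definition specht t : M := locked (psi_word R 1 (legs t) *: z).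

Lemma specht_low : specht (low_path n m) = z.
Proof. by rewrite /specht -lock legs_low // psi_word_iota scale1r. Qed.

Lemma specht_ascent r t : (1 <= r < n)%N -> ascent t r ->
  psi r *: specht t = specht (swap r t).
Proof. by move=> r1n asc; rewrite /specht -!lock scalerA psi_word_swap. Qed.

Lemma specht_descent r t : (1 <= r < n)%N -> descent t r ->
  specht t = psi r *: specht (swap r t).
Proof.
by move=> r1n d; rewrite specht_ascent ?swapK //; exact: swap_descent.
Qed.

Lemma specht_idem t : size (legs t) = m -> idem (weight k1 t) *: specht t = specht t.
Proof.
move: t; apply: (path_ind lemn); first by rewrite specht_low.
move=> r t r1n asc szt IH; rewrite weight_swap // -specht_ascent // scalerA.
by rewrite -gen_psi_e // -scalerA IH.
Qed.

(* The length of a standard basis vector is measured by the sum of its legs; psi_r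
   raises it by at most 1 and y_r strictly lowers it. *)
Inductive filtration (k : nat) : M -> Prop :=
| filtration0 : filtration k 0
| filtrationD x c t : filtration k x -> size (legs t) = m -> (sumn (legs t) < k)%N ->
    filtration k (x + sc c *: specht t).

Lemma filtration_add k x x' : filtration k x -> filtration k x' -> filtration k (x + x').
Proof.
move=> kx; elim=> [|w c t _ IH szt lt]; first by rewrite addr0.
by rewrite addrA; apply: filtrationD.
Qed.

Lemma filtration_sc k c x : filtration k x -> filtration k (sc c *: x).
Proof.
elim=> [|w d t _ IH szt lt]; first by rewrite scaler0; constructor.
by rewrite scalerDr scalerA -gen_scM; apply: filtrationD.
Qed.

Lemma filtration_int k (c : int) x : filtration k x -> filtration k (c%:~R *: x).
Proof. by rewrite -sc_int; exact: filtration_sc. Qed.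

Lemma filtration_nat k (c : nat) x : filtration k x -> filtration k (c%:R *: x).
Proof. by have := @filtration_int k c x; rewrite -pmulrn. Qed.

Lemma filtration_opp k x : filtration k x -> filtration k (- x).
Proof. by rewrite -scaleN1r; exact: (@filtration_int k (-1)). Qed.

Lemma filtrationW k l x : (k <= l)%N -> filtration k x -> filtration l x.
Proof.
move=> kl; elim=> [|w c t _ IH szt lt]; first by constructor.
by apply: filtrationD => //; apply: leq_trans kl.
Qed.

Lemma filtration_specht k t : size (legs t) = m -> (sumn (legs t) < k)%N ->
  filtration k (specht t).
Proof.
move=> szt lt; rewrite -[specht t]add0r -[specht t]scale1r -(gen_sc1 R).
by apply: filtrationD => //; constructor.
Qed.

Lemma filtration_lin (a : A) k l :
  (forall t, size (legs t) = m -> (sumn (legs t) < k)%N -> filtration l (a *: specht t)) ->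
  forall x, filtration k x -> filtration l (a *: x).
Proof.
move=> H x; elim=> [|w c t _ IH szt lt]; first by rewrite scaler0; constructor.
rewrite scalerDr; apply: filtration_add => //.
by rewrite scalerA -gen_sc_central -scalerA; apply/filtration_sc/H.
Qed.

Definition level t r := step t r == step t r.+1.

Definition filtered_at l := forall t, size (legs t) = m -> sumn (legs t) = l ->
  [/\ forall r, (1 <= r < n)%N -> filtration l.+2 (psi r *: specht t),
      forall r, (1 <= r <= n)%N -> filtration l (y r *: specht t)
    & forall r, (1 <= r < n)%N -> level t r -> filtration l (psi r *: specht t)].

(** Unless [t] is [low_path], [specht t] is psi_s applied to a shorter standard vector, and the
    generator is moved past psi_s with shorter error terms. The bound for psi_r at two equal steps
    is part of the induction because the braid relation leads back to it. *)
Lemma specht_filtered l : filtered_at l.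
Proof.
have [k] := ubnP l; elim: k l => // k IHk l ltlk t szt suml.
have {IHk} IH l' : (l' < l)%N -> filtered_at l' by move=> lt; apply: IHk; lia.
have Wpsi r k' x : (1 <= r < n)%N -> (k' <= l)%N -> filtration k' x ->
    filtration k'.+1 (psi r *: x).
  move=> r1n lek; apply: filtration_lin => s szs lts.
  have [|H _ _] := IH (sumn (legs s)) _ s szs erefl; first by lia.
  by apply: filtrationW (H r r1n).
have Dn r : (1 <= r < n)%N -> descent t r -> exists t', [/\ t' = swap r t,
    specht t = psi r *: specht t', size (legs t') = m, l = (sumn (legs t')).+1 &
    filtration l (specht t')].
  move=> r1n d; exists (swap r t); have E : l = (sumn (legs (swap r t))).+1.
    by rewrite -suml; apply: sumn_legs_descent.
  have szt' : size (legs (swap r t)) = m by rewrite size_legs_swap_descent.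
  split=> //; first exact: specht_descent.
  by apply: filtration_specht => //; lia.
have Fy r : (1 <= r <= n)%N -> filtration l (y r *: specht t).
  move=> r1n; have [->|[s s1n d]] := low_or_descent lemn szt.
    by rewrite specht_low z_y //; constructor.
  have [t' [_ -> szt' El Ft']] := Dn s s1n d.
  have Fy' p : (1 <= p <= n)%N -> filtration l (psi s *: (y p *: specht t')).
    move=> p1n; have [_ H _] := IH (sumn (legs t')) ltac:(lia) t' szt' erefl.
    by rewrite {1}El; apply: (Wpsi _) => //; [lia|apply: H].
  have [->|nrs] := eqVneq r s.
    (* Inserting the idempotent of [t'] makes the relation applicable, as it holds only after
       multiplication by e(i). *)
    rewrite -(specht_idem szt') !scalerA.
    have s1n' : (1 <= s.+1 <= n)%N by lia.
    have -> : y s * psi s * idem (weight k1 t') = psi s * y s.+1 * idem (weight k1 t')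
        - (residue (weight k1 t') s == residue (weight k1 t') s.+1)%:R * idem (weight k1 t').
      by rewrite gen_psi_y // mulrDl addrK.
    rewrite scalerBl -!scalerA specht_idem //; apply: filtration_add; first exact: Fy'.
    exact/filtration_opp/filtration_nat.
  have [->|nrs1] := eqVneq r s.+1.
    rewrite -(specht_idem szt') !scalerA gen_y_psi // mulrDl scalerDl -!scalerA.
    rewrite specht_idem //; apply: filtration_add; last exact: filtration_nat.
    by apply: Fy'; lia.
  by rewrite scalerA -gen_psi_y_far // -scalerA; exact: Fy'.
have Flevel r : (1 <= r < n)%N -> level t r -> filtration l (psi r *: specht t).
  move=> r1n lv; have [Et|[s s1n d]] := low_or_descent lemn szt.
    rewrite Et specht_low z_psi //; first by constructor.
    by apply/eqP => rm; move: lv; rewrite /level Et !step_low // rm leqnn ltnn.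
  have [t' [Et' -> szt' El Ft']] := Dn s s1n d.
  have St' p : step t' p = step t (transpose s p) by rewrite Et' step_swap.
  move: (d) (lv); rewrite /descent /level => /andP[/negPf ts ts1] /eqP trr1.
  have nrs : r != s by apply/eqP => E; move: trr1; rewrite E ts ts1.
  have [Ers|nrs1] := eqVneq r s.+1.
    (* legs at s + 1 and s + 2, arm at s *)
    have /andP[s0 _] := s1n; have lts : (s.+1 < n)%N by case/andP: r1n; rewrite Ers.
    have s1n' : (1 <= s.+1 < n)%N by rewrite lts.
    have ts2 : step t s.+2 = true by rewrite Ers ts1 in trr1.
    have T2 : transpose s s.+2 = s.+2 by apply: transpose_out; rewrite gtn_eqF.
    have T0 : transpose s.+1 s = s by apply: transpose_out; rewrite ltn_eqF.
    have d' : descent t' s.+1 by rewrite /descent !St' transpose_r T2 ts ts2.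
    have szt'' : size (legs (swap s.+1 t')) = m by rewrite size_legs_swap_descent.
    have E2 := sumn_legs_descent s1n' d'.
    set t'' := swap s.+1 t' in szt'' E2.
    have lv'' : level t'' s.
      by rewrite /level !step_swap // T0 transpose_l !St' transpose_l T2 ts1 ts2.
    rewrite (specht_descent s1n' d') -/t'' Ers !scalerA -(specht_idem szt'') scalerA.
    have [c Hc] := gen_braid R (weight k1 t'') s0 lts.
    have -> : psi s.+1 * psi s * psi s.+1 * idem (weight k1 t'') =
       (psi s * psi s.+1 * psi s) * idem (weight k1 t'') - c%:~R * idem (weight k1 t'').
      by rewrite Hc mulrDl addrK.
    rewrite scalerBl -!scalerA specht_idem //.
    have El2 : l = (sumn (legs t'')).+2 by rewrite El E2.
    apply: filtration_add; last first.
      by apply/filtration_opp/filtration_int/filtration_specht; rewrite ?El2.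
    have lt'' : (sumn (legs t'') < l)%N by rewrite El2.
    have [_ _ H] := IH _ lt'' t'' szt'' erefl.
    (* psi_s applied to [specht t''] involves only sums of legs below [l - 2], since [t''] has equal
       steps at [s]; the two remaining psi add at most 1 each. *)
    rewrite {1}El2; apply: (Wpsi _ _ _ s1n); first by rewrite El2.
    by apply: (Wpsi _ _ _ s1n' (ltnW lt'')); apply: H.
  have [Esr|nsr1] := eqVneq s r.+1.
    (* arms at r and r + 1, leg at r + 2 *)
    have /andP[r0 _] := r1n; have ltr : (r.+1 < n)%N by case/andP: s1n; rewrite Esr.
    have r1n' : (1 <= r.+1 < n)%N by rewrite ltr.
    have tr : step t r = false by rewrite trr1 -Esr.
    have T0 : transpose s r = r by apply: transpose_out; rewrite Esr ltn_eqF.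
    have T2 : transpose r r.+2 = r.+2 by apply: transpose_out; rewrite gtn_eqF.
    have d' : descent t' r by rewrite /descent -[r.+1]Esr !St' T0 transpose_l tr ts1.
    have szt'' : size (legs (swap r t')) = m by rewrite size_legs_swap_descent.
    have E2 := sumn_legs_descent r1n d'.
    set t'' := swap r t' in szt'' E2.
    have lv'' : level t'' r.+1.
      by rewrite /level !step_swap // transpose_r T2 -[r.+2]/(r.+1.+1) -Esr !St' T0
        transpose_r tr ts.
    rewrite (specht_descent r1n d') -/t'' Esr !scalerA -(specht_idem szt'') scalerA.
    have [c Hc] := gen_braid R (weight k1 t'') r0 ltr.
    rewrite Hc mulrDl scalerDl -!scalerA specht_idem //.
    have El2 : l = (sumn (legs t'')).+2 by rewrite El E2.
    apply: filtration_add; last first.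
      by apply/filtration_int/filtration_specht; rewrite ?El2.
    have lt'' : (sumn (legs t'') < l)%N by rewrite El2.
    have [_ _ H] := IH _ lt'' t'' szt'' erefl.
    rewrite {1}El2; apply: (Wpsi _ _ _ r1n'); first by rewrite El2.
    by apply: (Wpsi _ _ _ r1n (ltnW lt'')); apply: H.
  have lv' : level t' r.
    have N1 : r.+1 != s by rewrite eq_sym.
    by rewrite /level !St' (@transpose_out s r) // (@transpose_out s r.+1) // trr1.
  have lt' : (sumn (legs t') < l)%N by rewrite El.
  have [_ _ H] := IH _ lt' t' szt' erefl.
  rewrite scalerA gen_psi_far; last exact: far_apart.
  by rewrite -scalerA {1}El; apply: (Wpsi _ _ _ s1n (ltnW lt')); apply: H.
split=> // r r1n.
have [lv|] := boolP (level t r); first by apply: filtrationW (Flevel r r1n lv); lia.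
rewrite /level => nlv; have [d|nd] := boolP (descent t r); last first.
  have a : ascent t r.
    by move: nlv nd; rewrite /ascent /descent; case: (step t r); case: (step t r.+1).
  rewrite specht_ascent //; apply: filtration_specht; first by rewrite size_legs_swap.
  by rewrite sumn_legs_swap // suml.
have [t' [_ -> szt' El Ft']] := Dn r r1n d.
(* At a descent psi_r acts as psi_r^2 on the shorter vector, and the quadratic relation leaves only
   y_r, y_(r+1) and scalars. *)
rewrite scalerA -expr2 -(specht_idem szt') scalerA.
have [c [c' ->]] := gen_psi2 R (weight k1 t') r1n.
rewrite -scalerA specht_idem // scalerDl -scalerA scalerBl.
have [_ H _] := IH (sumn (legs t')) ltac:(lia) t' szt' erefl.
apply: (@filtrationW l); first by lia.
apply: filtration_add; last exact: filtration_int.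
apply/filtration_int/filtration_add; last apply/filtration_opp.
  by apply: filtrationW (H r _); lia.
by apply: filtrationW (H r.+1 _); lia.
Qed.

Lemma filtration_exhaustive x : exists k, filtration k x.
Proof.
have [a ->] := z_gen x.
have Fz : exists k, filtration k z.
  exists (sumn (iota 1 m)).+1; rewrite -specht_low; apply: filtration_specht.
    by rewrite legs_low // size_iota.
  by rewrite legs_low.
elim/(@gen_ind _ _ _ _ _ R): a z Fz => [a b Pa Pb|a b Pa Pb|c|i|r r1n|r r1n] w [k Fw].
- have [k' Fk'] := Pa w (ex_intro _ k Fw); have [l Fl] := Pb w (ex_intro _ k Fw).
  exists (maxn k' l); rewrite scalerDl; apply: filtration_add.
    by apply: filtrationW Fk'; exact: leq_maxl.
  by apply: filtrationW Fl; exact: leq_maxr.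
- by rewrite -scalerA; apply/Pa/Pb; exists k.
- by exists k; apply: filtration_sc.
- exists k; apply: filtration_lin Fw => t szt lt.
  rewrite -(specht_idem szt) scalerA gen_e_idem -scalerA; apply: filtration_nat.
  have [->|ne] := eqVneq i (weight k1 t); first by rewrite specht_idem //; exact: filtration_specht.
  rewrite -(specht_idem szt) scalerA gen_e_idem (negPf ne) mul0r scale0r.
  exact: filtration0.
- exists k; apply: filtration_lin Fw => t szt lt.
  have [_ H _] := specht_filtered szt erefl.
  exact: filtrationW (ltnW lt) (H r r1n).
exists k.+1; apply: filtration_lin Fw => t szt lt.
have [H _ _] := specht_filtered szt erefl.
by apply: filtrationW (H r r1n).
Qed.

Variable Phi : M -> V.
Hypothesis PhiD : {morph Phi : x y / x + y}.
Hypothesis PhiZ : forall a x, Phi (a *: x) = rep a *m Phi x.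
Hypothesis Phiz : Phi z = basis (low_path n m).

Lemma Phi_specht t : size (legs t) = m -> Phi (specht t) = basis t.
Proof.
move: t; apply: (path_ind lemn); first by rewrite specht_low.
move=> r t r1n asc szt IH; rewrite -specht_ascent // PhiZ IH rep_psi.
exact: psi_mx_ascent.
Qed.

(** The filtration provides some expansion in standard vectors, and [Phi_specht] reads off its
    coefficients. Hence [Phi] is injective. *)
Lemma specht_expansion x :
  @supported F n (fun t => size (legs t) == m) (Phi x) /\
  x = \sum_(t | size (legs t) == m) sc (coord (Phi x) t) *: specht t.
Proof.
have Phi0 : Phi 0 = 0 by apply: (addrI (Phi 0)); rewrite -PhiD !addr0.
have [k] := filtration_exhaustive x; elim=> [|w c t _ [IHs IH] szt _].
  rewrite Phi0; split; first exact: supported0.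
  by rewrite big1 // => t _; rewrite coord0 sc0 scale0r.
have E : Phi (w + sc c *: specht t) = Phi w + c *: basis t.
  by rewrite PhiD PhiZ rep_sc mul_scalar_mx Phi_specht.
rewrite E; split.
  by apply/supportedD/supportedZ/supported_basis => //; exact/eqP.
rewrite {1}IH [in RHS](eq_bigr (fun s => sc (coord (Phi w) s) *: specht s +
   sc (c * (t == s)%:R) *: specht s)); last first.
  by move=> s _; rewrite coordD coordZ coord_basis gen_scD scalerDl.
rewrite big_split /=; congr (_ + _); rewrite (bigD1 t) ?szt //= eqxx mulr1 big1 ?addr0 //.
by move=> s /andP[_ ne]; rewrite eq_sym (negPf ne) mulr0 sc0 scale0r.
Qed.

End HookModel.

(* Phi identifies M with the module spanned by the paths having m legs. *)
Record hook_model (F : fieldType) (e n : nat) (k1 : 'Z_e) (A : pzRingType)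
    (R : klr_rep F n k1 A) (M : lmodType A) (m : nat) (Phi : M -> 'cV[F]_((dimV n).+1)) := {
  modelD : {morph Phi : x y / x + y};
  modelZ : forall a x, Phi (a *: x) = rep R a *m Phi x;
  model_inj : injective Phi;
  model_supp : forall x, @supported F n (fun t => size (legs t) == m) (Phi x);
  model_surj : forall t, size (legs t) = m -> exists x, Phi x = basis F t
}.

Lemma hook_model_ex (F : fieldType) (e n : nat) (k1 : 'Z_e) (A : pzRingType)
    (R : klr_rep F n k1 A) (M : lmodType A) (m : nat) (z : M)
    (Phi : M -> 'cV[F]_((dimV n).+1)) :
  (3 <= e)%N -> (m <= n)%N -> (forall x, exists a, x = a *: z) ->
  gen_e R (weight k1 (low_path n m)) *: z = z ->
  (forall r, (1 <= r <= n)%N -> gen_y R r *: z = 0) ->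
  (forall r, (1 <= r < n)%N -> r != m -> gen_psi R r *: z = 0) ->
  {morph Phi : x y / x + y} -> (forall a x, Phi (a *: x) = rep R a *m Phi x) ->
  Phi z = basis F (low_path n m) -> hook_model R m Phi.
Proof.
move=> e3 lemn z_gen z_idem z_y z_psi PhiD PhiZ Phiz.
have H := specht_expansion e3 lemn z_gen z_idem z_y z_psi PhiD PhiZ Phiz.
split=> // [x x' eqx|x|t szt].
- by have [_ ->] := H x; have [_ ->] := H x'; rewrite eqx.
- by have [] := H x.
exists (specht R z t); exact: (Phi_specht lemn).
Qed.

Lemma supported_ind (F : fieldType) (n : nat) (P : 'cV[F]_((dimV n).+1) -> Prop)
    (Q : pred (n.-tuple bool)) u :
  P 0 -> (forall v w, P v -> P w -> P (v + w)) -> (forall c v, P v -> P (c *: v)) ->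
  (forall t, Q t -> P (basis F t)) -> supported Q u -> P u.
Proof.
move=> P0 PD PZ Pb Qu; rewrite -(sum_coord u); elim/big_ind: _ => // t _.
by have [->|ut] := eqVneq (coord u t) 0; [rewrite scale0r|apply/PZ/Pb/Qu].
Qed.

(** * Irreducibility of the image and of the subquotient *)

Section AddLast.
Variables (n : nat).
Hypothesis n1 : (1 <= n)%N.
Implicit Types t s : n.-tuple bool.

(** On a path ending with an arm, the effect of gamma_m. *)
Definition add_last t := path_of n (fun k => (k == n) || step t k).

Lemma step_add_last t k : step (add_last t) k = (k == n) || step t k.
Proof.
rewrite path_ofK //; have [t0 tn] := step_admissible t; split; first by rewrite t0 orbT.
by move=> l ltl; rewrite tn // gtn_eqF.
Qed.

Lemma legs_add_last t : ~~ step t n -> legs (add_last t) = rcons (legs t) n.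
Proof.
move=> tn; rewrite /legs (eq_filter (step_add_last t)).
have -> : iota 1 n = iota 1 n.-1 ++ [:: n].
  transitivity (iota 1 (n.-1 + 1)); first by congr iota; lia.
  by rewrite iotaD add1n prednK.
rewrite !filter_cat /= eqxx (negPf tn) cats0 cats1; congr rcons.
by apply: eq_in_filter => k; rewrite mem_iota => ?; rewrite ltn_eqF //; lia.
Qed.

Lemma add_last_inj t s : ~~ step t n -> ~~ step s n -> add_last t = add_last s -> t = s.
Proof.
move=> /negPf tn /negPf sn eqa; apply: step_inj => k _.
have := congr1 (fun x => step x k) eqa; rewrite !step_add_last.
by have [->|] := eqVneq k n; rewrite ?tn ?sn.
Qed.

End AddLast.

Section AbstractIrreducibility.
Variables (F : fieldType) (e n : nat) (k1 : 'Z_e) (A : pzRingType).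
Hypothesis (e3 : (3 <= e)%N) (n1 : (1 <= n)%N) (dv : (e %| n)%N).
Variable R : klr_rep F n k1 A.
Local Notation rep := (rep R).
Local Notation basis := (@basis n F).
Local Notation coord := (@coord n F).
Local Notation V := 'cV[F]_((dimV n).+1).
Local Notation supported := (@supported F n).
Implicit Types t s : n.-tuple bool.

Section Model.
Variables (M : lmodType A) (m : nat) (Phi : M -> V).
Hypothesis mod_Phi : hook_model R m Phi.

Lemma model0 : Phi 0 = 0.
Proof. by apply: (addrI (Phi 0)); rewrite -(modelD mod_Phi) !addr0. Qed.

Lemma modelN x : Phi (- x) = - Phi x.
Proof. by apply/eqP; rewrite -addr_eq0 -(modelD mod_Phi) addNr model0. Qed.

Lemma model_neq0 x : x != 0 -> Phi x != 0.
Proof.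
by apply: contraNneq => E; apply/eqP/(model_inj mod_Phi); rewrite E model0.
Qed.

Lemma supported_ends (b : bool) u : supported (fun t => size (legs t) == m) u ->
  supported (fun t => step t n) u -> supported (fun t => step t 1 == b) u ->
  supported (ends_in b m) u.
Proof.
by move=> s1 s2 s3 t ut; rewrite /ends_in (s1 t ut) (s2 t ut) (s3 t ut).
Qed.

Variables (N : lmodType A) (g : N) (f : {linear N -> M}) (tw : n.-tuple bool).
Hypothesis g_gen : forall x, exists a, x = a *: g.
Hypothesis fg : Phi (f g) = basis tw.
Hypothesis tw_ends : ends_in false m tw.

Lemma im_first_arm x : supported (ends_in false m) (Phi (f x)).
Proof.
have [a ->] := g_gen x; rewrite linearZ (modelZ mod_Phi) fg => t ut.
have /and3P[/eqP w1 wn _] := tw_ends.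
have sw : supported (first_arm_last_leg (n := n)) (basis tw).
  by apply: supported_basis; rewrite /first_arm_last_leg w1 wn.
have /andP[/negPf t1 tn] := rep_keeps_ends e3 n1 dv (a := a) sw ut.
rewrite /ends_in t1 tn.
by apply: (model_supp mod_Phi (x := a *: f g)); rewrite (modelZ mod_Phi) fg.
Qed.

(** The generator goes to the single path [tw], from which all paths with the same ends and as many
    legs are reached. *)
Lemma im_spanned x : supported (ends_in false m) (Phi x) -> exists x', f x' = x.
Proof.
move=> sx; suff [a Ha] : exists a, rep a *m basis tw = Phi x.
  by exists (a *: g); apply: (model_inj mod_Phi); rewrite linearZ (modelZ mod_Phi) fg.
apply: (supported_ind (P := fun u => exists a, rep a *m basis tw = u) _ _ _ _ sx)
  => [|u v [a <-] [b <-]|c u [a <-]|t et].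
- by exists (gen_sc R 0); rewrite rep_sc mul_scalar_mx scale0r.
- by exists (a + b); rewrite repD mulmxDl.
- by exists (gen_sc R c * a); rewrite repM rep_sc -mulmxE -mulmxA mul_scalar_mx.
exact: (reach_ends_in e3 n1 dv R tw_ends et).
Qed.

(** Any nonzero vector of the image can be carried to [tw], that is to [f g], which generates the
    image. *)
Lemma im_irreducible : irreducible_module (submod (lin_im f)).
Proof.
have imP x : x \in lin_im f <-> exists x', f x' = x.
  by split => [/asboolP|H]; [|apply/asboolP].
have fg_im : f g \in lin_im f by apply/imP; exists g.
pose w : submod (lin_im f) := Sub (f g) fg_im.
have valw : val w = f g by exact: SubK.
have fg0 : f g != 0.
  apply/eqP => E; have := coord_basis F tw tw; rewrite -fg E model0 coord0 eqxx => /eqP.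
  by rewrite eq_sym oner_eq0.
split; first by exists w; apply/eqP => /(congr1 val); rewrite linear0 valw; apply/eqP.
move=> U; have [[x [xU x0]]|H] := EM (exists x, x \in U /\ x != 0); last first.
  by left=> x xU; apply/eqP/negPn/negP => x0; case: H; exists x.
right=> x'; have [c Hc] : exists c, val x = f c by have /imP[c <-] := valP x; exists c.
have vx0 : val x != 0.
  by apply: contraNneq x0 => E; apply/eqP/val_inj; rewrite E linear0.
have [a Ha] : exists a, rep a *m Phi (val x) = basis tw.
  apply: (reach_vector e3 n1 dv R (model_neq0 vx0) _ tw_ends).
  by rewrite Hc; exact: im_first_arm.
have wU : w \in U.
  have E : f g = val (a *: x).
    by rewrite linearZ; apply: (model_inj mod_Phi); rewrite fg (modelZ mod_Phi) Ha.
  have -> : w = a *: x by apply: val_inj; exact: etrans valw E.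
  exact: rpredZ.
have [c' Hc'] : exists c', val x' = f c' by have /imP[c' <-] := valP x'; exists c'.
have [b Hb] := g_gen c'.
have E : val (b *: w) = val x'.
  by rewrite linearZ Hc' Hb linearZ; congr (_ *: _); exact: valw.
have -> : x' = b *: w by apply: val_inj; exact: esym E.
exact: rpredZ.
Qed.

End Model.

(** psi_r is nonzero on two legs at [r], [r + 1] only if [e] divides [r - 1], which is [n - 2] here.
    This matches the vanishing of gamma_m once a swap has put a leg at [n]. *)
Lemma psi_mx_two_last_legs r s : r.+1 = n -> step s r -> step s n ->
  psi_mx F e n r *m basis s = 0.
Proof.
case: r => [|b] rn sr sn; first by rewrite /psi_mx mul0mx.
rewrite psi_mx_word4 rn // sr sn step_last_succ.
have /negPf -> : ~~ (e %| b)%N.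
  apply/negP => z; have : (e %| n - b)%N by rewrite dvdn_sub.
  by rewrite -rn -addn2 addKn => /dvdn_leq; lia.
by rewrite dv.
Qed.

Section Kernel.
Variables (m : nat) (M M' : lmodType A) (Phi : M -> V) (Phi' : M' -> V).
Hypothesis ltmn : (m < n)%N.
Hypotheses (mod_Phi : hook_model R m Phi) (mod_Phi' : hook_model R m.+1 Phi').
Variables (z : M) (gamma : {linear M -> M'}).
Hypothesis Phiz : Phi z = basis (low_path n m).
Hypothesis gammaz : Phi' (gamma z) = basis (add_last (low_path n m)).

(** gamma commutes with psi_r. Swaps with [r + 1 < n] commute with [add_last], and a swap at [n - 1]
    makes both sides vanish. *)
Lemma gamma_basis t : size (legs t) = m -> forall x, Phi x = basis t ->
  Phi' (gamma x) = if step t n then 0 else basis (add_last t).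
Proof.
move: t; apply: (path_ind (ltnW ltmn)) => [x|r t r1n asc szt IH x Hx].
  rewrite -Phiz => /(model_inj mod_Phi)->.
  by rewrite gammaz step_low ?(ltnW ltmn) // leqNgt ltmn.
have [x0 Hx0] := model_surj mod_Phi szt.
have -> : x = gen_psi R r *: x0.
  apply: (model_inj mod_Phi).
  by rewrite Hx (modelZ mod_Phi) Hx0 rep_psi psi_mx_ascent.
rewrite linearZ (modelZ mod_Phi') (IH _ Hx0) rep_psi step_swap //.
have /andP[tr tr1] := asc.
have [En|rn] := eqVneq r.+1 n.
  have Tn : transpose r n = r by rewrite -[X in transpose r X]En transpose_r.
  have tn : step t n = false by apply/negbTE; rewrite En in tr1.
  rewrite Tn tr tn.
  by apply: psi_mx_two_last_legs; rewrite ?step_add_last // ?tr ?orbT ?eqxx.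
rewrite transpose_out ?(eq_sym n) //; last by rewrite ltn_eqF //; case/andP: r1n.
case tn : (step t n); first by rewrite mulmx0.
have rn' : r != n by rewrite ltn_eqF //; case/andP: r1n.
rewrite psi_mx_ascent // /ascent ?step_add_last // ?(negPf rn) ?(negPf rn') //.
congr basis; apply: step_inj => k _; rewrite step_swap // !step_add_last // step_swap //.
congr (_ || _); rewrite /transpose; case: (eqVneq k r) => [->|_].
  by rewrite (negPf rn) (negPf rn').
by case: (eqVneq k r.+1) => [->|//]; rewrite (negPf rn) (negPf rn').
Qed.

Let L := mx_of (fun t => if step t n then 0 else basis (add_last t)).

Lemma gamma_mx x : Phi' (gamma x) = L *m Phi x.
Proof.
suff [x' Hx' Ex] : exists2 x', Phi x' = Phi x & Phi' (gamma x') = L *m Phi x'.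
  by rewrite -Hx' -Ex (model_inj mod_Phi Hx').
apply: (supported_ind (P := fun u => exists2 x', Phi x' = u & Phi' (gamma x') = L *m Phi x')
   _ _ _ _ (@model_supp _ _ _ _ _ _ _ _ _ mod_Phi x)).
- by exists 0; rewrite ?linear0 ?(model0 mod_Phi) // (model0 mod_Phi') mulmx0.
- move=> u v [x1 <- H1] [x2 <- H2]; exists (x1 + x2); rewrite ?(modelD mod_Phi) //.
  by rewrite linearD (modelD mod_Phi') H1 H2 mulmxDr.
- move=> c u [x1 <- H1]; exists (gen_sc R c *: x1).
    by rewrite (modelZ mod_Phi) rep_sc mul_scalar_mx.
  rewrite linearZ (modelZ mod_Phi) (modelZ mod_Phi') H1 rep_sc !mul_scalar_mx.
  by rewrite -scalemxAr.
move=> t /eqP szt; have [x0 Hx0] := model_surj mod_Phi szt; exists x0 => //.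
by rewrite (gamma_basis szt Hx0) Hx0 mx_ofE.
Qed.

(** [add_last] is injective on paths ending with an arm, so their images cannot cancel. *)
Lemma kernel_last_leg x : gamma x = 0 <-> supported (fun t => step t n) (Phi x).
Proof.
split=> [E t ut|sx]; last first.
  apply: (model_inj mod_Phi'); rewrite (model0 mod_Phi') gamma_mx.
  apply: (supported_ind (P := fun u => L *m u = 0) _ _ _ _ sx).
  - by rewrite mulmx0.
  - by move=> u v Hu Hv; rewrite mulmxDr Hu Hv addr0.
  - by move=> c u Hu; rewrite -scalemxAr Hu scaler0.
  by move=> t tn; rewrite mx_ofE tn.
apply/negPn/negP => tn; move: (gamma_mx x); rewrite E (model0 mod_Phi') => /esym.
move/(congr1 (coord ^~ (add_last t))); rewrite coord0 coord_mulmx (bigD1 t) //= big1.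
  rewrite addr0 mx_ofE (negPf tn) coord_basis eqxx mulr1 => /eqP.
  by rewrite (negPf ut).
move=> s ne; rewrite mx_ofE; case sn : (step s n); first by rewrite coord0 mulr0.
rewrite coord_basis; case: eqP => [Es|_]; last by rewrite mulr0.
by case/eqP: ne; apply: add_last_inj Es; rewrite ?sn.
Qed.

Variables (N : lmodType A) (g : N) (f : {linear N -> M}) (tw t0 : n.-tuple bool).
Hypothesis g_gen : forall x, exists a, x = a *: g.
Hypothesis fg : Phi (f g) = basis tw.
Hypothesis tw_ends : ends_in false m tw.
Hypothesis t0_ends : ends_in true m t0.

(** The first residue is kappa1 for an arm and kappa1 - 1 for a leg. *)
Lemma weight_first (s t : n.-tuple bool) : weight k1 s = weight k1 t -> step s 1 = step t 1.
Proof.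
move=> /(congr1 (fun i => residue i 1)); rewrite !residue_weight ?n1 //.
rewrite /path_res /= => /addrI/oppr_inj.
have /negPf N1 : (1 : 'Z_e) != 0.
  by rewrite -[1]/(1%:R) natr_Ze_eq0 //; apply/negP => /dvdn_leq; lia.
by case: (step s 1); case: (step t 1) => // /eqP; rewrite ?(eq_sym 0) N1.
Qed.

(** Outside the image, [x] involves a path starting with a leg. By [weight_first] the idempotent of
    that path removes everything starting with an arm, so the target is reached exactly and not only
    modulo the image. *)
Lemma subquot_generated x : gamma x = 0 -> (forall x', f x' <> x) ->
  forall t, ends_in true m t -> exists a, supported (ends_in true m) (rep a *m Phi x) /\
    rep a *m Phi x = basis t.
Proof.
move=> /kernel_last_leg sx nim t et.
have [t1 [ut1 t1l]] : exists t1, coord (Phi x) t1 != 0 /\ step t1 1.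
  case: (EM (exists t1, coord (Phi x) t1 != 0 /\ step t1 1)) => // H; exfalso.
  have [|x' /nim//] := im_spanned mod_Phi fg tw_ends (x := x).
  apply: supported_ends => //; first exact: (model_supp mod_Phi).
  move=> s us; apply/eqP/negbTE/negP => sl; apply: H; by exists s.
set u := e_mx F k1 (weight k1 t1) *m Phi x.
have Eu s : coord u s = (weight k1 s == weight k1 t1)%:R * coord (Phi x) s.
  rewrite coord_mulmx (bigD1 s) //= big1 ?addr0 => [|s' ne].
    by rewrite e_mxE coordZ coord_basis eqxx mulr1 mulrC.
  by rewrite e_mxE coordZ coord_basis (negPf ne) !mulr0.
have u0 : u != 0.
  by apply: contraNneq ut1 => E; move: (Eu t1); rewrite E coord0 eqxx mul1r => <-.
have su : supported (ends_in true m) u.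
  apply: supported_ends => s; rewrite Eu mulf_eq0 negb_or => /andP[ws us].
  - exact: (model_supp mod_Phi us).
  - exact: sx.
  have [ew|ne] := eqVneq (weight k1 s) (weight k1 t1).
    by rewrite (weight_first ew) t1l.
  by rewrite (negPf ne) eqxx in ws.
have [a Ha] := reach_vector e3 n1 dv R u0 su et.
exists (a * gen_e R (weight k1 t1)); rewrite repM rep_idem -mulmxE -mulmxA Ha.
by split=> //; exact: supported_basis.
Qed.

Local Notation pi := (Defs.mpi (@restr_submod A M (lin_ker gamma) (lin_im f))).

Lemma subquot_irreducible : irreducible_module (subquot (lin_ker gamma) (lin_im f)).
Proof.
have kerP x : x \in lin_ker gamma <-> gamma x = 0 by split => /eqP.
have imP x : x \in lin_im f <-> exists x', f x' = x.
  by split => [/asboolP|H]; [|apply/asboolP].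
have pi0E (x : submod (lin_ker gamma)) : pi x = 0 <-> exists c, f c = val x.
  rewrite -imP; have -> : (pi x = 0) = (pi x = pi 0) by rewrite linear0.
  by rewrite mpiP subr0.
split.
  (* The path [t0], from leg to leg, lies in the kernel, while the image involves only paths
     starting with an arm. *)
  have szt0 : size (legs t0) = m by have /and3P[_ _ /eqP] := t0_ends.
  have [x0 Hx0] := model_surj mod_Phi szt0.
  have kx0 : x0 \in lin_ker gamma.
    apply/kerP/kernel_last_leg; rewrite Hx0; apply: supported_basis.
    by have /and3P[] := t0_ends.
  pose y0 : submod (lin_ker gamma) := Sub x0 kx0.
  have valy0 : val y0 = x0 by exact: SubK.
  exists (pi y0); apply/eqP => /pi0E[c Hc].
  have := @im_first_arm M m Phi mod_Phi N g f tw g_gen fg tw_ends c t0.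
  rewrite Hc; have -> : Phi (val y0) = basis t0 by rewrite -Hx0 -valy0.
  rewrite coord_basis eqxx oner_eq0 => /(_ isT) /and3P[].
  by have /and3P[/eqP->] := t0_ends.
move=> U; have [[q [qU q0]]|H] := EM (exists q, q \in U /\ q != 0); last first.
  by left=> q qU; apply/eqP/negPn/negP => q0; case: H; exists q.
right=> q'; move: q qU q0 => q.
rewrite -(mpi_surj q) -(mpi_surj q'); move: (repr _) (repr _) => x' x qU q0.
have gx : gamma (val x) = 0 by apply/kerP/(valP x).
have gx' : gamma (val x') = 0 by apply/kerP/(valP x').
have nim c : f c <> val x.
  by move=> Hc; case/eqP: q0; apply/pi0E; exists c.
(* Modulo the image, each path of [x'] is either zero or a multiple of [x], according to its first
   step. *)
have [a Ha] : exists a, supported (ends_in false m) (Phi (val x') - rep a *m Phi (val x)).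
  have sx' : supported (fun t => step t n && (size (legs t) == m)) (Phi (val x')).
    move=> t ut; rewrite (model_supp mod_Phi ut) andbT.
    by have /kernel_last_leg := gx'; apply.
  apply: (supported_ind (P := fun u => exists a,
    supported (ends_in false m) (u - rep a *m Phi (val x))) _ _ _ _ sx').
  - exists (gen_sc R 0); rewrite rep_sc mul_scalar_mx scale0r subr0; exact: supported0.
  - move=> u v [a Ha] [b Hb]; exists (a + b); rewrite repD mulmxDl opprD addrACA.
    exact: supportedD.
  - move=> c u [a Ha]; exists (gen_sc R c * a).
    rewrite repM rep_sc -mulmxE -mulmxA mul_scalar_mx -scalerBr; exact: supportedZ.
  move=> t /andP[tn szt]; case t1 : (step t 1).
    have [|a [_ Ha]] := subquot_generated gx nim (t := t); first by rewrite /ends_in t1 tn szt.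
    by exists a; rewrite Ha subrr; exact: supported0.
  exists (gen_sc R 0); rewrite rep_sc mul_scalar_mx scale0r subr0.
  by apply: supported_basis; rewrite /ends_in t1 tn szt.
have [|c Hc] := im_spanned mod_Phi fg tw_ends (x := val x' - a *: val x).
  by rewrite (modelD mod_Phi) (modelN mod_Phi) (modelZ mod_Phi).
have -> : pi x' = a *: pi x.
  rewrite -[RHS]linearZ; apply/subr0_eq; rewrite -linearB; apply/pi0E; exists c.
  by rewrite Hc linearB linearZ.
exact: rpredZ.
Qed.

End Kernel.
End AbstractIrreducibility.

(** * The cyclotomic algebra *)

Section CycRep.
Variables (F : fieldType) (e n : nat) (k1 : 'Z_e).
Hypothesis e3 : (3 <= e)%N.
Local Notation E := 'M[F]_((dimV n).+1).
Local Notation basis := (@basis n F).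
Local Notation psi_mx := (psi_mx F e n).
Local Notation y_mx := (y_mx F e n).
Local Notation e_mx := (@e_mx F e n k1).
Local Notation free := (klr_free F e n).
Local Notation cyc := (cyc_alg F n k1 (k1 - 1)).
Local Notation pi := (@cyc_pi F e n k1 (k1 - 1)).

Definition gen_mx (g : klr_gen e n) : E :=
  match g with
  | inl (inl i) => e_mx i
  | inl (inr r) => y_mx (val r)
  | inr r => psi_mx (val r)
  end.

Definition monom_mx (m : {fmonom klr_gen e n}) : E :=
  \prod_(g <- (m : seq (klr_gen e n))) gen_mx g.

Fact monom_mx_is_mmorphism : mmorphism monom_mx.
Proof.
by split=> [m1 m2|]; rewrite /monom_mx ?fmM ?fm1 ?big_cat ?big_nil.
Qed.
HB.instance Definition _ := isMultiplicative.Build _ _ monom_mx monom_mx_is_mmorphism.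

Definition free_mx : free -> E := mmap (@scalar_mx F (dimV n).+1) monom_mx.

Lemma free_mxD x y : free_mx (x + y) = free_mx x + free_mx y.
Proof. exact: raddfD. Qed.

Lemma free_mxN x : free_mx (- x) = - free_mx x.
Proof. exact: raddfN. Qed.

Lemma free_mxM x y : free_mx (x * y) = free_mx x * free_mx y.
Proof.
have [mulf _] := @commr_mmap_is_multiplicative _ _ _ (@scalar_mx F (dimV n).+1) monom_mx
  (fun g m m' => esym (scalar_mxC (g@_m) (monom_mx m'))).
exact: mulf.
Qed.

Lemma free_mxC c : free_mx c%:MP = c%:M.
Proof. exact: mmapC. Qed.

Lemma free_mx1 : free_mx 1 = 1.
Proof. exact: mmap1. Qed.

Lemma free_mx_gen g : free_mx (free_gen F g) = gen_mx g.
Proof.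
by rewrite /free_mx /free_gen mmapU /monom_mx fmU big_seq1 mul1r.
Qed.

Lemma free_mx_e i : free_mx (free_e F i) = e_mx i.
Proof. exact: free_mx_gen. Qed.

Lemma free_mx_y r : free_mx (free_y F e n r) = y_mx r.
Proof.
rewrite /free_y; case: insubP => [r' _ <-|nr]; first exact: free_mx_gen.
by rewrite /y_mx (negPf nr); exact: raddf0.
Qed.

Lemma free_mx_psi r : free_mx (free_psi F e n r) = psi_mx r.
Proof.
rewrite /free_psi; case: insubP => [r' _ <-|nr]; first exact: free_mx_gen.
by rewrite /psi_mx (negPf nr); exact: raddf0.
Qed.

Lemma free_mx_nat k : free_mx k%:R = k%:R.
Proof. by elim: k => [|k IH]; [exact: raddf0|rewrite -!natr1 free_mxD IH free_mx1]. Qed.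

Lemma free_mx_sum (I : Type) (s : seq I) (f : I -> free) :
  free_mx (\sum_(i <- s) f i) = \sum_(i <- s) free_mx (f i).
Proof. exact: raddf_sum. Qed.

Lemma free_mxM_eq x y X Y : free_mx x = X -> free_mx y = Y -> free_mx (x * y) = X * Y.
Proof. by move=> <- <-; exact: free_mxM. Qed.

Lemma free_mxD_eq x y X Y : free_mx x = X -> free_mx y = Y -> free_mx (x + y) = X + Y.
Proof. by move=> <- <-; exact: free_mxD. Qed.

Lemma free_mxN_eq x X : free_mx x = X -> free_mx (- x) = - X.
Proof. by move=> <-; exact: free_mxN. Qed.

(* Rewriting with free_mxM makes unification unfold the free algebra, so the
   value of free_mx is computed by syntactic matching instead. *)
Ltac eval_free := lazymatch goal with
  | |- free_mx (_ * _) = _ => apply: free_mxM_eq; eval_free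
  | |- free_mx (_ ^+ 2) = _ => apply: free_mxM_eq; eval_free
  | |- free_mx (_ + _) = _ => apply: free_mxD_eq; eval_free
  | |- free_mx (- _) = _ => apply: free_mxN_eq; eval_free
  | |- free_mx (free_e _ _) = _ => exact: free_mx_e
  | |- free_mx (free_y _ _ _ _) = _ => exact: free_mx_y
  | |- free_mx (free_psi _ _ _ _) = _ => exact: free_mx_psi
  | |- free_mx (nat_of_bool _)%:R = _ => exact: free_mx_nat
  | |- free_mx 1 = _ => exact: free_mx1
  | |- free_mx 0 = _ => exact: raddf0
  end.

Lemma free_mx_rel u v : klr_rel u v -> free_mx u = free_mx v.
Proof.
case=> {u v}.
- move=> i j; transitivity (e_mx i * e_mx j); first by eval_free.
  by rewrite e_mx_mul; symmetry; eval_free.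
- transitivity (\sum_i e_mx i); last by rewrite e_mx_sum; symmetry; eval_free.
  by rewrite free_mx_sum; apply: eq_bigr => i _; eval_free.
- move=> r i _; transitivity (y_mx r * e_mx i); first by eval_free.
  by rewrite y_e_mx //; symmetry; eval_free.
- move=> r i r1n; transitivity (psi_mx r * e_mx i); first by eval_free.
  by rewrite psi_e_mx //; symmetry; eval_free.
- move=> r s _ _; transitivity (y_mx r * y_mx s); first by eval_free.
  by rewrite y_mxC //; symmetry; eval_free.
- move=> r s _ _ n1 n2; transitivity (psi_mx r * y_mx s); first by eval_free.
  by rewrite psi_y_mx_far //; symmetry; eval_free.
- move=> r s _ _ lt; transitivity (psi_mx r * psi_mx s); first by eval_free.
  transitivity (psi_mx s * psi_mx r); last by symmetry; eval_free.
  by case/orP: lt => lt; [|symmetry]; apply: psi_mx_far.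
- move=> r i r1n; transitivity (psi_mx r * y_mx r.+1 * e_mx i); first by eval_free.
  by rewrite psi_y_mx //; symmetry; eval_free.
- move=> r i r1n; transitivity (y_mx r.+1 * psi_mx r * e_mx i); first by eval_free.
  by rewrite y_psi_mx //; symmetry; eval_free.
- move=> r i r1n; transitivity (psi_mx r ^+ 2 * e_mx i); first by eval_free.
  rewrite psi2_mx //; lazy zeta; symmetry.
  by case: ifP => _; [eval_free|case: ifP => _; [eval_free|case: ifP => _; eval_free]].
- move=> r i r1 r1n.
  transitivity (psi_mx r * psi_mx r.+1 * psi_mx r * e_mx i); first by eval_free.
  rewrite braid_mx //; lazy zeta; symmetry.
  by case: ifP => _; [eval_free|case: ifP => _; eval_free].
Qed.

Lemma y1_basis t : y_mx 1 *m basis t = 0.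
Proof.
rewrite /y_mx; case: ifP => n1; last by rewrite mul0mx.
rewrite mx_ofE local_word4 ?size_word //; last exact: y_rule_size.
rewrite word4 !nth_zlist // (_ : step t 0 = true) //=.
by rewrite andbF (_ : (e %| 0 + 1)%N = false) //=; apply/negP => /dvdn_leq; lia.
Qed.

(** For a residue sequence that occurs, [i_1] is kappa1 or kappa2, so the exponent is positive, and
    y_1 acts by zero. *)
Lemma cyclotomic_mx i : (1 <= n)%N ->
  y_mx 1 ^+ charge_mult k1 (k1 - 1) (residue i 1) * e_mx i = 0.
Proof.
move=> n1; rewrite -[RHS](mul0r (e_mx i)); apply: mul_e_mx_ext => t <-.
rewrite residue_weight ?n1 // mul0mx.
have [c ->] : exists c, charge_mult k1 (k1 - 1) (path_res k1 (step t) 1) = c.+1.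
  rewrite /charge_mult /path_res /= addr0; case: (step t 1).
    by rewrite eqxx; exists (k1 == k1 - 1); rewrite addn1.
  by rewrite subr0 eqxx; exists (k1 - 1 == k1).
by rewrite exprSr -mulmxE -mulmxA y1_basis mulmx0.
Qed.

Lemma ideal_span_ker (R : pzRingType) (S : R -> Prop) (f : R -> E) :
  f 0 = 0 -> {morph f : x y / x + y} -> {morph f : x y / x * y} ->
  (forall s, S s -> f s = 0) -> forall x, ideal_span S x -> f x = 0.
Proof.
move=> f0 fD fM fS x; elim=> [//|y a s b _ IH Ss].
by rewrite fD IH !fM (fS s Ss) mulr0 mul0r addr0.
Qed.

Definition klr_mx (u : klr_alg F e n) : E := free_mx (repr (u : Quotient.quot _)).
Definition cyc_mx (u : cyc) : E := klr_mx (repr (u : Quotient.quot _)).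

(** Two representatives differ by an element of the ideal, which [free_mx] kills. *)
Lemma klr_mx_pi x : klr_mx (klr_pi x) = free_mx x.
Proof.
apply/subr0_eq; rewrite /klr_mx -free_mxN -free_mxD.
have := rpi_surj (klr_pi x) => /rpiP; move: (_ - _).
apply: ideal_span_ker => //; [exact: raddf0|exact: free_mxD|exact: free_mxM|].
by move=> _ [u [v [/free_mx_rel uv ->]]]; rewrite free_mxD free_mxN uv subrr.
Qed.

Lemma klr_pi_surj (u : klr_alg F e n) : exists x, u = klr_pi x.
Proof. by exists (repr (u : Quotient.quot _)); rewrite [RHS]rpi_surj. Qed.

Lemma cyc_pi_surj (u : cyc) : exists x, u = pi x.
Proof.
have [x Dx] := klr_pi_surj (repr (u : Quotient.quot _)).
by exists x; rewrite /cyc_pi -Dx rpi_surj.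
Qed.

Hypothesis n1 : (1 <= n)%N.

Lemma cyc_mx_pi x : cyc_mx (pi x) = free_mx x.
Proof.
have D a b : klr_mx (a + b) = klr_mx a + klr_mx b.
  have [x' ->] := klr_pi_surj a; have [y' ->] := klr_pi_surj b.
  by rewrite /klr_pi -rpiD !klr_mx_pi free_mxD.
have M a b : klr_mx (a * b) = klr_mx a * klr_mx b.
  have [x' ->] := klr_pi_surj a; have [y' ->] := klr_pi_surj b.
  by rewrite /klr_pi -rmorphM !klr_mx_pi free_mxM.
have Z : klr_mx 0 = 0 by rewrite -[0](rmorph0 (rpi _)) klr_mx_pi; exact: raddf0.
rewrite -klr_mx_pi; apply/subr0_eq; rewrite /cyc_mx.
have N a : klr_mx (- a) = - klr_mx a.
  by apply/eqP; rewrite -addr_eq0 -D addNr Z.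
rewrite -N -D; have := rpi_surj (pi x) => /rpiP; move: (_ - klr_pi x).
apply: (@ideal_span_ker (klr_alg F e n) _ klr_mx Z D M) => _ [i ->].
rewrite klr_mx_pi free_mxM free_mx_e -(cyclotomic_mx i n1); congr (_ * _).
elim: charge_mult => [|c IH]; first by rewrite !expr0 free_mx1.
by rewrite !exprS free_mxM IH free_mx_y.
Qed.

Lemma cyc_mxD u v : cyc_mx (u + v) = cyc_mx u + cyc_mx v.
Proof.
have [x ->] := cyc_pi_surj u; have [y ->] := cyc_pi_surj v.
by rewrite /cyc_pi -!rmorphD [LHS]cyc_mx_pi !cyc_mx_pi free_mxD.
Qed.

Lemma cyc_mxM u v : cyc_mx (u * v) = cyc_mx u * cyc_mx v.
Proof.
have [x ->] := cyc_pi_surj u; have [y ->] := cyc_pi_surj v.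
by rewrite /cyc_pi -!rmorphM [LHS]cyc_mx_pi !cyc_mx_pi free_mxM.
Qed.

Lemma cyc_mx1 : cyc_mx 1 = 1.
Proof. by rewrite -free_mx1 -cyc_mx_pi /cyc_pi /klr_pi !rmorph1. Qed.

Lemma cyc_mx_psi r : cyc_mx (cyc_psi F n k1 (k1 - 1) r) = psi_mx r.
Proof. by rewrite cyc_mx_pi free_mx_psi. Qed.

Lemma cyc_mx_y r : cyc_mx (cyc_y F n k1 (k1 - 1) r) = y_mx r.
Proof. by rewrite cyc_mx_pi free_mx_y. Qed.

Lemma cyc_mx_e i : cyc_mx (cyc_e F k1 (k1 - 1) i) = e_mx i.
Proof. by rewrite cyc_mx_pi free_mx_e. Qed.

Lemma cyc_mx_scalar c : cyc_mx (pi c%:MP) = c%:M.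
Proof. by rewrite cyc_mx_pi free_mxC. Qed.

End CycRep.

(** * Generators and relations in the cyclotomic algebra *)

Section CycGenerators.
Variables (F : fieldType) (e n : nat) (k1 k2 : 'Z_e).
Local Notation cyc := (cyc_alg F n k1 k2).
Local Notation pi := (@cyc_pi F e n k1 k2).

Lemma cyc_piD x y : pi (x + y) = pi x + pi y.
Proof. by rewrite /cyc_pi /klr_pi !rmorphD. Qed.

Lemma cyc_piN x : pi (- x) = - pi x.
Proof. by rewrite /cyc_pi /klr_pi !rmorphN. Qed.

Lemma cyc_piM x y : pi (x * y) = pi x * pi y.
Proof. exact: etrans (congr1 _ (rpiM _ x y)) (rpiM _ _ _). Qed.

Lemma cyc_pi0 : pi 0 = 0.
Proof. by rewrite /cyc_pi /klr_pi !rmorph0. Qed.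

Lemma cyc_pi1 : pi 1 = 1.
Proof. by rewrite /cyc_pi /klr_pi !rmorph1. Qed.

Lemma cyc_pi_rel u v : klr_rel u v -> pi u = pi v.
Proof.
move=> uv; congr (rpi _ _); apply/rpiP; rewrite -[_ - _]add0r -[u - v]mul1r -[1 * _]mulr1.
by apply: ideal_spanD; [constructor|exists u, v].
Qed.

Lemma malgC_central c (g : klr_free F e n) : c%:MP * g = g * c%:MP.
Proof.
rewrite [g]monalgE mulr_sumr mulr_suml; apply: eq_bigr => k _.
by rewrite !malgM_def fgmulUU fgmulUU mul1m mulm1 mulrC.
Qed.

Lemma cyc_scalarC c (a : cyc) : pi c%:MP * a = a * pi c%:MP.
Proof.
have [x ->] : exists x, a = pi x.
  have [x Dx] := klr_pi_surj (repr (a : Quotient.quot _)).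
  by exists x; rewrite /cyc_pi -Dx rpi_surj.
by rewrite -!cyc_piM malgC_central.
Qed.

Lemma cyc_alg_ind (P : cyc -> Prop) :
  (forall a b, P a -> P b -> P (a + b)) -> (forall a b, P a -> P b -> P (a * b)) ->
  (forall c, P (pi c%:MP)) -> (forall i, P (cyc_e F k1 k2 i)) ->
  (forall r, (1 <= r <= n)%N -> P (cyc_y F n k1 k2 r)) ->
  (forall r, (1 <= r < n)%N -> P (cyc_psi F n k1 k2 r)) ->
  forall a, P a.
Proof.
move=> PD PM Pc Pe Py Ppsi a.
have [x ->] : exists x, a = pi x.
  have [x Dx] := klr_pi_surj (repr (a : Quotient.quot _)).
  by exists x; rewrite /cyc_pi -Dx rpi_surj.
have P0 : P 0 by rewrite -cyc_pi0 -malgC0E.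
have Pmon (s : seq (klr_gen e n)) : P (pi << FMonom s >>).
  elim: s => [|g s IH].
  have E1 : mone = FMonom [::] :> {fmonom klr_gen e n} by exact: fmoneE.
  rewrite -E1. exact: (Pc 1).
  have -> : << FMonom (g :: s) >> = free_gen F g * << FMonom s >>.
    rewrite /free_gen malgM_def. rewrite fgmulUU mulr1. by rewrite /= fmuE /mmul /= fmmulE.
  rewrite cyc_piM; apply: PM IH; case: g => [[i|r]|r]; first exact: Pe.
    have /Py : (1 <= val r <= n)%N := valP r.
    by rewrite /cyc_y /free_y valK.
  have /Ppsi : (1 <= val r < n)%N := valP r.
  by rewrite /cyc_psi /free_psi valK.
rewrite [x]monalgE; apply: (big_ind (fun y => P (pi y))) => [||k _].
- by rewrite cyc_pi0.
- by move=> y z Py' Pz; rewrite cyc_piD; apply: PD.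
have -> : << x@_k *g k >> = (x@_k)%:MP * << k >> :> klr_free F e n.
  by rewrite malgM_def fgmulUU mulr1 mul1m.
rewrite cyc_piM. rewrite -[k]fmK. by apply: PM.
Qed.

End CycGenerators.

Section CycEval.
Variables (F : fieldType) (e n : nat) (k1 k2 : 'Z_e).
Local Notation pi := (@cyc_pi F e n k1 k2).

Lemma cyc_piM_eq x y X Y : pi x = X -> pi y = Y -> pi (x * y) = X * Y.
Proof. by move=> <- <-; exact: cyc_piM. Qed.

Lemma cyc_piD_eq x y X Y : pi x = X -> pi y = Y -> pi (x + y) = X + Y.
Proof. by move=> <- <-; exact: cyc_piD. Qed.

Lemma cyc_piN_eq x X : pi x = X -> pi (- x) = - X.
Proof. by move=> <-; exact: cyc_piN. Qed.

Lemma cyc_pi_nat (b : bool) : pi b%:R = b%:R.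
Proof. by case: b; [exact: cyc_pi1|exact: cyc_pi0]. Qed.

End CycEval.

Ltac eval_pi := lazymatch goal with
  | |- cyc_pi _ _ (_ * _) = _ => apply: cyc_piM_eq; eval_pi
  | |- cyc_pi _ _ (_ ^+ 2) = _ => apply: cyc_piM_eq; eval_pi
  | |- cyc_pi _ _ (_ + _) = _ => apply: cyc_piD_eq; eval_pi
  | |- cyc_pi _ _ (- _) = _ => apply: cyc_piN_eq; eval_pi
  | |- cyc_pi _ _ (nat_of_bool _)%:R = _ => exact: cyc_pi_nat
  | |- cyc_pi _ _ 1 = _ => exact: cyc_pi1
  | |- cyc_pi _ _ 0 = _ => exact: cyc_pi0
  | |- _ => reflexivity
  end.

Section CycKlrRep.
Variables (F : fieldType) (e n : nat) (k1 : 'Z_e).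
Hypothesis (e3 : (3 <= e)%N) (n1 : (1 <= n)%N).
Local Notation k2 := (k1 - 1).
Local Notation cyc := (cyc_alg F n k1 k2).
Local Notation pi := (@cyc_pi F e n k1 k2).
Local Notation psi := (cyc_psi F n k1 k2).
Local Notation y := (cyc_y F n k1 k2).
Local Notation idem := (@cyc_e F e n k1 k2).

Lemma cyc_idem_idem i j : idem i * idem j = (i == j)%:R * idem i.
Proof.
transitivity (pi (free_e F i * free_e F j)); first by symmetry; eval_pi.
by rewrite (cyc_pi_rel k1 k2 (klr_e_e F i j)); eval_pi.
Qed.

Lemma cyc_psi_idem r i : (1 <= r < n)%N ->
  psi r * idem i = idem (swap_residues r i) * psi r.
Proof.
move=> r1n; transitivity (pi (free_psi F e n r * free_e F i)); first by symmetry; eval_pi.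
by rewrite (cyc_pi_rel k1 k2 (klr_psi_e F i r1n)); eval_pi.
Qed.

Lemma cyc_psi_y_far r s : (1 <= r < n)%N -> (1 <= s <= n)%N -> s != r -> s != r.+1 ->
  psi r * y s = y s * psi r.
Proof.
move=> r1n s1n sr sr1; transitivity (pi (free_psi F e n r * free_y F e n s)).
  by symmetry; eval_pi.
by rewrite (cyc_pi_rel k1 k2 (klr_psi_y_far F e r1n s1n sr sr1)); eval_pi.
Qed.

Lemma cyc_psi_far r s : (r.+1 < s)%N || (s.+1 < r)%N -> psi r * psi s = psi s * psi r.
Proof.
move=> lt; case: (boolP (1 <= r < n)%N) => [r1n|nr]; last first.
  have -> : psi r = 0 by rewrite /cyc_psi /free_psi insubN //; exact: cyc_pi0.
  by rewrite mul0r mulr0.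
case: (boolP (1 <= s < n)%N) => [s1n|ns]; last first.
  have -> : psi s = 0 by rewrite /cyc_psi /free_psi insubN //; exact: cyc_pi0.
  by rewrite mul0r mulr0.
transitivity (pi (free_psi F e n r * free_psi F e n s)); first by symmetry; eval_pi.
by rewrite (cyc_pi_rel k1 k2 (klr_psi_psi_far F e r1n s1n lt)); eval_pi.
Qed.

Lemma cyc_psi_y r i : (1 <= r < n)%N -> psi r * y r.+1 * idem i =
  (y r * psi r + (residue i r == residue i r.+1)%:R) * idem i.
Proof.
move=> r1n; transitivity (pi (free_psi F e n r * free_y F e n r.+1 * free_e F i)).
  by symmetry; eval_pi.
by rewrite (cyc_pi_rel k1 k2 (klr_psi_y F i r1n)); eval_pi.
Qed.

Lemma cyc_y_psi r i : (1 <= r < n)%N -> y r.+1 * psi r * idem i =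
  (psi r * y r + (residue i r == residue i r.+1)%:R) * idem i.
Proof.
move=> r1n; transitivity (pi (free_y F e n r.+1 * free_psi F e n r * free_e F i)).
  by symmetry; eval_pi.
by rewrite (cyc_pi_rel k1 k2 (klr_y_psi F i r1n)); eval_pi.
Qed.

(** Straightening needs only that psi_r^2 does not raise lengths, so the dependence on residues is
    hidden in two integers; [cyc_braid] does the same. *)
Lemma cyc_psi2 r i : (1 <= r < n)%N -> exists c d : int,
  psi r ^+ 2 * idem i = (c%:~R * (y r - y r.+1) + d%:~R) * idem i.
Proof.
move=> r1n.
have := cyc_pi_rel k1 k2 (klr_psi2 F i r1n).
have -> : pi (free_psi F e n r ^+ 2 * free_e F i) = psi r ^+ 2 * idem i by eval_pi.
lazy zeta; case: ifP => _ => [E|].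
  by exists 0, 0; apply: etrans E _; rewrite !mulr0z mul0r addr0 mul0r; eval_pi.
case: ifP => _ => [E|].
  exists (-1), 0; apply: etrans E _.
  by rewrite mulrN1z mulr0z addr0 mulN1r opprB; eval_pi.
case: ifP => _ E.
  by exists 1, 0; apply: etrans E _; rewrite mulr1z mulr0z addr0 mul1r; eval_pi.
by exists 0, 1; apply: etrans E _; rewrite mulr0z mulr1z mul0r add0r mul1r.
Qed.

Lemma cyc_braid r i : (1 <= r)%N -> (r.+1 < n)%N -> exists c : int,
  psi r * psi r.+1 * psi r * idem i = (psi r.+1 * psi r * psi r.+1 + c%:~R) * idem i.
Proof.
move=> r1 r1n.
have := cyc_pi_rel k1 k2 (klr_braid F i r1 r1n).
have -> : pi (free_psi F e n r * free_psi F e n r.+1 * free_psi F e n r * free_e F i) =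
  psi r * psi r.+1 * psi r * idem i by eval_pi.
lazy zeta; case: ifP => _ => [E|].
  by exists 1; apply: etrans E _; rewrite mulr1z; eval_pi.
case: ifP => _ E.
  by exists (-1); apply: etrans E _; rewrite mulrN1z; eval_pi.
by exists 0; apply: etrans E _; rewrite mulr0z addr0; eval_pi.
Qed.

Definition cyc_sc c : cyc := pi c%:MP.

Lemma cyc_scD : {morph cyc_sc : c d / c + d}.
Proof. by move=> c d; rewrite /cyc_sc monalgUD; exact: cyc_piD. Qed.

Lemma cyc_scM : {morph cyc_sc : c d / c * d}.
Proof. by move=> c d; rewrite /cyc_sc mpolyCM; exact: cyc_piM. Qed.

Lemma cyc_sc1 : cyc_sc 1 = 1.
Proof. exact: cyc_pi1. Qed.

Definition cyc_klr_rep : klr_rep F n k1 cyc := KlrRep cyc_idem_idem cyc_psi_idem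
  cyc_psi_y_far cyc_psi_far cyc_psi_y cyc_y_psi cyc_psi2 cyc_braid cyc_scD cyc_scM cyc_sc1
  (@cyc_scalarC F e n k1 k2) (@cyc_alg_ind F e n k1 k2)
  (@cyc_mxD F e n k1 e3 n1) (@cyc_mxM F e n k1 e3 n1) (@cyc_mx1 F e n k1 e3 n1)
  (@cyc_mx_psi F e n k1 e3 n1) (@cyc_mx_y F e n k1 e3 n1) (@cyc_mx_e F e n k1 e3 n1)
  (@cyc_mx_scalar F e n k1 e3 n1).

End CycKlrRep.

(** * Models of the Specht modules *)

Section HookModules.
Variables (F : fieldType) (e n : nat) (k1 : 'Z_e).
Hypothesis (e3 : (3 <= e)%N) (n1 : (1 <= n)%N).
Local Notation k2 := (k1 - 1).
Local Notation cyc := (cyc_alg F n k1 k2).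
Local Notation R := (cyc_klr_rep F k1 e3 n1).
Local Notation basis := (@basis n F).

Lemma weight_low m : (m <= n)%N -> weight k1 (low_path n m) = hook2_residues n k1 k2 m.
Proof.
move=> lemn; apply: eq_seq_of_residues => r /andP[r1 rn].
(* The subtraction is truncated: no arm precedes position [m + 1]. *)
have arm k : arm_res k1 (step (low_path n m)) k = k1 + (k - m.+1)%:R.
  elim: k => [|k IH] /=; first by rewrite sub0n addr0.
  rewrite IH step_low // -addrA -natrD; congr (_ + _%:R).
  by case: leqP => /=; lia.
rewrite /path_res arm step_low //; case: leqP => rm.
  rewrite (_ : (r - m.+1 = 0)%N); last by lia.
  by rewrite addr0 natrB // opprB addrA subrK.
by rewrite subr0; congr (_ + _%:R); lia.
Qed.

(** In [low_path] no arm precedes a leg, so all y_r vanish on it, and psi_r can act only at the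
    leg-arm pair [r = m]. *)
Lemma hook2_rel_low m s : (m <= n)%N -> hook2_rel (k1 := k1) (k2 := k2) m s ->
  cyc_mx s *m basis (low_path n m) = 0.
Proof.
move=> lemn; case=> {s} [|r r1n|r r1n rm].
- have -> : cyc_e F k1 k2 (hook2_residues n k1 k2 m) - 1 =
      cyc_e F k1 k2 (hook2_residues n k1 k2 m) + @cyc_sc F e n k1 (-1).
    by rewrite -cyc_sc1 /cyc_sc monalgUN; congr (_ + _); symmetry; exact: cyc_piN.
  rewrite (cyc_mxD e3 n1) (cyc_mx_e F k1 e3 n1) (cyc_mx_scalar k1 e3 n1) mulmxDl.
  by rewrite e_mxE weight_low // eqxx scale1r mul_scalar_mx scaleN1r subrr.
- rewrite (cyc_mx_y F k1 e3 n1); case: r r1n => // b r1n.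
  rewrite y_mx_word4 // !step_low //.
  have nd c : ~~ (c <= m)%N && (c < m)%N = false by case: leqP => //; lia.
  by rewrite /y_rule !nd !andbF.
rewrite (cyc_mx_psi F k1 e3 n1); case: r r1n rm => // b r1n rm.
rewrite psi_mx_word4 // !step_low // /psi_rule.
case: (leqP b.+1 m) => bm /=; last first.
  have -> : (b.+1 < m)%N = false by lia.
  have -> : (b.+2 < m)%N = false by lia.
  by rewrite !andbF; do !case: ifP => _.
have -> : (b.+1 < m)%N by rewrite ltn_neqAle rm.
by rewrite (ltnW bm) /=; do !case: ifP => _.
Qed.

Lemma hook2_model m : (m <= n)%N ->
  exists Phi : hook2_specht F n k1 k2 m -> 'cV[F]_((dimV n).+1),
    hook_model R m Phi /\ Phi (hook2_gen F n k1 k2 m) = basis (low_path n m).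
Proof.
move=> lemn.
have [Phi [PhiD PhiZ Phiz]] := cyclic_map_ex (A := cyc) (S := hook2_rel m)
  (rep := rep R) (v := basis (low_path n m)) (repD R) (repM R)
  (fun s => @hook2_rel_low m s lemn).
rewrite rep1 mul1mx in Phiz.
exists Phi; split=> //.
have rel (a : cyc) : hook2_rel m a -> a *: (hook2_gen F n k1 k2 m) = 0.
  exact: cyclic_relation.
apply: (@hook_model_ex F e n k1 cyc R _ m (hook2_gen F n k1 k2 m) Phi e3 lemn) => //.
- exact: (cyclic_surj (S := hook2_rel m)).
- rewrite weight_low //.
  have /eqP := rel _ (hook2_e F n k1 k2 m).
  by rewrite scalerBl scale1r subr_eq0 => /eqP.
- by move=> r r1n; exact: rel _ (hook2_y _ _ _ _ r1n).
by move=> r r1n rm; exact: rel _ (hook2_psi _ _ _ r1n rm).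
Qed.

Lemma model_hook2_v m (Phi : hook2_specht F n k1 k2 m -> 'cV[F]_((dimV n).+1))
    (t : n.-tuple bool) s : (m <= n)%N ->
  hook_model R m Phi -> Phi (hook2_gen F n k1 k2 m) = basis (low_path n m) ->
  legs t = s -> size s = m -> Phi (hook2_v F n k1 k2 m s) = basis t.
Proof.
move=> lemn mod_Phi Phiz ts szs; rewrite /hook2_v (modelZ mod_Phi) Phiz.
rewrite -(rep_psi_word R lemn (t := t)) ts //; congr (rep R _ *m _).
rewrite -psi_word_prod szs add1n; apply: eq_big_nat => i _.
by rewrite subn1.
Qed.

End HookModules.

Theorem proposition6p15 (F : fieldType) (e n : nat) (kappa1 kappa2 : 'Z_e) :
  (3 <= e)%N -> (1 <= n)%N ->
  kappa2 = kappa1 - 1 -> (e %| n)%N ->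
  (forall m : nat, (1 <= m <= n.-1)%N ->
    forall phi : {linear hook1_specht F n kappa1 kappa2 m.-1
                         -> hook2_specht F n kappa1 kappa2 m},
    is_phi phi ->
    irreducible_module (submod (lin_im phi))) /\
  (forall m : nat, (2 <= m <= n.-1)%N ->
    forall (phi : {linear hook1_specht F n kappa1 kappa2 m.-1
                          -> hook2_specht F n kappa1 kappa2 m})
           (gamma : {linear hook2_specht F n kappa1 kappa2 m
                            -> hook2_specht F n kappa1 kappa2 m.+1}),
    is_phi phi -> is_gamma gamma ->
    irreducible_module (subquot (lin_ker gamma) (lin_im phi))).
Proof.
(* [tw m] has legs 2, ..., m, n and labels the image of the generator under phi_m; the disjunct
   [k == 0] respects the convention that step 0 is a leg. *)
move=> e3 n1 -> dv; pose tw m := add_last (path_of n (fun k => (k == 0%N) || (2 <= k <= m)%N)).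
have tw_legs m : (1 <= m < n)%N -> legs (tw m) = rcons (index_iota 2 m.+1) n.
  move=> /andP[m1 mn].
  have stepE k : step (path_of n (fun k => (k == 0%N) || (2 <= k <= m)%N)) k =
      (k == 0%N) || (2 <= k <= m)%N.
    by rewrite path_ofK //; split=> // l ltnl; lia.
  rewrite legs_add_last ?stepE //; last by lia.
  congr rcons; rewrite /legs (eq_filter stepE).
  have -> : iota 1 n = iota 1 1 ++ iota 2 (m - 1) ++ iota m.+1 (n - m).
    rewrite (_ : n = 1 + ((m - 1) + (n - m)))%N; last by lia.
    by rewrite !iotaD; congr (_ ++ (_ ++ iota _ _)); lia.
  rewrite !filter_cat.
  have -> : filter (fun k => (k == 0%N) || (2 <= k <= m)%N) (iota m.+1 (n - m)) = [::].
    apply/eqP; rewrite -[_ == _]negbK -has_filter -all_predC; apply/allP => k.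
    by rewrite mem_iota /=; lia.
  rewrite cats0 /=; apply/all_filterP/allP => k; rewrite mem_iota; lia.
have tw_size m : (1 <= m < n)%N -> size (rcons (index_iota 2 m.+1) n) = m.
  by move=> m1n; rewrite size_rcons size_iota; lia.
have tw_ends m : (1 <= m < n)%N -> ends_in false m (tw m).
  move=> m1n; rewrite /ends_in tw_legs // tw_size // !step_add_last // !eqxx andbT /=.
  by rewrite path_ofE //=; apply/eqP; lia.
have fg m (Phi : hook2_specht F n kappa1 (kappa1 - 1) m -> 'cV[F]_((dimV n).+1)) 
   (phi : {linear hook1_specht F n kappa1 (kappa1 - 1) m.-1
                  -> hook2_specht F n kappa1 (kappa1 - 1) m}) :
   (1 <= m < n)%N -> is_phi phi -> hook_model (cyc_klr_rep F kappa1 e3 n1) m Phi ->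
   Phi (hook2_gen F n kappa1 (kappa1 - 1) m) = basis F (low_path n m) ->
   Phi (phi (hook1_gen F n kappa1 (kappa1 - 1) m.-1)) = basis F (tw m).
  move=> m1n Hphi mod_Phi Phiz; rewrite Hphi.
  by apply: (model_hook2_v _ mod_Phi Phiz (tw_legs m m1n) (tw_size m m1n)); lia.
split=> m mn.
  move=> phi Hphi; have m1n : (1 <= m < n)%N by lia.
  have [|Phi [mod_Phi Phiz]] := @hook2_model F e n kappa1 e3 n1 m; first by lia.
  apply: (im_irreducible e3 n1 dv mod_Phi _ (fg m Phi phi m1n Hphi mod_Phi Phiz) (tw_ends m m1n)).
  exact: (cyclic_surj (S := hook1_rel m.-1)).
move=> phi gamma Hphi Hgamma; have m1n : (1 <= m < n)%N by lia.
have ltmn : (m < n)%N by lia.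
have [|Phi [mod_Phi Phiz]] := @hook2_model F e n kappa1 e3 n1 m; first by lia.
have [|Phi' [mod_Phi' Phiz']] := @hook2_model F e n kappa1 e3 n1 m.+1; first by [].
have gammaz : Phi' (gamma (hook2_gen F n kappa1 (kappa1 - 1) m)) =
    basis F (add_last (low_path n m)).
  rewrite Hgamma; apply: (model_hook2_v _ mod_Phi' Phiz') => //.
    by rewrite legs_add_last ?step_low ?legs_low // ?(ltnW ltmn) // -?ltnNge // /index_iota subn1.
  by rewrite size_rcons size_iota subn1.
(* The legs are 1, ..., m-1, n; here [m >= 2] ensures that step 1 is a leg. *)
have t0_ends : ends_in true m (add_last (low_path n m.-1)).
  have lem : (m.-1 <= n)%N by lia.
  have ltm : (m.-1 < n)%N by lia.
  rewrite /ends_in legs_add_last ?step_low // -?ltnNge // !step_add_last // !step_low //.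
  by rewrite size_rcons legs_low // size_iota eqxx; apply/and3P; split=> //; apply/eqP; lia.
apply: (subquot_irreducible e3 n1 dv ltmn mod_Phi mod_Phi' Phiz gammaz _
  (fg m Phi phi m1n Hphi mod_Phi Phiz) (tw_ends m m1n) t0_ends).
exact: (cyclic_surj (S := hook1_rel m.-1)).
Qed.
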